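(* Let $(b,c)$ be a connected transient graph over $X$. Then the following assertions are equivalent. (ii.a) $Gc(x)=1$ for some (equivalently, all) $x\in X$. (iii.a) The graph $(b,c)$ is stochastically complete at infinity and for some (equivalently, all) $x\in X$ $$\lim_{t\to\infty}e^{-tL}1(x)=\lim_{t\to\infty}\sum_{y\in X}e^{-tL}1_x(y)=0.$$ (iii.b) We have for some (equivalently, all) $x\in X$ $$\mathbb{P}_x\Big(\int_0^\zeta c(\mathbb{X}_t)\,dt=\infty\Big)=1.$$
   Context: Let $X$ be a countable set. A graph $(b,c)$ over $X$ consists of a symmetric function $b:X\times X\to[0,\infty)$ with $b(x,x)=0$ and $\sum_{y\in X}b(x,y)<\infty$ for all $x\in X$, and a function $c:X\to[0,\infty)$ (the killing term); one writes $b$ for $(b,0)$. The graph is connected if for all $x,y\in X$ there are $x=y_1,\dots,y_{n+1}=y$ with $b(y_i,y_{i+1})>0$ for $1\le i\le n$. Let $\mathcal{L}f(x)=\sum_y b(x,y)(f(x)-f(y))+c(x)f(x)$ for $f:X\to\mathbb{R}$ with $\sum_yb(x,y)|f(y)|<\infty$ for all $x$. Let $\mathcal{Q}(f)=\frac12\sum_{x,y}b(x,y)(f(x)-f(y))^2+\sum_x c(x)f(x)^2$, $\mathcal{D}=\{f:X\to\mathbb{R}\mid\mathcal{Q}(f)<\infty\}$, and let $\mathcal{D}_0$ be the closure of the finitely supported functions in $\mathcal{D}$ with respect to $\|f\|_o=\sqrt{\mathcal{Q}(f)+|f(o)|^2}$ for a fixed $o\in X$. Let $L$ be the positive self-adjoint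 operator on $\ell^2(X)$ (counting measure) associated with the closed form obtained by restricting $\mathcal{Q}$ to $\mathcal{D}_0\cap\ell^2(X)$. Its semigroup is extended to bounded or positive functions $f$ by $e^{-tL}f(x)=\sum_y(e^{-tL}1_y)(x)f(y)$, where $1_y=1_{\{y\}}$ (values in $[0,\infty]$ for positive $f$). The connected graph $(b,c)$ is transient if for every $y\in X$ there is a unique $G_y\in\mathcal{D}_0$ with $\mathcal{L}G_y=1_y$. Then $G(x,y)=G_y(x)$ and $Gc(x)=\sum_yG(x,y)c(y)$. The graph $(b,c)$ is stochastically complete at infinity if for some (equivalently all) $t>0$ and some (equivalently all) $x\in X$, $M_t(x)=e^{-tL}1(x)+\int_0^t(e^{-sL}c)(x)\,ds=1$. $(\mathbb{X}_t)$ denotes the Markov process associated with the graph $b=(b,0)$ without killing term (and the counting measure): the minimal continuous-time Markov chain on $X$ with jump rates $b(x,y)$ from $x$ to $y$, started at $x$ under $\mathbb{P}_x$, with lifetime (explosion time) $\zeta\in(0,\infty]$. *)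

(* Defs.v *)
From HB Require Import structures.
From mathcomp Require Import all_boot all_order all_algebra.
From mathcomp Require Import all_classical all_reals all_analysis.
From mathcomp Require Import measurable_realfun.

Set Implicit Arguments.
Unset Strict Implicit.
Unset Printing Implicit Defensive.

Import Order.TTheory GRing.Theory Num.Theory numFieldNormedType.Exports.

Local Open Scope classical_set_scope.
Local Open Scope ring_scope.

(* [esum] is a supremum of finite partial sums, so it is the sum of a family
   only when the family is nonnegative.  The real sum below is the sum of an
   absolutely summable family of arbitrary sign; it is a junk value on other
   families. *)
Definition rsum (R : realType) (I : choiceType) (f : I -> R) : R :=
  fine (\esum_(i in [set: I]) (f^\+ i)%:E)%E
  - fine (\esum_(i in [set: I]) (f^\- i)%:E)%E.

Record graph (X : countType) (R : realType) := Graph {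
  b : X -> X -> R;
  c : X -> R;
  b_ge0 : forall x y, 0 <= b x y;
  b_sym : forall x y, b x y = b y x;
  b_diag : forall x, b x x = 0;
  b_summable : forall x, (\esum_(y in [set: X]) (b x y)%:E < +oo)%E;
  c_ge0 : forall x, 0 <= c x }.

Section Graphs.
Context (R : realType) (X : countType) (g : graph X R).

Definition connected_graph : Prop :=
  forall x y : X, exists s : seq X,
    path (fun u v => 0 < b g u v) x s && (last x s == y).

Definition ind (y : X) : X -> R := fun x => (x == y)%:R.

Definition formal_dom (f : X -> R) : Prop :=
  forall x, (\esum_(y in [set: X]) (b g x y * `|f y|)%:E < +oo)%E.

Definition laplacian (f : X -> R) (x : X) : R :=
  rsum (fun y => b g x y * (f x - f y)) + c g x * f x.

Definition energy (f : X -> R) : \bar R :=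
  ((2^-1)%:E *
     \esum_(p in [set: X * X]) (b g p.1 p.2 * (f p.1 - f p.2) ^+ 2)%:E
   + \esum_(x in [set: X]) (c g x * f x ^+ 2)%:E)%E.

Definition finite_energy (f : X -> R) : Prop := (energy f < +oo)%E.

(* The polarization of [energy]. *)
Definition energy2 (f h : X -> R) : R :=
  2^-1 * rsum (fun p : X * X =>
                 b g p.1 p.2 * (f p.1 - f p.2) * (h p.1 - h p.2))
  + rsum (fun x => c g x * f x * h x).

(* Meaningful on functions of finite energy, as [fine +oo = 0]. *)
Definition norm_o (o : X) (f : X -> R) : R :=
  Num.sqrt (fine (energy f) + `|f o| ^+ 2).

Definition D0 (o : X) (f : X -> R) : Prop :=
  finite_energy f /\
  forall e : R, 0 < e -> exists phi : X -> R,
    finite_set [set x | phi x != 0] /\ norm_o o (fun x => f x - phi x) < e.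

Definition l2 (f : X -> R) : Prop :=
  (\esum_(x in [set: X]) (f x ^+ 2)%:E < +oo)%E.

Definition l2norm (f : X -> R) : R :=
  Num.sqrt (fine (\esum_(x in [set: X]) (f x ^+ 2)%:E)%E).

Definition l2dot (f h : X -> R) : R := rsum (fun x => f x * h x).

(* [opL o f h] : f is in the domain of the self-adjoint operator L associated
   with the restriction of the energy form to D0 /\ l2, and L f = h. *)
Definition opL (o : X) (f h : X -> R) : Prop :=
  [/\ D0 o f, l2 f, l2 h &
      forall u, D0 o u -> l2 u -> energy2 f u = l2dot h u].

(* [semigroup_of A T] : T is the strongly continuous semigroup of symmetric
   contractions of l2 with generator -A, i.e. T t = e^{-tA} for t >= 0, for A
   a positive self-adjoint operator given by its graph.  The values of T
   outside l2 and at negative times are irrelevant. *)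
Record semigroup_of (A : (X -> R) -> (X -> R) -> Prop)
    (T : R -> (X -> R) -> (X -> R)) : Prop := SemigroupOf {
  sg_l2 : forall t f, 0 <= t -> l2 f -> l2 (T t f);
  sg_linear : forall t a f h, 0 <= t -> l2 f -> l2 h ->
    T t (fun x => a * f x + h x) = (fun x => a * T t f x + T t h x);
  sg_symmetric : forall t f h, 0 <= t -> l2 f -> l2 h ->
    l2dot (T t f) h = l2dot f (T t h);
  sg_contraction : forall t f, 0 <= t -> l2 f -> l2norm (T t f) <= l2norm f;
  sg_id : forall f, l2 f -> T 0 f = f;
  sg_comp : forall s t f, 0 <= s -> 0 <= t -> l2 f ->
    T (s + t) f = T s (T t f);
  sg_continuous : forall f, l2 f ->
    l2norm (fun x => T t f x - f x) @[t --> 0^'+] --> (0 : R);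
  sg_generator : forall f h, l2 f -> l2 h ->
    (A f h <->
     l2norm (fun x => t^-1 * (f x - T t f x) - h x) @[t --> 0^'+]
       --> (0 : R)) }.

(* The extension of the semigroup T to functions f >= 0. *)
Definition sg_ext (T : R -> (X -> R) -> (X -> R)) (t : R) (f : X -> R)
    (x : X) : \bar R :=
  (\esum_(y in [set: X]) (T t (ind y) x * f y)%:E)%E.

Definition is_green (o y : X) (u : X -> R) : Prop :=
  [/\ D0 o u, formal_dom u & laplacian u = ind y].

Definition transient (o : X) : Prop :=
  forall y, exists! u : X -> R, is_green o y u.

(* The default value 0 is never used when the graph is transient. *)
Definition green (o x y : X) : R :=
  xget ((fun=> 0) : X -> R) [set u | is_green o y u] x.

Definition green_c (o x : X) : \bar R :=
  (\esum_(y in [set: X]) (green o x y * c g y)%:E)%E.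

Definition Mt (T : R -> (X -> R) -> (X -> R)) (t : R) (x : X) : \bar R :=
  (sg_ext T t (fun=> 1%R) x
   + \int[lebesgue_measure]_(s in `[0%R, t]) sg_ext T s (c g) x)%E.

Definition stoch_complete_some (T : R -> (X -> R) -> (X -> R)) : Prop :=
  exists t x, 0 < t /\ Mt T t x = 1%E.

Definition stoch_complete_all (T : R -> (X -> R) -> (X -> R)) : Prop :=
  forall t x, 0 < t -> Mt T t x = 1%E.

Definition heat_vanishes_at (T : R -> (X -> R) -> (X -> R)) (x : X) : Prop :=
  (sg_ext T t (fun=> 1) x @[t --> +oo] --> 0%E) /\
  ((\esum_(y in [set: X]) (T t (ind x) y)%:E)%E @[t --> +oo] --> 0%E).

(* The total jump rate at x, for the graph without killing. *)
Definition jump_rate (x : X) : R :=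
  fine (\esum_(y in [set: X]) (b g x y)%:E)%E.

(* A vertex with jump rate 0 is absorbing. *)
Definition jump_prob (x y : X) : R :=
  if jump_rate x == 0 then (x == y)%:R else b g x y / jump_rate x.

Section Chain.
Context (d : measure_display) (Omega : measurableType d).

(* The minimal chain is built from its successive states Y n and its
   holding times S n: under P x, Y is a Markov chain started at x with
   transition probabilities [jump_prob], and given Y the S n are independent
   exponential variables of parameters [jump_rate (Y n)] (parameter 0 means
   S n = +oo almost surely). *)
Record minimal_chain (P : X -> probability Omega R)
    (Y : nat -> Omega -> X) (S : nat -> Omega -> \bar R) : Prop :=
  MinimalChain {
  chain_measurable : forall n y, measurable [set w | Y n w = y];
  holding_measurable : forall n, measurable_fun [set: Omega] (S n);
  holding_gt0 : forall n w, (0 < S n w)%E;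
  chain_law : forall x n (y : nat -> X),
    P x [set w | forall i, (i <= n)%N -> Y i w = y i] =
    ((x == y 0%N)%:R * \prod_(i < n) jump_prob (y i) (y i.+1))%:E;
  holding_law : forall x n (y : nat -> X) (s : nat -> R),
    (forall i, 0 <= s i) ->
    P x [set w | forall i, (i <= n)%N -> Y i w = y i /\ ((s i)%:E < S i w)%E] =
    (P x [set w | forall i, (i <= n)%N -> Y i w = y i] *
     (\prod_(i < n.+1) expR (- (jump_rate (y i) * s i)))%:E)%E }.

Definition jump_time (S : nat -> Omega -> \bar R) (n : nat) (w : Omega) :
    \bar R := (\sum_(k < n) S k w)%E.

Definition lifetime (S : nat -> Omega -> \bar R) (w : Omega) : \bar R :=
  (\sum_(0 <= k <oo) S k w)%E.

(* The state at time t; [None] from the lifetime on. *)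
Definition state_at (Y : nat -> Omega -> X) (S : nat -> Omega -> \bar R)
    (t : R) (w : Omega) : option X :=
  xget None [set s | exists n, s = Some (Y n w) /\
    (jump_time S n w <= t%:E < jump_time S n.+1 w)%E].

Definition total_killing (Y : nat -> Omega -> X) (S : nat -> Omega -> \bar R)
    (w : Omega) : \bar R :=
  (\int[lebesgue_measure]_(t in [set t : R | (0%R <= t)%R /\ t%:E < lifetime S w])
     (oapp (c g) 0%R (state_at Y S t w))%:E)%E.

End Chain.
End Graphs.

(* Main.v *)
(** Kill the jump chain at [x] with probability [c x / deg x], where
    [deg x = sum_y b x y + c x], and let [surv_n n x] be the probability that
    it survives [n] steps from [x].  It decreases to a function [surv] with
    [laplacian surv = 0], and all assertions say that [surv] vanishes: at one
    point or everywhere, which by connectedness is the same.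
    - The Green function is the increasing limit of its truncated Picard
      iterates, whence [Gc = 1 - surv].
    - The Green function splits at time [t] into [int_0^t e^{-sL} ds] and
      [e^{-tL} G]; applied to [c] this gives [M_t = 1 - surv + e^{-tL} surv].
      If [M_t = 1] at one point, positivity of the heat kernel yields
      [surv = e^{-tL} surv <= e^{-tL} 1], and the last term tends to [0].
    - Given the path, the holding times are exponential, so
      [surv_n n x = E_x exp (- sum_(k < n) c (Y k) * S k)]; hence [surv x] is
      the expectation of [exp] of minus the total killing. *)

Require Import Defs.
From HB Require Import structures.
From mathcomp Require Import all_boot all_order all_algebra.
From mathcomp Require Import all_classical all_reals all_analysis.
From mathcomp Require Import measurable_realfun.
From mathcomp Require Import ring lra.
Import Order.TTheory GRing.Theory Num.Theory numFieldNormedType.Exports.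
Local Open Scope classical_set_scope.
Local Open Scope ring_scope.

Set Implicit Arguments.
Unset Strict Implicit.
Unset Printing Implicit Defensive.

(** * Sums of real families over an arbitrary index type *)

Section Summation.
Context {R : realType} {I : choiceType}.
Implicit Types f h : I -> R.

(** The semigroup is given only by its [l2] axioms and its generator. Positivity, a maximum
    principle and a pointwise heat equation are not among them, and [1], [c], [surv] and the Green
    functions need not lie in [l2]. All upper bounds therefore come from one comparison,
    [duhamel_le]: if [w >= 0], [w >= f] and [laplacian w >= kappa], then [w] dominates a discretized
    [e^{-tL} f + int_0^t e^{-sL} kappa ds]. Its sign comes from testing with [(phi - w)^+] for
    finitely supported [phi], where the Laplacian can be computed; this is why [D0_dense] has to
    approximate in energy and in [l2] at once. Taking [w = 0] gives positivity of the semigroup, a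
    Green function bounds the truncated integral, and [1], [surv] and [1 - phi] turn out to be
    excessive. Lower bounds come from the finitely supported subsolutions [green_n], along which the
    semigroup can be telescoped. On the probabilistic side the delicate point is an infinite holding
    time: it ends the trajectory in [total_killing], while the product formula for expectations runs
    over all indices. *)

Definition nnsum f : \bar R := (\esum_(i in [set: I]) (f i)%:E)%E.

Definition summ f : Prop := (nnsum (fun i => `|f i|%R) < +oo)%E.

Lemma nnsum_ge0 f : (forall i, 0 <= f i) -> (0 <= nnsum f)%E.
Proof. by move=> f0; apply: esum_ge0 => i _; rewrite lee_fin. Qed.

Lemma le_nnsum f h : (forall i, f i <= h i) -> (nnsum f <= nnsum h)%E.
Proof. by move=> fh; apply: le_esum => i _; rewrite lee_fin. Qed.

Lemma nnsumD f h : (forall i, 0 <= f i) -> (forall i, 0 <= h i) ->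
  nnsum (fun i => f i + h i) = (nnsum f + nnsum h)%E.
Proof.
move=> f0 h0; rewrite /nnsum -esumD; last 2 first.
- by move=> i _; rewrite lee_fin.
- by move=> i _; rewrite lee_fin.
by apply: eq_esum => i _; rewrite EFinD.
Qed.

Lemma nnsum_fin f : (forall i, 0 <= f i) -> (nnsum f < +oo)%E ->
  nnsum f \is a fin_num.
Proof. by move=> f0 foo; rewrite ge0_fin_numE ?nnsum_ge0. Qed.

Lemma ge0_summ f : (forall i, 0 <= f i) -> (nnsum f < +oo)%E -> summ f.
Proof.
move=> f0; rewrite /summ (_ : (fun i => `|f i|) = f)//.
by apply/funext => i; rewrite ger0_norm.
Qed.

Lemma summ_ge0 f : (forall i, 0 <= f i) -> summ f -> (nnsum f < +oo)%E.
Proof.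
move=> f0; rewrite /summ (_ : (fun i => `|f i|) = f)//.
by apply/funext => i; rewrite ger0_norm.
Qed.

Lemma summ_le f h : (forall i, `|f i| <= h i) -> summ h -> summ f.
Proof.
move=> fh; apply: le_lt_trans; apply: le_nnsum => i.
exact: le_trans (fh i) (ler_norm _).
Qed.

Lemma summD f h : summ f -> summ h -> summ (fun i => f i + h i).
Proof.
move=> finsupp hs; apply: (@le_lt_trans _ _ (nnsum (fun i => `|f i| + `|h i|)%R)).
  by apply: le_nnsum => i; exact: ler_normD.
by rewrite nnsumD ?lte_add_pinfty.
Qed.

(** One inequality holds for every positive factor and every family; applied to [a^-1] and the
    scaled family, it gives the other one. *)
Lemma nnsumZ (a : R) f : 0 <= a -> (forall i, 0 <= f i) ->
  nnsum (fun i => a * f i) = (a%:E * nnsum f)%E.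
Proof.
have le k (b : R) : 0 < b -> (forall i, 0 <= k i) ->
    (b%:E * nnsum k <= nnsum (fun i => b * k i)%R)%E.
  move=> b0 k0; rewrite -lee_pdivlMl//.
  apply: ge_ereal_sup => _ [X [finX _] <-].
  rewrite lee_pdivlMl// ge0_mule_fsumr; last by move=> i; rewrite lee_fin.
  by apply: esum_ge; exists X => //; under eq_fsbigr do rewrite -EFinM.
rewrite le_eqVlt => /predU1P[<-|a0] f0.
  rewrite mul0e; apply: esum1 => i _; by rewrite mul0r.
apply/eqP; rewrite eq_le le// andbT -lee_pdivrMl//.
apply: le_trans (le _ _ _ _) _; first by rewrite invr_gt0.
  by move=> i; rewrite mulr_ge0// ltW.
by apply: le_nnsum => i; rewrite mulKf// gt_eqF.
Qed.

Lemma summZ (a : R) f : summ f -> summ (fun i => a * f i).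
Proof.
move=> finsupp; rewrite /summ; under eq_fun do rewrite normrM.
by rewrite nnsumZ// lte_mul_pinfty// nnsum_fin.
Qed.

Lemma summN f : summ f -> summ (fun i => - f i).
Proof.
rewrite /summ => finsupp; rewrite (_ : (fun i => `|- f i|) = (fun i => `|f i|))//.
by apply/funext => i; rewrite normrN.
Qed.

Lemma summB f h : summ f -> summ h -> summ (fun i => f i - h i).
Proof. by move=> finsupp hs; apply: summD => //; exact: summN. Qed.

(** The value does not depend on how the family is split into nonnegative parts: [k^+ + h = k^- + f]
    involves only nonnegative families, to which [nnsumD] applies. Linearity of [rsum] follows from
    this. *)
Lemma rsumE f h : (forall i, 0 <= f i) -> (forall i, 0 <= h i) ->
  (nnsum f < +oo)%E -> (nnsum h < +oo)%E ->
  rsum (fun i => f i - h i) = fine (nnsum f) - fine (nnsum h).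
Proof.
move=> f0 h0 finsupp hs; set k := (fun i => f i - h i).
have kp0 i : 0 <= k^\+ i by rewrite funrpos_ge0.
have kn0 i : 0 <= k^\- i by rewrite funrneg_ge0.
have kpf i : k^\+ i <= f i.
  by rewrite /k /funrpos ge_max f0 lerBlDr lerDl h0.
have knh i : k^\- i <= h i.
  by rewrite /k /funrneg ge_max h0 opprB lerBlDr lerDl f0.
have kps : (nnsum k^\+%R < +oo)%E by apply: le_lt_trans finsupp; exact: le_nnsum.
have kns : (nnsum k^\-%R < +oo)%E by apply: le_lt_trans hs; exact: le_nnsum.
rewrite /rsum -/(nnsum k^\+) -/(nnsum k^\-).
have : (nnsum k^\+%R + nnsum h = nnsum k^\-%R + nnsum f)%E.
  rewrite -!nnsumD//; congr nnsum; apply/funext => i.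
  have : k^\+ i - k^\- i = k i by rewrite -[in RHS](funrposBneg k).
  by rewrite /k => ?; lra.
move/(congr1 fine); rewrite !fineD ?nnsum_fin//; lra.
Qed.

Lemma summ_pos f : summ f -> (nnsum f^\+%R < +oo)%E.
Proof.
apply: le_lt_trans; apply: le_nnsum => i.
by rewrite /funrpos ge_max normr_ge0 ler_norm.
Qed.

Lemma summ_neg f : summ f -> (nnsum f^\-%R < +oo)%E.
Proof.
apply: le_lt_trans; apply: le_nnsum => i.
by rewrite /funrneg ge_max normr_ge0 -normrN ler_norm.
Qed.

Lemma nnsum_pos_fin f : summ f -> nnsum f^\+ \is a fin_num.
Proof. by move=> finsupp; apply: nnsum_fin; [exact: funrpos_ge0|exact: summ_pos]. Qed.

Lemma nnsum_neg_fin f : summ f -> nnsum f^\- \is a fin_num.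
Proof. by move=> finsupp; apply: nnsum_fin; [exact: funrneg_ge0|exact: summ_neg]. Qed.

Lemma funrposBnegE f i : f i = f^\+ i - f^\- i.
Proof. by rewrite -[in LHS](funrposBneg f). Qed.

Lemma rsum_ge0E f : (forall i, 0 <= f i) -> rsum f = fine (nnsum f).
Proof.
move=> f0; rewrite /rsum -/(nnsum f^\+) -/(nnsum f^\-).
have -> : f^\+ = f.
  by apply/funext => i; rewrite /funrpos; apply/max_idPl.
have -> : nnsum f^\- = 0%E.
  apply: esum1 => i _; congr (_%:E); rewrite /funrneg.
  by apply/max_idPr; rewrite oppr_le0.
by rewrite subr0.
Qed.

Lemma EFin_rsum f : (forall i, 0 <= f i) -> (nnsum f < +oo)%E ->
  (rsum f)%:E = nnsum f.
Proof. by move=> f0 finsupp; rewrite rsum_ge0E// fineK// nnsum_fin. Qed.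

Lemma rsum_ge0 f : (forall i, 0 <= f i) -> 0 <= rsum f.
Proof. by move=> f0; rewrite rsum_ge0E// fine_ge0// nnsum_ge0. Qed.

Lemma rsumD f h : summ f -> summ h ->
  rsum (fun i => f i + h i) = rsum f + rsum h.
Proof.
move=> finsupp hs.
have -> : (fun i => f i + h i) =
    (fun i => (f^\+ i + h^\+ i) - (f^\- i + h^\- i)).
  by apply/funext => i; rewrite (funrposBnegE f) (funrposBnegE h); ring.
have D k l : (nnsum k < +oo)%E -> (nnsum l < +oo)%E ->
   (forall i, 0 <= k i) -> (forall i, 0 <= l i) ->
   (nnsum (fun i => k i + l i)%R < +oo)%E.
  by move=> ? ? ? ?; rewrite nnsumD// lte_add_pinfty.
rewrite rsumE; first last.
- by apply: D; rewrite ?summ_neg// => i; rewrite funrneg_ge0.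
- by apply: D; rewrite ?summ_pos// => i; rewrite funrpos_ge0.
- by move=> i; rewrite addr_ge0// funrneg_ge0.
- by move=> i; rewrite addr_ge0// funrpos_ge0.
rewrite !nnsumD; try by move=> i; rewrite ?funrpos_ge0 ?funrneg_ge0.
rewrite !fineD; try exact: nnsum_pos_fin; try exact: nnsum_neg_fin.
by rewrite /rsum -/(nnsum f^\+) -/(nnsum f^\-) -/(nnsum h^\+) -/(nnsum h^\-); ring.
Qed.

Lemma rsumN f : rsum (fun i => - f i) = - rsum f.
Proof.
rewrite /rsum opprB; congr (fine _ - fine _); apply: eq_esum => i _.
by rewrite /funrpos /funrneg opprK.
Qed.

Lemma rsumB f h : summ f -> summ h ->
  rsum (fun i => f i - h i) = rsum f - rsum h.
Proof. by move=> finsupp hs; rewrite -rsumN rsumD//; exact: summN. Qed.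

Lemma rsumZ (a : R) f : summ f -> rsum (fun i => a * f i) = a * rsum f.
Proof.
wlog a0 : a / 0 <= a => [hw|] finsupp.
  have [a0|/ltW a0] := leP 0 a; first exact: hw.
  rewrite -[RHS]opprK -mulNr -hw ?oppr_ge0// -rsumN.
  by congr rsum; apply/funext => i; rewrite mulNr opprK.
have -> : (fun i => a * f i) = (fun i => a * f^\+ i - a * f^\- i).
  by apply/funext => i; rewrite [in LHS](funrposBnegE f) mulrBr.
rewrite rsumE; first last.
- by rewrite nnsumZ// lte_mul_pinfty ?nnsum_fin ?summ_neg.
- by rewrite nnsumZ// lte_mul_pinfty ?nnsum_fin ?summ_pos.
- by move=> i; rewrite mulr_ge0// funrneg_ge0.
- by move=> i; rewrite mulr_ge0// funrpos_ge0.
rewrite !nnsumZ//; try by move=> i; rewrite ?funrpos_ge0 ?funrneg_ge0.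
rewrite !fineM//; try exact: nnsum_pos_fin; try exact: nnsum_neg_fin.
by rewrite -mulrBr.
Qed.

Lemma ler_rsum f h : summ f -> summ h -> (forall i, f i <= h i) ->
  rsum f <= rsum h.
Proof.
move=> finsupp hs fh; rewrite -subr_ge0 -rsumB//; apply: rsum_ge0 => i.
by rewrite subr_ge0.
Qed.

Lemma rsum0 : rsum (fun _ : I => 0 : R) = 0.
Proof. by rewrite rsum_ge0E// /nnsum esum1. Qed.

Lemma nnsum_single (i0 : I) (a : R) : 0 <= a ->
  nnsum (fun i => (i == i0)%:R * a) = a%:E.
Proof.
move=> a0; rewrite /nnsum -[RHS](@esum_set1 _ _ i0 (fun=> a%:E)) ?lee_fin//.
rewrite [RHS]esum_mkcond; apply: eq_esum => i _; rewrite in_set1.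
by case: eqP; rewrite ?mul1r ?mul0r.
Qed.

Lemma summ_single (i0 : I) f : (forall i, i != i0 -> f i = 0) -> summ f.
Proof.
move=> f0; have -> : f = (fun i => (i == i0)%:R * f i0).
  apply/funext => i; have [->|/f0] := eqVneq i i0; first by rewrite mul1r.
  by rewrite mul0r.
rewrite /summ; under eq_fun do rewrite normrM ger0_norm//.
by rewrite nnsum_single// ltry.
Qed.

Lemma rsum_single (i0 : I) f : (forall i, i != i0 -> f i = 0) ->
  rsum f = f i0.
Proof.
move=> f0; have -> : f = (fun i => (i == i0)%:R * f i0).
  apply/funext => i; have [->|/f0] := eqVneq i i0; first by rewrite mul1r.
  by rewrite mul0r.
rewrite eqxx mul1r.
wlog a0 : f f0 / 0 <= f i0 => [hw|].
  have [a0|/ltW a0] := leP 0 (f i0); first exact: hw.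
  rewrite -[f i0]opprK; under eq_fun do rewrite mulrN.
  rewrite rsumN; congr (- _); rewrite (hw (fun i => - f i)) ?oppr_ge0//.
  by move=> i /f0 ->; rewrite oppr0.
by rewrite rsum_ge0E ?nnsum_single// => i; rewrite mulr_ge0.
Qed.

Lemma summ_finite f : finite_set [set i | f i != 0] -> summ f.
Proof.
move=> fin; rewrite /summ /nnsum.
rewrite (_ : esum _ _ = \esum_(i in [set i | f i != 0]) `|f i|%:E).
  rewrite -[X in esum X _]set_mem_set esum_fset ?set_mem_set//.
  by rewrite fsbig_finite//= sumEFin ltry.
rewrite [RHS]esum_mkcond; apply: eq_esum => i _.
case: ifPn => //; rewrite notin_setE/= => /negP; rewrite negbK => /eqP ->.
by rewrite normr0.
Qed.

Lemma le_term_nnsum f i : (forall j, 0 <= f j) -> ((f i)%:E <= nnsum f)%E.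
Proof.
move=> f0; rewrite -(@nnsum_single i)//; apply: le_nnsum => j.
by have [->|_] := eqVneq j i; rewrite ?mul1r// mul0r.
Qed.

Lemma le_term_rsum f i : (forall j, 0 <= f j) -> summ f -> f i <= rsum f.
Proof.
by move=> f0 finsupp; rewrite -lee_fin EFin_rsum ?summ_ge0// le_term_nnsum.
Qed.

Lemma rsum_eq0 f : (forall i, 0 <= f i) -> summ f -> rsum f = 0 ->
  forall i, f i = 0.
Proof.
move=> f0 finsupp fe i; apply/eqP; rewrite eq_le f0 andbT -fe.
exact: le_term_rsum.
Qed.

(* Comparison with partial sums over finite sets gives Fatou. *)
Lemma nnsum_le_lim (u : nat -> I -> R) f (M : \bar R) :
  (forall n i, 0 <= u n i) -> (forall i, u ^~ i @ \oo --> f i) ->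
  (forall n, nnsum (u n) <= M)%E -> (nnsum f <= M)%E.
Proof.
move=> u0 uf uM; apply: ge_ereal_sup => _ [X [finX _] <-].
rewrite fsbig_finite//= sumEFin.
have cv : (fun n => (\sum_(i <- finmap.enum_fset (fset_set X)) u n i)%:E) @ \oo -->
    (\sum_(i <- finmap.enum_fset (fset_set X)) f i)%:E.
  apply: cvg_EFin; first by exact: nearW.
  elim: (finmap.enum_fset _) => [|i r IH].
    by rewrite big_nil; under eq_fun do rewrite big_nil; exact: cvg_cst.
  rewrite big_cons; under eq_fun do rewrite big_cons.
  by apply: cvgD; [exact: uf|exact: IH].
rewrite -(cvg_lim _ cv)//; apply: lime_le; first by apply/cvg_ex; eexists; exact: cv.
apply: nearW => n; apply: le_trans (uM n).
by apply: esum_ge; exists X => //; rewrite fsbig_finite//= sumEFin.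
Qed.

(** [F] is a finite set whose partial sum comes within [e] of the supremum defining the sum. *)
Lemma nnsum_tail f (e : R) : (forall i, 0 <= f i) -> (nnsum f < +oo)%E -> 0 < e ->
  exists F : set I, finite_set F /\
    (nnsum (fun i => (i \notin F)%:R * f i)%R <= e%:E)%E.
Proof.
move=> f0 finsupp e0.
have : (nnsum f - e%:E < nnsum f)%E by rewrite lteBlDr// lteDl ?lte_fin// nnsum_fin.
move=> /ereal_sup_gt[_ [F [finF _] <-] ltF]; exists F; split => //.
have E : nnsum f = (nnsum (fun i => (i \in F)%:R * f i)%R +
    nnsum (fun i => (i \notin F)%:R * f i)%R)%E.
  rewrite -nnsumD; try by move=> i; rewrite mulr_ge0.
  congr nnsum; apply/funext => i; case: (i \in F) => /=; lra.
have EF : (\sum_(x \in F) (f x)%:E)%E = nnsum (fun i => (i \in F)%:R * f i).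
  rewrite -esum_fset//; last by move=> i _; rewrite lee_fin.
  rewrite esum_mkcond /nnsum; apply: eq_esum => i _.
  by case: ifP; rewrite ?mul1r ?mul0r.
have s1 : (nnsum (fun i => (i \in F)%:R * f i)%R < +oo)%E.
  by apply: le_lt_trans finsupp; apply: le_nnsum => i; case: (i \in F); rewrite ?mul1r ?mul0r.
have s2 : (nnsum (fun i => (i \notin F)%:R * f i)%R < +oo)%E.
  by apply: le_lt_trans finsupp; apply: le_nnsum => i; case: (i \in F); rewrite ?mul1r ?mul0r.
move: ltF; rewrite EF E -(fineK (nnsum_fin _ s1)); last by move=> i; rewrite mulr_ge0.
rewrite -(fineK (nnsum_fin _ s2)); last by move=> i; rewrite mulr_ge0.
by rewrite -EFinD lte_fin lee_fin; lra.
Qed.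

End Summation.

Lemma nnsum_inj {R : realType} {I J : choiceType} (e : J -> I) (f : I -> R) :
  injective e -> (forall i, (forall j, e j <> i) -> f i = 0) ->
  nnsum f = nnsum (fun j => f (e j)).
Proof.
move=> inje f0; rewrite /nnsum -(@esum_image _ _ _ setT e (fun i => (f i)%:E)).
  rewrite [RHS]esum_mkcond; apply: eq_esum => i _.
  case: ifPn => //; rewrite notin_setE => ni; rewrite f0// => j ej.
  by apply: ni; exists j.
by move=> x y _ _; exact: inje.
Qed.

Lemma rsum_inj {R : realType} {I J : choiceType} (e : J -> I) (f : I -> R) :
  injective e -> (forall i, (forall j, e j <> i) -> f i = 0) ->
  rsum f = rsum (fun j => f (e j)).
Proof.
move=> inje f0; rewrite /rsum; congr (fine _ - fine _).
  rewrite -/(nnsum f^\+) (nnsum_inj inje)// => i /f0 fi0.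
  by rewrite /funrpos fi0 maxxx.
rewrite -/(nnsum f^\-) (nnsum_inj inje)// => i /f0 fi0.
by rewrite /funrneg fi0 oppr0 maxxx.
Qed.

Lemma summ_inj {R : realType} {I J : choiceType} (e : J -> I) (f : I -> R) :
  injective e -> (forall i, (forall j, e j <> i) -> f i = 0) ->
  summ (fun j => f (e j)) -> summ f.
Proof.
move=> inje f0; rewrite /summ (@nnsum_inj _ _ _ e (fun i => `|f i|))// => i /f0 ->.
by rewrite normr0.
Qed.

Lemma half_adde_lty {R : realType} (A B : \bar R) : (0 <= A)%E -> (0 <= B)%E ->
  ((2^-1)%:E * (A + B) < +oo)%E <-> (A < +oo)%E /\ (B < +oo)%E.
Proof.
move=> A0 B0; have h0 : (0 <= A + B)%E by rewrite adde_ge0.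
split=> [S|[Aoo Boo]].
  have {}S : (A + B < +oo)%E.
    by move: S; rewrite !ltey; apply: contra => /eqP ->; rewrite mulry gtr0_sg ?invr_gt0// mul1e.
  by split; apply: le_lt_trans S; rewrite ?leeDr ?leeDl.
by rewrite lte_mul_pinfty// ?ge0_fin_numE ?lee_fin ?invr_ge0// lte_add_pinfty.
Qed.

(** * Positive semidefinite forms: Cauchy-Schwarz and triangle inequalities *)

Section PositiveForm.
Context {R : realType} {X : Type}.

(** Linearity is restricted to [V] because the forms at hand are values of [rsum], which is
    meaningful on summable families only; symmetry and positivity survive the junk values. *)
Record psd (V : (X -> R) -> Prop) (B : (X -> R) -> (X -> R) -> R) : Prop := Psd {
  psd_closed : forall a f h, V f -> V h -> V (fun x => a * f x + h x);
  psd_sym : forall f h, B f h = B h f;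
  psd_linear : forall a f h k, V f -> V h -> V k ->
    B (fun x => a * f x + h x) k = a * B f k + B h k;
  psd_ge0 : forall f, 0 <= B f f }.

Variables (V : (X -> R) -> Prop) (B : (X -> R) -> (X -> R) -> R).
Hypothesis psdB : psd V B.

Lemma psdB_closed f h : V f -> V h -> V (fun x => f x - h x).
Proof.
move=> Vf Vh; rewrite (_ : (fun x => _) = (fun x => -1 * h x + f x)).
  exact: (psd_closed psdB).
by apply/funext => x; ring.
Qed.

Lemma psd_linearr a f h k : V f -> V h -> V k ->
  B k (fun x => a * f x + h x) = a * B k f + B k h.
Proof.
move=> Vf Vh Vk.
by rewrite (psd_sym psdB) (psd_linear psdB)// (psd_sym psdB f) (psd_sym psdB h).
Qed.

Lemma psdBl f h k : V f -> V h -> V k ->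
  B (fun x => f x - h x) k = B f k - B h k.
Proof.
move=> Vf Vh Vk; rewrite (_ : (fun x => _) = (fun x => -1 * h x + f x)).
  by rewrite (psd_linear psdB)//; ring.
by apply/funext => x; ring.
Qed.

Lemma psdBr f h k : V f -> V h -> V k ->
  B k (fun x => f x - h x) = B k f - B k h.
Proof. by move=> Vf Vh Vk; rewrite (psd_sym psdB) psdBl// !(psd_sym psdB k). Qed.

Lemma psd_sqB f h : V f -> V h ->
  B (fun x => f x - h x) (fun x => f x - h x) = B f f - 2 * B f h + B h h.
Proof.
move=> Vf Vh; have Vd := psdB_closed Vf Vh.
by rewrite psdBl// !psdBr// (psd_sym psdB h f); ring.
Qed.

Lemma psd_sqD a f h : V f -> V h ->
  B (fun x => a * f x + h x) (fun x => a * f x + h x) =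
  a ^+ 2 * B f f + 2 * a * B f h + B h h.
Proof.
move=> Vf Vh; have Vd := psd_closed psdB a Vf Vh.
by rewrite (psd_linear psdB)// !psd_linearr// (psd_sym psdB h f); ring.
Qed.

Lemma psd_CS2 f h : V f -> V h -> (B f h) ^+ 2 <= B f f * B h h.
Proof.
move=> Vf Vh.
have q a : 0 <= a ^+ 2 * B f f + 2 * a * B f h + B h h.
  by rewrite -psd_sqD// (psd_ge0 psdB).
have [f0|f0] := eqVneq (B f f) 0.
  have [->|fh] := eqVneq (B f h) 0; first by rewrite f0 mul0r expr0n.
  (* Without its quadratic term the polynomial is affine, and at this point it takes the value [-1].
     In the other case below, [q] is used at the minimizer. *)
  have := q (- (B h h + 1) / (2 * B f h)); rewrite f0 mulr0 add0r.
  rewrite (_ : 2 * _ * _ = - (B h h + 1)); first by lra.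
  by field.
have fp : 0 < B f f by rewrite lt_neqAle eq_sym f0 (psd_ge0 psdB).
have := q (- B f h / B f f).
rewrite (_ : _ + _ + _ = (B f f * B h h - B f h ^+ 2) / B f f).
  by rewrite pmulr_lge0 ?invr_gt0// subr_ge0.
by field.
Qed.

Lemma psd_CS f h : V f -> V h ->
  `|B f h| <= Num.sqrt (B f f) * Num.sqrt (B h h).
Proof.
move=> Vf Vh; rewrite -sqrtrM ?(psd_ge0 psdB)// -sqrtr_sqr ler_wsqrtr//.
exact: psd_CS2.
Qed.

Lemma psd_triangle f h : V f -> V h ->
  Num.sqrt (B (fun x => f x + h x) (fun x => f x + h x)) <=
  Num.sqrt (B f f) + Num.sqrt (B h h).
Proof.
move=> Vf Vh; have E : (fun x => f x + h x) = (fun x => 1 * f x + h x).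
  by apply/funext => x; rewrite mul1r.
rewrite E psd_sqD// -[leRHS]ger0_norm ?addr_ge0 ?sqrtr_ge0//.
rewrite -[leRHS]sqrtr_sqr ler_wsqrtr// sqrrD !sqr_sqrtr ?(psd_ge0 psdB)//.
have := psd_CS Vf Vh; have := ler_norm (B f h); rewrite -mulr_natr; lra.
Qed.

Lemma psd_triangleB f h : V f -> V h ->
  Num.sqrt (B (fun x => f x - h x) (fun x => f x - h x)) <=
  Num.sqrt (B f f) + Num.sqrt (B h h).
Proof.
move=> Vf Vh; have Vn : V (fun x => - h x).
  (* Closure is stated for [a * f + h], so a multiple of [h] is taken as a combination of [h] with
     itself. *)
  rewrite (_ : (fun x => - h x) = (fun x => -2 * h x + h x)).
    exact: (psd_closed psdB).
  by apply/funext => x; ring.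
apply: le_trans (psd_triangle Vf Vn) _; rewrite lerD2l.
have -> : (fun x => - h x) = (fun x => -2 * h x + h x).
  by apply/funext => x; ring.
rewrite psd_sqD// (_ : _ + _ = B h h)//; ring.
Qed.

Lemma psd_sqrtZ a f : V f ->
  Num.sqrt (B (fun x => a * f x) (fun x => a * f x)) = `|a| * Num.sqrt (B f f).
Proof.
move=> Vf; have -> : (fun x => a * f x) = (fun x => (a - 1) * f x + f x).
  by apply/funext => x; ring.
rewrite psd_sqD// (_ : _ + _ + _ = a ^+ 2 * B f f); last by ring.
by rewrite sqrtrM ?sqr_ge0// sqrtr_sqr.
Qed.

End PositiveForm.

(** * Weighted square-summable families; edges, killing term and [l2] are instances *)

Section WeightedForm.
Context {R : realType} {I : choiceType}.
Variable w : I -> R.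
Hypothesis w0 : forall i, 0 <= w i.

Definition wl2 (f : I -> R) : Prop := (nnsum (fun i => w i * f i ^+ 2)%R < +oo)%E.

Definition wdot (f h : I -> R) : R := rsum (fun i => w i * f i * h i).

Lemma wl2_ge0 f i : 0 <= w i * f i ^+ 2.
Proof. by rewrite mulr_ge0// sqr_ge0. Qed.

Lemma wl2_summ f h : wl2 f -> wl2 h -> summ (fun i => w i * f i * h i).
Proof.
move=> finsupp hs; apply: (@summ_le _ _ _ (fun i => w i * f i ^+ 2 + w i * h i ^+ 2)).
  move=> i; rewrite -mulrA normrM ger0_norm// -mulrDr ler_wpM2l// ler_norml.
  have := sqr_ge0 (f i + h i); have := sqr_ge0 (f i - h i).
  have := sqr_ge0 (f i); have := sqr_ge0 (h i).
  rewrite !expr2 => *; apply/andP; split; nra.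
by apply: summD; apply: ge0_summ => // i; exact: wl2_ge0.
Qed.

Lemma wl2_comb a f h : wl2 f -> wl2 h -> wl2 (fun i => a * f i + h i).
Proof.
move=> finsupp hs; apply: summ_ge0; first by move=> i; rewrite mulr_ge0// sqr_ge0.
rewrite (_ : (fun i => _) = (fun i => a ^+ 2 * (w i * f i * f i) +
  2 * a * (w i * f i * h i) + w i * h i * h i)).
  by apply: summD; [apply: summD; apply: summZ|]; exact: wl2_summ.
by apply/funext => i; ring.
Qed.

Lemma wdot_psd : psd wl2 wdot.
Proof.
split=> [a f h|f h|a f h k finsupp hs ks|f]; first exact: wl2_comb.
- by congr rsum; apply/funext => i; ring.
- have s1 := wl2_summ finsupp ks; have s2 := wl2_summ hs ks.
  rewrite /wdot -(rsumZ a s1) -(rsumD (summZ a s1) s2).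
  by congr rsum; apply/funext => i; ring.
- by apply: rsum_ge0 => i; rewrite -mulrA -expr2 wl2_ge0.
Qed.

Lemma wdot_nnsum f : wl2 f -> (wdot f f)%:E = nnsum (fun i => w i * f i ^+ 2).
Proof.
move=> finsupp; rewrite -EFin_rsum//; last by move=> i; exact: wl2_ge0.
by congr (_%:E); congr rsum; apply/funext => i; rewrite expr2 mulrA.
Qed.

End WeightedForm.

(** * Finitely supported functions, the Laplacian and the energy form *)

Section Graph.
Context {R : realType} {X : countType} (g : graph X R).
Implicit Types (f h u phi : X -> R) (x y z : X).

Definition finsupp f : Prop := finite_set [set x | f x != 0].

(** Induction on a list covering the support: setting the function to 0 at the head leaves a
    function supported in the tail. *)
Lemma finsupp_ind (P : (X -> R) -> Prop) : P (fun=> 0) ->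
  (forall a x f, P f -> P (fun z => a * ind R x z + f z)) ->
  forall f, finsupp f -> P f.
Proof.
move=> P0 PD f /finite_seqP[s sE].
have {sE} : forall x, f x != 0 -> x \in s
  by move=> x fx; have : [set z | f z != 0] x by []; rewrite sE.
elim: s f => [|x s IH] f finsupp.
  rewrite (_ : f = fun=> 0)//; apply/funext => x.
  by apply/eqP/negP => /negP /finsupp.
rewrite (_ : f = fun z => f x * ind R x z + (z != x)%:R * f z).
  apply: PD; apply: IH => z; have [->|zx] := eqVneq z x; first by rewrite mul0r eqxx.
  by rewrite mul1r => /finsupp; rewrite inE (negPf zx).
by apply/funext => z; rewrite /ind; case: eqVneq => [->|_] /=; ring.
Qed.

Lemma finsupp_sub f h : (forall x, f x = 0 -> h x = 0) -> finsupp f -> finsupp h.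
Proof.
move=> fh; apply: sub_finite_set => x /= hx; apply/eqP => fx.
by move: hx; rewrite fh ?eqxx.
Qed.

Lemma finsupp_comb a f h : finsupp f -> finsupp h -> finsupp (fun x => a * f x + h x).
Proof.
move=> ff fh; apply: (@sub_finite_set _ _ ([set x | f x != 0] `|` [set x | h x != 0])).
  move=> x /=; have [->|fx _] := eqVneq (f x) 0; last by left.
  by rewrite mulr0 add0r; right.
by rewrite finite_setU.
Qed.

Lemma finsupp_single y : finsupp (ind R y).
Proof.
apply: (@sub_finite_set _ _ [set y]); last exact: finite_set1.
by move=> x /=; rewrite /ind; case: (x =P y) => // _; rewrite eqxx.
Qed.

Lemma summ_finsupp f h : finsupp f -> summ (fun x => f x * h x).
Proof.
move=> ff; apply: summ_finite; apply: sub_finite_set ff => x /=.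
by apply: contra => /eqP ->; rewrite mul0r.
Qed.

Lemma rsum_ind y h : rsum (fun x => ind R y x * h x) = h y.
Proof.
rewrite (@rsum_single _ _ y) /ind ?eqxx ?mul1r// => i /negPf ->.
by rewrite mul0r.
Qed.

Lemma l2dotE f h : l2dot f h = wdot (fun=> 1) f h.
Proof. by congr rsum; apply/funext => x; rewrite mul1r. Qed.

Lemma l2E f : l2 f = wl2 (fun=> 1) f.
Proof.
congr (_ < +oo)%E; rewrite /nnsum; congr esum.
by apply/funext => x; rewrite mul1r.
Qed.

Lemma l2_psd : psd (@l2 R X) (@l2dot R X).
Proof.
rewrite (_ : @l2 R X = wl2 (fun=> 1)); last by apply/funext => f; exact: l2E.
rewrite (_ : @l2dot R X = wdot (fun=> 1)); last first.
  by apply/funext => f; apply/funext => h; exact: l2dotE.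
by apply: wdot_psd => _; exact: ler01.
Qed.

Lemma l2_summ f h : l2 f -> l2 h -> summ (fun x => f x * h x).
Proof.
rewrite !l2E => /wl2_summ finsupp /finsupp; rewrite (_ : (fun x => _) = (fun x => f x * h x)).
  by apply; move=> _; exact: ler01.
by apply/funext => x; rewrite mul1r.
Qed.

Lemma l2dot_nnsum f : l2 f -> (l2dot f f)%:E = nnsum (fun x => f x ^+ 2).
Proof.
rewrite l2E l2dotE => /wdot_nnsum -> //.
by congr nnsum; apply/funext => x; rewrite mul1r.
Qed.

Lemma l2normE f : l2 f -> l2norm f = Num.sqrt (l2dot f f).
Proof. by move=> fl; rewrite /l2norm -/(nnsum (fun x => f x ^+ 2)) -l2dot_nnsum. Qed.

Lemma l2_le f h : (forall x, `|f x| <= `|h x|) -> l2 h -> l2 f.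
Proof.
move=> fh; apply: le_lt_trans; apply: le_esum => x _; rewrite lee_fin.
by rewrite -(real_normK (num_real (f x))) -(real_normK (num_real (h x))) lerXn2r ?nnegrE.
Qed.

Lemma l2_finsupp f : finsupp f -> l2 f.
Proof.
move=> ff; apply: summ_ge0; first by move=> x; exact: sqr_ge0.
by under eq_fun do rewrite expr2; exact: summ_finsupp.
Qed.

(** The counting measure gives every vertex mass 1. This turns the [l2] estimates on the semigroup
    into pointwise ones. *)
Lemma l2_pointwise f x : l2 f -> `|f x| <= l2norm f.
Proof.
move=> fl; rewrite l2normE// -sqrtr_sqr ler_wsqrtr// -lee_fin l2dot_nnsum//.
by apply: (@le_term_nnsum _ _ (fun y => f y ^+ 2)) => y; exact: sqr_ge0.
Qed.

Definition edge_weight (p : X * X) : R := b g p.1 p.2.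
Definition edge_diff f (p : X * X) : R := f p.1 - f p.2.

Lemma edge_weight_ge0 p : 0 <= edge_weight p. Proof. exact: b_ge0. Qed.

Lemma finite_energyP f : finite_energy g f <-> wl2 edge_weight (edge_diff f) /\ wl2 (c g) f.
Proof.
rewrite /finite_energy /energy.
rewrite -/(nnsum (fun p : X * X => edge_weight p * edge_diff f p ^+ 2)%R).
rewrite -/(nnsum (fun x => c g x * f x ^+ 2)%R) /wl2.
apply: half_adde_lty; apply: nnsum_ge0 => i; apply: wl2_ge0 => j.
  exact: edge_weight_ge0.
exact: c_ge0.
Qed.

Lemma energy2E f h :
  energy2 g f h = 2^-1 * wdot edge_weight (edge_diff f) (edge_diff h) + wdot (c g) f h.
Proof. by []. Qed.

Lemma edge_diffZD a f h : edge_diff (fun x => a * f x + h x) = (fun p => a * edge_diff f p + edge_diff h p).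
Proof. by apply/funext => p; rewrite /edge_diff; ring. Qed.

Lemma energy_psd : psd (finite_energy g) (energy2 g).
Proof.
have P1 := wdot_psd edge_weight_ge0; have P2 := wdot_psd (@c_ge0 _ _ g).
split.
- move=> a f h /finite_energyP[f1 f2] /finite_energyP[h1 h2].
  apply/finite_energyP; rewrite edge_diffZD; split; apply: wl2_comb => // i.
    exact: edge_weight_ge0.
  exact: c_ge0.
- by move=> f h; rewrite !energy2E (psd_sym P1) (psd_sym P2).
- move=> a f h k /finite_energyP[f1 f2] /finite_energyP[h1 h2] /finite_energyP[k1 k2].
  by rewrite !energy2E edge_diffZD (psd_linear P1)// (psd_linear P2)//; ring.
- by move=> f; rewrite energy2E addr_ge0 ?mulr_ge0 ?invr_ge0 ?(psd_ge0 P1) ?(psd_ge0 P2).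
Qed.

(* As [energy] halves the killing term too, it is only equivalent to the
   quadratic form of [energy2]. *)
Lemma energy_equiv f : finite_energy g f ->
  fine (energy g f) <= energy2 g f f /\ energy2 g f f <= 2 * fine (energy g f).
Proof.
move=> /finite_energyP[f1 f2].
rewrite /energy -/(nnsum (fun p : X * X => edge_weight p * edge_diff f p ^+ 2)%R).
rewrite -/(nnsum (fun x => c g x * f x ^+ 2)%R).
rewrite -(wdot_nnsum edge_weight_ge0)// -(wdot_nnsum (@c_ge0 _ _ g))// energy2E /=.
have := psd_ge0 (wdot_psd (@c_ge0 _ _ g)) f; have := psd_ge0 (wdot_psd edge_weight_ge0) (edge_diff f).
by split; lra.
Qed.

Lemma wdot_le_energy f : wdot edge_weight (edge_diff f) (edge_diff f) <= 2 * energy2 g f f.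
Proof.
have := psd_ge0 (wdot_psd (@c_ge0 _ _ g)) f.
by rewrite energy2E; lra.
Qed.

Lemma b_summ x : summ (b g x).
Proof. by apply: ge0_summ; [move=> y; exact: b_ge0|exact: b_summable]. Qed.

Lemma jump_rateE x : jump_rate g x = rsum (b g x).
Proof. by rewrite rsum_ge0E// => y; exact: b_ge0. Qed.

Definition deg x := jump_rate g x + c g x.
Definition adj f x := rsum (fun y => b g x y * f y).

Lemma formal_domE f : formal_dom g f <-> forall x, summ (fun y => b g x y * f y).
Proof.
split => H x; have := H x; rewrite /summ /nnsum; congr (_ < +oo)%E; apply: eq_esum => y _;
  by rewrite normrM ger0_norm// b_ge0.
Qed.

Lemma laplacianE f x : formal_dom g f -> laplacian g f x = deg x * f x - adj f x.
Proof.
move=> /formal_domE fd; rewrite /laplacian.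
rewrite (_ : (fun y => _) = (fun y => f x * b g x y - b g x y * f y)); last first.
  by apply/funext => y; ring.
rewrite rsumB//; last by apply: summZ; exact: b_summ.
rewrite rsumZ; last exact: b_summ.
by rewrite /deg jump_rateE /adj; ring.
Qed.

Lemma inj_pairl x : injective (fun y : X => (x, y)).
Proof. by move=> y y' []. Qed.

Lemma inj_pairr x : injective (fun y : X => (y, x)).
Proof. by move=> y y' []. Qed.

Lemma summ_row (F : X * X -> R) x : summ F -> summ (fun y => F (x, y)).
Proof.
move=> Fs; rewrite /summ.
rewrite (_ : nnsum _ = nnsum (fun p : X * X => (p.1 == x)%:R * `|F p|)).
  apply: le_lt_trans Fs; apply: le_nnsum => p.
  by case: eqP => _; rewrite ?mul1r ?mul0r.
rewrite (nnsum_inj (@inj_pairl x)).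
  by congr nnsum; apply/funext => y /=; rewrite eqxx mul1r.
move=> [x' y] /= ne; have [xx|] := eqVneq x' x; last by rewrite mul0r.
by have := ne y; rewrite xx.
Qed.

(** From [|f y| <= |f x| + 1 + (f x - f y)^2]: weighted by [b x y], the constant part is summable by
    [b_summable] and the square by finite energy. *)
Lemma finite_energy_formal f : finite_energy g f -> formal_dom g f.
Proof.
move=> /finite_energyP[f1 _]; apply/formal_domE => x.
apply: (@summ_le _ _ _ (fun y => (`|f x| + 1) * b g x y + edge_weight (x, y) * edge_diff f (x, y) ^+ 2)).
  move=> y; rewrite normrM (ger0_norm (b_ge0 g x y)) /edge_weight /edge_diff/=.
  have := b_ge0 g x y; set B := b g x y => B0.
  have : `|f y| <= `|f x| + `|f x - f y|.
    by rewrite addrC -lerBlDr; apply: le_trans (lerB_dist _ _) _; rewrite distrC.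
  have : `|f x - f y| <= 1 + (f x - f y) ^+ 2.
    rewrite -(real_normK (num_real (f x - f y))); have := normr_ge0 (f x - f y).
    by set t := `|_|; move=> t0; have := sqr_ge0 (t - 1); rewrite !expr2; nra.
  move=> h1 h2; have h3 : `|f y| <= `|f x| + 1 + (f x - f y) ^+ 2 by lra.
  by have := ler_wpM2l B0 h3; lra.
apply: summD; first by apply: summZ; exact: b_summ.
by apply: (summ_row (F := fun p => edge_weight p * edge_diff f p ^+ 2));
  apply: ge0_summ => // p; apply: wl2_ge0; exact: edge_weight_ge0.
Qed.

Lemma adjZD a f h x : formal_dom g f -> formal_dom g h ->
  adj (fun z => a * f z + h z) x = a * adj f x + adj h x.
Proof.
move=> /formal_domE fd /formal_domE hd; rewrite /adj -rsumZ// -rsumD//; last exact: summZ.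
by congr rsum; apply/funext => y; ring.
Qed.

Lemma formal_domZD a f h : formal_dom g f -> formal_dom g h ->
  formal_dom g (fun z => a * f z + h z).
Proof.
move=> /formal_domE fd /formal_domE hd; apply/formal_domE => x.
rewrite (_ : (fun y => _) = (fun y => a * (b g x y * f y) + b g x y * h y)).
  by apply: summD => //; exact: summZ.
by apply/funext => y; ring.
Qed.

Lemma laplacianZD a f h x : formal_dom g f -> formal_dom g h ->
  laplacian g (fun z => a * f z + h z) x = a * laplacian g f x + laplacian g h x.
Proof.
move=> fd hd; rewrite !laplacianE//; last exact: formal_domZD.
by rewrite adjZD//; ring.
Qed.

Lemma adj_ge0 f x : (forall y, 0 <= f y) -> 0 <= adj f x.
Proof. by move=> f0; apply: rsum_ge0 => y; rewrite mulr_ge0// b_ge0. Qed.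

Lemma le_adj f h x : formal_dom g f -> formal_dom g h -> (forall y, f y <= h y) ->
  adj f x <= adj h x.
Proof.
move=> /formal_domE fd /formal_domE hd fh; apply: ler_rsum => // y.
by rewrite ler_wpM2l// b_ge0.
Qed.

Lemma formal_le f h : (forall x, `|f x| <= h x) -> formal_dom g h -> formal_dom g f.
Proof.
move=> fh /formal_domE hd; apply/formal_domE => x; apply: summ_le (hd x) => y.
by rewrite normrM ger0_norm ?b_ge0// ler_wpM2l// b_ge0.
Qed.

Lemma formal_cst a : formal_dom g (fun=> a).
Proof.
apply/formal_domE => x; rewrite (_ : (fun y => _) = (fun y => a * b g x y)).
  by apply: summZ; exact: b_summ.
by apply/funext => y; rewrite mulrC.
Qed.

Lemma finite_energy_ind x : finite_energy g (ind R x).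
Proof.
apply/finite_energyP; split.
  apply: summ_ge0; first by move=> p; apply: wl2_ge0; exact: edge_weight_ge0.
  apply: (@summ_le _ _ _ (fun p : X * X => (p.1 == x)%:R * b g p.1 p.2 + (p.2 == x)%:R * b g p.1 p.2)).
    move=> p; rewrite ger0_norm; last by apply: wl2_ge0; exact: edge_weight_ge0.
    rewrite /edge_weight /edge_diff /ind -mulrDl mulrC ler_wpM2r ?b_ge0//.
    by case: eqP; case: eqP => _ _; rewrite ?subrr ?subr0 ?sub0r ?expr0n ?sqrrN ?expr1n //=; lra.
  apply: summD.
    apply: (summ_inj (@inj_pairl x)).
      move=> [x' y] /= ne; have [xx|] := eqVneq x' x; last by rewrite mul0r.
      by have := ne y; rewrite xx.
    rewrite (_ : (fun j => _) = b g x); first exact: b_summ.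
    by apply/funext => y /=; rewrite eqxx mul1r.
  apply: (summ_inj (@inj_pairr x)).
    move=> [y x'] /= ne; have [xx|] := eqVneq x' x; last by rewrite mul0r.
    by have := ne y; rewrite xx.
  rewrite (_ : (fun j => _) = b g x); first exact: b_summ.
  by apply/funext => y /=; rewrite eqxx mul1r b_sym.
apply: summ_ge0; first by move=> p; apply: wl2_ge0; exact: c_ge0.
apply: (@summ_single _ _ x) => y /negPf yx; by rewrite /ind yx expr0n mulr0.
Qed.

Lemma finite_energy_finsupp f : finsupp f -> finite_energy g f.
Proof.
apply: (finsupp_ind (P := finite_energy g)).
  rewrite (_ : (fun=> 0) = (fun z => ind R z z - ind R z z)); last first.
    by apply/funext => z; rewrite subrr.
  apply/finite_energyP; split; rewrite /wl2 /nnsum esum1// => i _.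
    by rewrite /edge_diff !subrr expr0n mulr0.
  by rewrite subrr expr0n mulr0.
move=> a x h hf; apply: (psd_closed energy_psd) => //; exact: finite_energy_ind.
Qed.

Lemma energy2_ind u x : finite_energy g u -> energy2 g u (ind R x) = laplacian g u x.
Proof.
move=> ue; have ud := finite_energy_formal ue; have /formal_domE us := ud.
have sx : summ (fun y => b g x y * (u x - u y)).
  rewrite (_ : (fun y => _) = (fun y => u x * b g x y - b g x y * u y)).
    by apply: summB => //; apply: summZ; exact: b_summ.
  by apply/funext => y; ring.
rewrite /laplacian energy2E; congr (_ + _); last first.
  rewrite /wdot (@rsum_single _ _ x) /ind ?eqxx ?mulr1// => y /negPf ->.
  by rewrite mulr0.
(* Split according to the end of the edge that is [x]. By symmetry of [b] both parts have the same
   sum, which cancels the factor [1/2]. *)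
rewrite /wdot (_ : (fun p => _) = (fun p : X * X =>
   (p.1 == x)%:R * (b g p.1 p.2 * (u p.1 - u p.2)) +
   (p.2 == x)%:R * (b g p.1 p.2 * (u p.2 - u p.1)))); last first.
  by apply/funext => p; rewrite /edge_weight /edge_diff /ind; ring.
have H1 (p : X * X) : (forall j, (x, j) <> p) ->
    (p.1 == x)%:R * (b g p.1 p.2 * (u p.1 - u p.2)) = 0.
  case: p => [x' y] /= ne; have [xx|] := eqVneq x' x; last by rewrite mul0r.
  by have := ne y; rewrite xx.
have H2 (p : X * X) : (forall j, (j, x) <> p) ->
    (p.2 == x)%:R * (b g p.1 p.2 * (u p.2 - u p.1)) = 0.
  case: p => [y x'] /= ne; have [xx|] := eqVneq x' x; last by rewrite mul0r.
  by have := ne y; rewrite xx.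
have E1 : (fun j => ((x, j).1 == x)%:R * (b g (x, j).1 (x, j).2 * (u (x, j).1 - u (x, j).2)))
   = (fun y => b g x y * (u x - u y)).
  by apply/funext => y /=; rewrite eqxx mul1r.
have E2 : (fun j => ((j, x).2 == x)%:R * (b g (j, x).1 (j, x).2 * (u (j, x).2 - u (j, x).1)))
   = (fun y => b g x y * (u x - u y)).
  by apply/funext => y /=; rewrite eqxx mul1r b_sym.
rewrite rsumD.
- rewrite (rsum_inj (@inj_pairl x) H1) (rsum_inj (@inj_pairr x) H2) E1 E2; lra.
- by apply: (summ_inj (@inj_pairl x) H1); rewrite E1.
- by apply: (summ_inj (@inj_pairr x) H2); rewrite E2.
Qed.

Lemma energy2_finsupp u phi : finite_energy g u -> finsupp phi ->
  energy2 g u phi = rsum (fun x => phi x * laplacian g u x).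
Proof.
move=> ue fphi.
suff : finsupp phi /\ energy2 g u phi = rsum (fun x => phi x * laplacian g u x) by case.
move: phi fphi; apply: finsupp_ind.
  split; first by apply: (@finsupp_sub (fun=> 0)) => //; rewrite /finsupp (_ : [set _ | _] = set0) //;
    apply/seteqP; split => // x /=; rewrite eqxx.
  have -> : rsum (fun x => 0 * laplacian g u x) = 0.
    by under eq_fun do rewrite mul0r; exact: rsum0.
  have H := finite_energy_ind.
  rewrite energy2E /wdot.
  under eq_fun do rewrite /edge_diff subrr mulr0.
  by under [X in _ + rsum X]eq_fun do rewrite mulr0; rewrite !rsum0 mulr0 addr0.
move=> a x f [ff IH]; split; first by apply: finsupp_comb => //; exact: finsupp_single.
rewrite (psd_linearr energy_psd)//; [|exact: finite_energy_ind|exact: finite_energy_finsupp].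
rewrite IH energy2_ind// -(rsum_ind x (laplacian g u)) -rsumZ.
  rewrite -rsumD.
  - by congr rsum; apply/funext => z; ring.
  - by apply: summZ; apply: summ_finsupp; exact: finsupp_single.
  - exact: summ_finsupp.
by apply: summ_finsupp; exact: finsupp_single.
Qed.

Lemma l2_formal f : l2 f -> formal_dom g f.
Proof.
move=> fl; apply: (@formal_le _ (fun=> l2norm f)); last exact: formal_cst.
by move=> x; exact: l2_pointwise.
Qed.

Lemma adj_ind y x : adj (ind R y) x = b g x y.
Proof.
rewrite /adj (@rsum_single _ _ y) /ind ?eqxx ?mulr1// => z /negPf ->.
by rewrite mulr0.
Qed.

Lemma laplacian_ind y x : laplacian g (ind R y) x = deg y * ind R y x - b g x y.
Proof.
rewrite laplacianE ?adj_ind; last by apply: l2_formal; apply: l2_finsupp; exact: finsupp_single.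
by rewrite /ind; case: eqVneq => [->|_] //; rewrite !mulr0.
Qed.

(** A summable family bounded by its sum is square summable. This puts the indicators, hence all
    finitely supported functions, into the domain of [opL]. *)
Lemma l2_b y : l2 (fun x => b g x y).
Proof.
apply: summ_ge0; first by move=> x; exact: sqr_ge0.
apply: (@summ_le _ _ _ (fun x => rsum (b g y) * b g y x)).
  move=> x; rewrite ger0_norm ?sqr_ge0// expr2 b_sym ler_wpM2r ?b_ge0//.
  by apply: le_term_rsum; [move=> z; exact: b_ge0|exact: b_summ].
by apply: summZ; exact: b_summ.
Qed.

Lemma l2_laplacian_ind y : l2 (laplacian g (ind R y)).
Proof.
rewrite (_ : laplacian g _ = (fun x => deg y * ind R y x - b g x y)).
  rewrite (_ : (fun x => _) = (fun x => -1 * b g x y + deg y * ind R y x)).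
    apply: (psd_closed l2_psd); first exact: l2_b.
    apply: l2_finsupp; apply: finsupp_sub (finsupp_single y) => x ->; exact: mulr0.
  by apply/funext => x; ring.
by apply/funext => x; exact: laplacian_ind.
Qed.

Lemma l2dot_laplacian_ind y u : l2 u -> l2dot (laplacian g (ind R y)) u = laplacian g u y.
Proof.
move=> ul; have ud := l2_formal ul; rewrite laplacianE// /l2dot.
rewrite (_ : (fun x => _) = (fun x => deg y * (ind R y x * u x) - b g y x * u x)).
  rewrite rsumB.
  - rewrite rsumZ; last by apply: summ_finsupp; exact: finsupp_single.
    by rewrite rsum_ind.
  - by apply: summZ; apply: summ_finsupp; exact: finsupp_single.
  - by move/formal_domE : ud; exact.
by apply/funext => x; rewrite laplacian_ind b_sym; ring.
Qed.

End Graph.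

(** * Clamping a real number to a symmetric interval *)

Section RealBounds.
Context {R : realType}.
Implicit Types a s t : R.

Lemma sqr_le_norm a s : `|a| <= `|s| -> a ^+ 2 <= s ^+ 2.
Proof.
by move=> h; rewrite -(real_normK (num_real a)) -(real_normK (num_real s)) lerXn2r ?nnegrE.
Qed.

Definition clamp s a := if a < - s then - s else if s < a then s else a.

(** Clamping is 1-Lipschitz in the pair of point and threshold for the maximum norm ([key]), and the
    square of a maximum is at most the sum of the squares. *)
Lemma clamp_contract (a b s t : R) : 0 <= s -> 0 <= t ->
  (clamp s a - clamp t b) ^+ 2 <= (a - b) ^+ 2 + (s - t) ^+ 2.
Proof.
move=> s0 t0.
have key (d : R) : `|a - b| <= d -> `|s - t| <= d -> `|clamp s a - clamp t b| <= d.
  rewrite !ler_norml /clamp => /andP[h1 h2] /andP[h3 h4]; apply/andP.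
  have [?|?] := ltP a (- s); last have [?|?] := ltP s a;
  (have [?|?] := ltP b (- t); last have [?|?] := ltP t b); split; lra.
have [h|h] := leP `|a - b| `|s - t|.
  by have := sqr_le_norm (key _ h (lexx _)); have := sqr_ge0 (a - b); lra.
have := sqr_le_norm (key _ (lexx _) (ltW h)).
by have := sqr_ge0 (s - t); lra.
Qed.

Lemma clamp_dist (a u : R) : `|u - clamp `|u| a| <= `|u - a|.
Proof.
rewrite /clamp; have h1 := ler_norm u; have := ler_norm (- u); rewrite normrN => h2.
have := ler_norm (u - a); have := ler_norm (- (u - a)); rewrite normrN.
move: `|u - a| => A; move: `|u| h1 h2 => U h1 h2 *; rewrite ler_norml.
by have [?|?] := ltP a (- U); [|have [?|?] := ltP U a]; apply/andP; split; lra.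
Qed.

Lemma clamp_dist2 (a u : R) : `|u - clamp `|u| a| <= 2 * `|u|.
Proof.
rewrite /clamp; have h1 := ler_norm u; have := ler_norm (- u); rewrite normrN => h2.
move: `|u| h1 h2 => U h1 h2 *; rewrite ler_norml.
by have [?|?] := ltP a (- U); [|have [?|?] := ltP U a]; apply/andP; split; lra.
Qed.

Lemma clamp0 (u : R) : clamp `|u| 0 = 0.
Proof.
rewrite /clamp; have := normr_ge0 u => u0.
by have [?|?] := ltP 0 (- `|u|); [lra|have [?|?] := ltP `|u| 0; lra].
Qed.

End RealBounds.

(** * The domain [D0]: pointwise control and approximation *)

Section FormDomain.
Context {R : realType} {X : countType} (g : graph X R) (o : X).
Implicit Types (f h u phi : X -> R) (x y z : X).

(** A bilinear substitute for [norm_o], with square equivalent up to a factor 2 ([norm_o_equiv]), so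
    that the lemmas on [psd] forms apply to the closure defining [D0]. *)
Definition energy_o f h := energy2 g f h + f o * h o.

Lemma energy_o_psd : psd (finite_energy g) energy_o.
Proof.
have P := energy_psd g; split.
- exact: psd_closed P.
- by move=> f h; rewrite /energy_o (psd_sym P) mulrC.
- by move=> a f h k fe he ke; rewrite /energy_o (psd_linear P)//; ring.
- by move=> f; rewrite /energy_o addr_ge0 ?(psd_ge0 P)// -expr2 sqr_ge0.
Qed.

Lemma energy_le_energy_o f : energy2 g f f <= energy_o f f.
Proof. by rewrite /energy_o lerDl -expr2 sqr_ge0. Qed.

Lemma norm_o_equiv f : finite_energy g f ->
  norm_o g o f ^+ 2 <= energy_o f f /\ energy_o f f <= 2 * norm_o g o f ^+ 2.
Proof.
move=> fe; have [e1 e2] := energy_equiv fe.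
have e0 : 0 <= fine (energy g f).
  by have := psd_ge0 (energy_psd g) f; lra.
rewrite /norm_o sqr_sqrtr; last by rewrite addr_ge0// sqr_ge0.
rewrite /energy_o -expr2 real_normK ?num_real//.
by have := sqr_ge0 (f o); split; lra.
Qed.

Lemma D0P f : D0 g o f <-> finite_energy g f /\
  forall e : R, 0 < e -> exists phi, finsupp phi /\
    energy_o (fun x => f x - phi x) (fun x => f x - phi x) < e.
Proof.
split=> -[fe H]; split=> // e e0.
  have e2 : 0 < Num.sqrt (e / 2) by rewrite sqrtr_gt0 divr_gt0.
  have [phi [phif ltphi]] := H _ e2; exists phi; split => //.
  have fpe := psdB_closed (energy_psd g) fe (finite_energy_finsupp g phif).
  have [_] := norm_o_equiv fpe; move/le_lt_trans; apply.
  rewrite -ltr_pdivlMl// mulrC -[ltRHS]sqr_sqrtr ?divr_ge0 ?ltW//.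
  by rewrite ltrXn2r ?nnegrE ?sqrtr_ge0.
have [phi [phif ltphi]] := H _ (exprn_gt0 2 e0); exists phi; split => //.
have fpe := psdB_closed (energy_psd g) fe (finite_energy_finsupp g phif).
have [+ _] := norm_o_equiv fpe; move/le_lt_trans => /(_ _ ltphi).
by rewrite ltr_pXn2r// nnegrE ?sqrtr_ge0 ?ltW.
Qed.

Lemma D0_energy f : D0 g o f -> finite_energy g f. Proof. by case. Qed.

Lemma D0_finsupp f : finsupp f -> D0 g o f.
Proof.
move=> ff; apply/D0P; split=> [|e e0]; first exact: finite_energy_finsupp.
exists f; split => //; rewrite (_ : (fun x => _) = fun x => 0 * f x + (f x - f x)).
  have -> : (fun x => 0 * f x + (f x - f x)) = (fun x => f x - f x).
    by apply/funext => x; rewrite mul0r add0r.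
  have ee := finite_energy_finsupp g ff.
  by rewrite (psd_sqB energy_o_psd)// (_ : _ - _ + _ = 0) //; ring.
by apply/funext => x; rewrite mul0r add0r.
Qed.

Hypothesis conn : connected_graph g.

(** The estimate is carried from [o] along a path, one edge at a time; the difference across an edge
    of positive weight is controlled by the term of that edge in the energy. *)
Lemma diff_control x : exists2 C : R, 0 < C &
  forall f, finite_energy g f -> (f x - f o) ^+ 2 <= C * energy2 g f f.
Proof.
have [s] := conn o x; suff step : forall z : X, path (fun z z' : X => 0 < b g z z') z s && (last z s == x) ->
    (exists2 C : R, 0 < C &
      forall f, finite_energy g f -> (f z - f o) ^+ 2 <= C * energy2 g f f) ->
    exists2 C : R, 0 < C &
      forall f, finite_energy g f -> (f x - f o) ^+ 2 <= C * energy2 g f f.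
  move/step; apply.
  by exists 1 => // f fe; rewrite subrr expr0n mul1r (psd_ge0 (energy_psd g)).
elim: s => [|v s IH] z /=; first by move=> /eqP <-.
move=> /andP[/andP[buv ps] lx] [C C0 hC]; apply: (IH v); first by rewrite ps.
(* [(f v - f o)^2 <= 2 (f z - f o)^2 + 2 (f z - f v)^2], and a single ordered pair contributes at
   most [2 * energy2]; hence the 4. *)
exists (2 * C + 4 / b g z v); first by rewrite addr_gt0 ?divr_gt0 ?mulr_gt0.
move=> f fe; have /finite_energyP[fb _] := fe.
have : b g z v * (f z - f v) ^+ 2 <= 2 * energy2 g f f.
  apply: le_trans (wdot_le_energy g f); rewrite -lee_fin (wdot_nnsum (edge_weight_ge0 g))//.
  apply: (@le_term_nnsum _ _ (fun p => edge_weight g p * edge_diff f p ^+ 2) (z, v)) => p.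
  by apply: wl2_ge0; exact: edge_weight_ge0.
rewrite mulrC -ler_pdivlMr// => h.
have h2 := hC f fe.
have h3 : (f v - f o) ^+ 2 <= 2 * (f z - f o) ^+ 2 + 2 * (f z - f v) ^+ 2.
  by have := sqr_ge0 ((f z - f o) + (f z - f v)); rewrite !expr2; nra.
have -> : (2 * C + 4 / b g z v) * energy2 g f f =
  2 * (C * energy2 g f f) + 2 * (2 * energy2 g f f / b g z v) by ring.
lra.
Qed.

Lemma pointwise_control : exists2 C : X -> R, (forall x, 0 < C x) &
  forall x f, finite_energy g f -> f x ^+ 2 <= C x * energy_o f f.
Proof.
have [C HC] := choice (fun x => let: ex_intro2 C h1 h2 := diff_control x in
  ex_intro _ C (conj h1 h2)).
exists (fun x => 2 * C x + 2) => [x|x f fe].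
  by have [] := HC x; lra.
have [C0 /(_ f fe) h] := HC x.
have : f x ^+ 2 <= 2 * (f x - f o) ^+ 2 + 2 * f o ^+ 2.
  by have := sqr_ge0 (f x - f o - f o); rewrite !expr2; nra.
have e0 := psd_ge0 (energy_psd g) f; have := sqr_ge0 (f o); rewrite /energy_o -expr2.
have : 0 <= C x * f o ^+ 2 by rewrite mulr_ge0// ?sqr_ge0// ltW.
lra.
Qed.

(* Approximants of [u] in the energy norm need not be close to [u] in l2.  Clamping
   them between [-|u|] and [|u|] dominates the tails of both norms by those of
   [u], and on finite sets pointwise closeness suffices. *)
Lemma D0_dense u (e : R) : D0 g o u -> l2 u -> 0 < e ->
  exists psi, [/\ finsupp psi,
    energy2 g (fun x => u x - psi x) (fun x => u x - psi x) < e &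
    l2dot (fun x => u x - psi x) (fun x => u x - psi x) < e].
Proof.
move=> /D0P[ue uD] ul e0; have [C C0 HC] := pointwise_control.
have /finite_energyP[ub uc] := ue.
have e16 : 0 < e / 16 by rewrite divr_gt0.
have [|F [finF tF]] := nnsum_tail _ ub e16.
  by move=> p; apply: wl2_ge0; exact: edge_weight_ge0.
have [|F' [finF' tF']] := nnsum_tail _ ul e16; first by move=> x; exact: sqr_ge0.
pose D p := (p \in F)%:R * (edge_weight g p * (2 * (C p.1 + C p.2))).
pose D' x := (x \in F')%:R * C x.
have D0 p : 0 <= D p.
  by rewrite /D !mulr_ge0 ?edge_weight_ge0// addr_ge0// ltW.
have D'0 x : 0 <= D' x by rewrite /D' mulr_ge0// ltW.
have Ds : summ D.
  apply: summ_finite; apply: sub_finite_set finF => p /=; rewrite /D.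
  by case: (boolP (p \in F)) => [|_]; rewrite ?mul0r ?eqxx// inE.
have D's : summ D'.
  apply: summ_finite; apply: sub_finite_set finF' => p /=; rewrite /D'.
  by case: (boolP (p \in F')) => [|_]; rewrite ?mul0r ?eqxx// inE.
pose K := rsum D; pose K' := rsum D'.
have K0 : 0 <= K by exact: rsum_ge0.
have K'0 : 0 <= K' by exact: rsum_ge0.
(* [K / 2] pays for the edges in [F] and [K'] for the vertices in [F']; 5 is 4 for the energy of [v]
   entering through [difw] plus 1 for the killing term. *)
pose del := e / 4 / (K / 2 + K' + 5).
have del0 : 0 < del by rewrite !divr_gt0//; lra.
have [phi [phif ltphi]] := uD _ del0.
pose psi x := clamp `|u x| (phi x).
have psif : finsupp psi by apply: finsupp_sub phif => x; rewrite /psi => ->; exact: clamp0.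
have psie := finite_energy_finsupp g psif.
have phie := finite_energy_finsupp g phif.
have upe := psdB_closed (energy_psd g) ue psie.
have uphie := psdB_closed (energy_psd g) ue phie.
set w := fun x => u x - psi x; set v := fun x => u x - phi x.
rewrite -/v in ltphi uphie; rewrite -/w in upe.
have wv x : w x ^+ 2 <= v x ^+ 2 by apply: sqr_le_norm; exact: clamp_dist.
have wu x : w x ^+ 2 <= 4 * u x ^+ 2.
  have -> : 4 * u x ^+ 2 = (2 * u x) ^+ 2 by ring.
  apply: sqr_le_norm; rewrite [leRHS]normrM [X in X * _]ger0_norm//.
  exact: clamp_dist2.
have difw p : edge_diff w p ^+ 2 <= 8 * edge_diff u p ^+ 2 + 4 * edge_diff v p ^+ 2.
  have h1 : edge_diff psi p ^+ 2 <= edge_diff phi p ^+ 2 + edge_diff u p ^+ 2.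
    apply: le_trans (clamp_contract _ _ (normr_ge0 _) (normr_ge0 _)) _.
    by rewrite lerD2l; apply: sqr_le_norm; exact: ler_dist_dist.
  have h2 : edge_diff phi p ^+ 2 <= 2 * edge_diff v p ^+ 2 + 2 * edge_diff u p ^+ 2.
    have := sqr_ge0 (edge_diff v p + edge_diff u p).
    have -> : edge_diff phi p = edge_diff u p - edge_diff v p by rewrite /edge_diff /v; ring.
    by rewrite !expr2; nra.
  have h3 : edge_diff w p ^+ 2 <= 2 * edge_diff u p ^+ 2 + 2 * edge_diff psi p ^+ 2.
    have := sqr_ge0 (edge_diff u p + edge_diff psi p).
    have -> : edge_diff w p = edge_diff u p - edge_diff psi p by rewrite /edge_diff /w; ring.
    by rewrite !expr2; nra.
  lra.
have Bv x := HC x v uphie.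
have difw2 p : edge_diff w p ^+ 2 <= 2 * (C p.1 + C p.2) * energy_o v v.
  have h1 := Bv p.1; have h2 := Bv p.2; have h3 := wv p.1; have h4 := wv p.2.
  have : edge_diff w p ^+ 2 <= 2 * w p.1 ^+ 2 + 2 * w p.2 ^+ 2.
    by have := sqr_ge0 (w p.1 + w p.2); rewrite /edge_diff !expr2; nra.
  lra.
have Bv0 := psd_ge0 energy_o_psd v.
have /finite_energyP[wb wc] := upe; have /finite_energyP[vb vc] := uphie.
have tails : summ (fun p => (p \notin F)%:R * (edge_weight g p * edge_diff u p ^+ 2)).
  apply: ge0_summ; last exact: le_lt_trans tF (ltry _).
  by move=> p; rewrite mulr_ge0// wl2_ge0//; exact: edge_weight_ge0.
have tails' : summ (fun x => (x \notin F')%:R * (u x ^+ 2)).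
  apply: ge0_summ; last exact: le_lt_trans tF' (ltry _).
  by move=> p; rewrite mulr_ge0// sqr_ge0.
have tF2 : rsum (fun p => (p \notin F)%:R * (edge_weight g p * edge_diff u p ^+ 2)) <= e / 16.
  rewrite -lee_fin EFin_rsum//; last exact: le_lt_trans tF (ltry _).
  by move=> p; rewrite mulr_ge0// wl2_ge0//; exact: edge_weight_ge0.
have tF2' : rsum (fun x => (x \notin F')%:R * (u x ^+ 2)) <= e / 16.
  rewrite -lee_fin EFin_rsum//; last exact: le_lt_trans tF' (ltry _).
  by move=> p; rewrite mulr_ge0// sqr_ge0.
have delK : (K / 2 + K' + 5) * energy_o v v <= e / 4.
  have : (K / 2 + K' + 5) * del = e / 4 by rewrite /del; field; lra.
  by move=> <-; rewrite ler_wpM2l ?ltW//; lra.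
have KB : 0 <= K * energy_o v v by rewrite mulr_ge0.
have K'B : 0 <= K' * energy_o v v by rewrite mulr_ge0.
have vsb := wl2_summ (edge_weight_ge0 g) vb vb.
have wdv := wdot_le_energy g v.
have vBo := energy_le_energy_o v.
have main : wdot (edge_weight g) (edge_diff w) (edge_diff w) <= K * energy_o v v + 8 * energy_o v v + e / 2.
  apply: (@le_trans _ _ (rsum (fun p => (energy_o v v * D p + 4 * (edge_weight g p * edge_diff v p * edge_diff v p)) +
     8 * ((p \notin F)%:R * (edge_weight g p * edge_diff u p ^+ 2))))).
    have wsb := wl2_summ (edge_weight_ge0 g) wb wb; apply: ler_rsum => //.
      exact: (summD (summD (summZ _ Ds) (summZ _ vsb)) (summZ _ tails)).
    move=> p; rewrite /D; have b0 := edge_weight_ge0 g p.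
    have v0 : 0 <= 4 * (edge_weight g p * edge_diff v p * edge_diff v p).
      by rewrite mulr_ge0// -mulrA -expr2 wl2_ge0//; exact: edge_weight_ge0.
    rewrite -mulrA -expr2; case: (p \in F) => /=.
      by rewrite mul1r mul0r mulr0; have := ler_wpM2l b0 (difw2 p); lra.
    by rewrite mul1r mul0r mulr0; have := ler_wpM2l b0 (difw p); rewrite expr2; lra.
  rewrite (rsumD (summD (summZ _ Ds) (summZ _ vsb)) (summZ _ tails)).
  rewrite (rsumD (summZ _ Ds) (summZ _ vsb)).
  rewrite (rsumZ _ Ds) (rsumZ _ vsb) (rsumZ _ tails) -/K -/(wdot (edge_weight g) (edge_diff v) (edge_diff v)); lra.
have cw : wdot (c g) w w <= wdot (c g) v v.
  have := wl2_summ (@c_ge0 _ _ g) wc wc; have := wl2_summ (@c_ge0 _ _ g) vc vc.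
  move=> sv sw; apply: ler_rsum => //.
  by move=> x; rewrite -!mulrA -!expr2 ler_wpM2l ?c_ge0.
have cv : wdot (c g) v v <= energy2 g v v.
  by rewrite energy2E lerDr mulr_ge0 ?invr_ge0// (psd_ge0 (wdot_psd (edge_weight_ge0 g))).
exists psi; split => //; first by rewrite energy2E; lra.
have vl2 : l2 w.
  apply: (@l2_le _ _ _ (fun x => 2 * u x)) => [x|].
    rewrite [leRHS]normrM [X in _ <= X * _]ger0_norm//; exact: clamp_dist2.
  rewrite (_ : (fun x => _) = (fun x => u x - (- 1) * u x + 0 * u x)).
    have -> : (fun x => u x - -1 * u x + 0 * u x) = (fun x => 1 * u x + u x).
      by apply/funext => x; ring.
    exact: (psd_closed l2_psd).
  by apply/funext => x; ring.
apply: (@le_lt_trans _ _ (rsum (fun x => energy_o v v * D' x + 4 * ((x \notin F')%:R * u x ^+ 2)))).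
  apply: ler_rsum; [exact: l2_summ|exact: (summD (summZ _ D's) (summZ _ tails'))|].
  move=> x; rewrite -expr2 -/(w x) /D'; case: (x \in F') => /=.
    by rewrite mul1r mul0r mulr0; have := wv x; have := Bv x; lra.
  by rewrite mul1r mul0r mulr0; have := wu x; lra.
rewrite (rsumD (summZ _ D's) (summZ _ tails')).
rewrite (rsumZ _ D's) (rsumZ _ tails') -/K'; lra.
Qed.

End FormDomain.

Lemma rsum_le_lim {R : realType} {I : choiceType} (u : nat -> I -> R) (f : I -> R) (M : R) :
  (forall n i, 0 <= u n i) -> (forall i, u ^~ i @ \oo --> f i) ->
  (forall n, summ (u n)) -> (forall n, rsum (u n) <= M) ->
  (nnsum f <= M%:E)%E /\ rsum f <= M.
Proof.
move=> u0 uf us uM.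
have f0 i : 0 <= f i.
  by apply: (cvgr_to_ge (uf i)); exact: nearW.
have le : (nnsum f <= M%:E)%E.
  apply: (nnsum_le_lim u0 uf) => n; rewrite -EFin_rsum//; last exact: summ_ge0.
  by rewrite lee_fin.
split => //; rewrite -lee_fin EFin_rsum//; exact: le_lt_trans le (ltry _).
Qed.

Lemma nnsum_sum {R : realType} {I J : choiceType} (F : I + J -> R) :
  (forall s, 0 <= F s) -> nnsum F = (nnsum (F \o inl) + nnsum (F \o inr))%E.
Proof.
move=> F0; pose F1 (s : I + J) := if s is inl i then F (inl i) else 0.
pose F2 (s : I + J) := if s is inr i then F (inr i) else 0.
have F10 s : 0 <= F1 s by case: s => /=.
have F20 s : 0 <= F2 s by case: s => /=.
transitivity (nnsum (fun s => F1 s + F2 s)).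
  by congr nnsum; apply/funext => -[i|j]; rewrite /F1 /F2/= ?addr0 ?add0r.
rewrite nnsumD//; congr (_ + _)%E.
  rewrite (@nnsum_inj _ _ _ (@inl I J) F1)// => [? ? []//|[i|j]//= /(_ i)//].
by rewrite (@nnsum_inj _ _ _ (@inr I J) F2)// => [? ? []//|[i|j]//= /(_ j)//].
Qed.

Lemma esum_swap {R : realType} {I J : choiceType} (F : I -> J -> \bar R) :
  (forall i j, 0 <= F i j)%E ->
  (\esum_(i in [set: I]) \esum_(j in [set: J]) F i j =
   \esum_(j in [set: J]) \esum_(i in [set: I]) F i j)%E.
Proof.
move=> F0; rewrite (@esum_esum _ _ _ _ (fun=> setT))//.
rewrite (@esum_esum _ _ _ _ (fun=> setT) (fun j i => F i j))//.
rewrite (reindex_esum ([set: J] `*`` (fun=> [set: I])) _ (fun x : J * I => (x.2, x.1)))//.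
split=> //=.
- by move=> [i1 i2] [j1 j2] /= _ _ [] -> ->.
- by move=> [i1 i2] _; exists (i2, i1).
Qed.

(** * The Green function as a limit of finitely supported subsolutions *)

Section GreenFunction.
Context {R : realType} {X : countType} (g : graph X R) (o : X).
Hypothesis conn : connected_graph g.
Implicit Types (f h u phi : X -> R) (x y z : X).

(** Edges and vertices share one index type, so that the quadratic form of [energy2] becomes a
    single sum and one application of Fatou yields its lower semicontinuity with the exact bound. *)
Definition energy_density f (s : (X * X) + X) : R :=
  match s with
  | inl p => 2^-1 * (edge_weight g p * edge_diff f p ^+ 2)
  | inr x => c g x * f x ^+ 2
  end.

Lemma energy_density_ge0 f s : 0 <= energy_density f s.
Proof.
case: s => [p|x] /=; last by rewrite wl2_ge0//; exact: c_ge0.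
by rewrite mulr_ge0 ?invr_ge0// wl2_ge0//; exact: edge_weight_ge0.
Qed.

Lemma nnsum_energy_density f : nnsum (energy_density f) =
  ((2^-1)%:E * nnsum (fun p : X * X => edge_weight g p * edge_diff f p ^+ 2)%R +
    nnsum (fun x => c g x * f x ^+ 2)%R)%E.
Proof.
rewrite nnsum_sum; last exact: energy_density_ge0.
congr (_ + _)%E; rewrite -nnsumZ ?invr_ge0// => p.
by rewrite wl2_ge0//; exact: edge_weight_ge0.
Qed.

Lemma energy_lsc (u : nat -> X -> R) f (M : R) :
  (forall n, finite_energy g (u n)) -> (forall x, u ^~ x @ \oo --> f x) ->
  (forall n, energy2 g (u n) (u n) <= M) ->
  finite_energy g f /\ energy2 g f f <= M.
Proof.
move=> ue uf uM.
have le : (nnsum (energy_density f) <= M%:E)%E.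
  apply: (@nnsum_le_lim _ _ (fun n => energy_density (u n))); first by move=> n i; exact: energy_density_ge0.
    case=> [p|x] /=.
      apply: cvgM; first exact: cvg_cst.
      apply: cvgM; first exact: cvg_cst.
      by rewrite /edge_diff; under eq_fun do rewrite expr2; rewrite expr2; apply: cvgM; apply: cvgB; exact: uf.
    apply: cvgM; first exact: cvg_cst.
    by under eq_fun do rewrite expr2; rewrite expr2; apply: cvgM; exact: uf.
  move=> n; have /finite_energyP[u1 u2] := ue n.
  rewrite nnsum_energy_density -(wdot_nnsum (edge_weight_ge0 g))// -(wdot_nnsum (@c_ge0 _ _ g))//.
  by rewrite -EFinM -EFinD lee_fin -energy2E.
have A0 : (0 <= nnsum (fun p : X * X => edge_weight g p * edge_diff f p ^+ 2)%R)%E.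
  by apply: nnsum_ge0 => p; rewrite wl2_ge0//; exact: edge_weight_ge0.
have C0 : (0 <= nnsum (fun x => c g x * f x ^+ 2)%R)%E.
  by apply: nnsum_ge0 => p; rewrite wl2_ge0//; exact: c_ge0.
have fe : finite_energy g f.
  apply/finite_energyP; rewrite /wl2.
  move: le; rewrite nnsum_energy_density => le; split.
    have : ((2^-1)%:E * nnsum (fun p : X * X => edge_weight g p * edge_diff f p ^+ 2)%R <= M%:E)%E.
      by apply: le_trans le; rewrite leeDl.
    rewrite -lee_pdivlMl ?invr_gt0// invrK => /le_lt_trans; apply.
    by rewrite -EFinM ltry.
  apply: (@le_lt_trans _ _ M%:E); last exact: ltry.
  by apply: le_trans le; rewrite leeDr// mule_ge0// lee_fin invr_ge0.
split => //; have /finite_energyP[u1 u2] := fe.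
rewrite -lee_fin; apply: le_trans le.
rewrite nnsum_energy_density -(wdot_nnsum (edge_weight_ge0 g))// -(wdot_nnsum (@c_ge0 _ _ g))//.
Qed.

(* Picard iteration for [deg u = 1_y + sum_z b u]; the condition on [pickle] makes
   every iterate finitely supported. *)
Fixpoint green_n y (n : nat) : X -> R :=
  if n is n'.+1 then
    fun x => if (pickle x < n)%N then (ind R y x + adj g (green_n y n') x) / deg g x else 0
  else fun=> 0.

Lemma deg_ge0 x : 0 <= deg g x.
Proof.
by rewrite addr_ge0 ?c_ge0// jump_rateE; apply: rsum_ge0 => y; exact: b_ge0.
Qed.

Lemma green_n_ge0 y n x : 0 <= green_n y n x.
Proof.
elim: n x => [|n IH] x //=; case: ifP => // _.
by rewrite divr_ge0 ?deg_ge0// addr_ge0 ?adj_ge0.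
Qed.

Lemma green_n_finsupp y n : finsupp (green_n y n).
Proof.
apply: (@sub_finite_set _ _ [set` pmap (unpickle : nat -> option X) (iota 0 n)]).
  move=> x /=; case: n => [|n] /=; first by rewrite eqxx.
  case: ifP => [xn _|_]; last by rewrite eqxx.
  suff : x \in pmap (unpickle : nat -> option X) (iota 0 n.+1) by [].
  by rewrite mem_pmap -pickleK map_f// mem_iota.
exact: finite_seq.
Qed.

Lemma finsupp_formal f : finsupp f -> formal_dom g f.
Proof. by move=> /l2_finsupp; exact: l2_formal. Qed.

(** The cutoff set grows with [n], and inside it the update is monotone in the previous iterate. *)
Lemma green_n_mono y x : nondecreasing_seq (green_n y ^~ x).
Proof.
apply/nondecreasing_seqP => n; elim: n x => [|n IH] x.
  by rewrite [leLHS]/=; exact: green_n_ge0.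
have -> : green_n y n.+2 x = if (pickle x < n.+2)%N then (ind R y x + adj g (green_n y n.+1) x) / deg g x else 0 by [].
have -> : green_n y n.+1 x = if (pickle x < n.+1)%N then (ind R y x + adj g (green_n y n) x) / deg g x else 0 by [].
case: ifP => xn.
  rewrite ltnW// ler_wpM2r ?invr_ge0 ?deg_ge0// lerD2l le_adj//; exact/finsupp_formal/green_n_finsupp.
by case: ifP => // _; rewrite divr_ge0 ?deg_ge0// addr_ge0 ?adj_ge0// => z; exact: green_n_ge0.
Qed.

Hypothesis degp : forall x, 0 < deg g x.

(** Inside the cutoff [deg * green_n] equals [1_y + adj] of the previous, smaller iterate; outside,
    the function is 0 and its Laplacian is [- adj <= 0]. *)
Lemma laplacian_green_n y n x : laplacian g (green_n y n) x <= ind R y x.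
Proof.
rewrite laplacianE; last exact/finsupp_formal/green_n_finsupp.
have i0 : 0 <= ind R y x by rewrite ler0n.
case: n => [|n]; first by rewrite /= mulr0 sub0r lerNl (le_trans _ (adj_ge0 _ _ _))// ?oppr_le0.
have -> : green_n y n.+1 x = if (pickle x < n.+1)%N then (ind R y x + adj g (green_n y n) x) / deg g x else 0 by [].
case: ifP => _; last first.
  by rewrite mulr0 sub0r lerNl (le_trans _ (adj_ge0 _ _ _)) ?oppr_le0// => z; exact: green_n_ge0.
rewrite mulrC divfK ?gt_eqF// lerBlDr lerD2l le_adj//; try exact/finsupp_formal/green_n_finsupp.
by move=> z; exact: green_n_mono.
Qed.

Lemma energy_green_n y n : energy2 g (green_n y n) (green_n y n) <= green_n y n y.
Proof.
have gf := green_n_finsupp y n; rewrite energy2_finsupp//; last exact: finite_energy_finsupp.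
rewrite -[leRHS](rsum_ind y (green_n y n)); apply: ler_rsum.
- exact: summ_finsupp.
- exact/summ_finsupp/finsupp_single.
- by move=> x; rewrite mulrC ler_wpM2r ?green_n_ge0// laplacian_green_n.
Qed.

(** Both sides are continuous in [u] for [energy_o], by Cauchy-Schwarz and by [pointwise_control].
    [K] collects the two constants, so a defect [a] would satisfy
    [a^2 <= K * energy_o (u - phi) < a^2]. *)
Lemma energy2_reproducing_D0 F y : finite_energy g F ->
  (forall phi, finsupp phi -> energy2 g F phi = phi y) ->
  forall u, D0 g o u -> energy2 g F u = u y.
Proof.
move=> Fe H u /D0P[ue uD]; have [C C0 HC] := pointwise_control o conn.
have E := energy_psd g; have F0 := psd_ge0 E F.
apply/eqP; rewrite -subr_eq0; apply/negP => /negP a0.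
pose a := energy2 g F u - u y; rewrite -/a in a0.
pose K := 2 * energy2 g F F + 2 * C y.
have K0 : 0 < K by have := C0 y; rewrite /K; lra.
have [|phi [phif lt]] := uD (a ^+ 2 / K); first by rewrite divr_gt0// exprn_even_gt0.
have phie := finite_energy_finsupp g phif.
have upe := psdB_closed E ue phie.
have : a ^+ 2 <= K * energy_o g o (fun x => u x - phi x) (fun x => u x - phi x).
  have h1 := psd_CS2 E Fe upe; have h2 := HC y _ upe.
  have h3 := energy_le_energy_o g o (fun x => u x - phi x).
  have -> : a = energy2 g F (fun x => u x - phi x) - (u y - phi y).
    by rewrite (psdBr E ue phie Fe) (H _ phif) /a; ring.
  have B0 := psd_ge0 (energy_o_psd g o) (fun x => u x - phi x).
  have h4 := ler_wpM2l F0 h3.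
  have h5 := sqr_ge0 (energy2 g F (fun x => u x - phi x) + (u y - phi y)).
  rewrite /K; move: h1 h2 h4 h5; rewrite !expr2; nra.
move/le_lt_trans => /(_ (K * (a ^+ 2 / K))); rewrite ltr_pM2l// => /(_ lt).
by rewrite mulrCA divff ?gt_eqF// mulr1 ltxx.
Qed.

(* The energy of [green_n y n] is at most its value at [y], and testing the Green
   function against [green_n y n] gives back that value; so [green_n y n] stays below
   the Green function at [y], and its limit has minimal energy. *)
Section Limit.
Variables (y : X) (G : X -> R).
Hypothesis GG : is_green g o y G.

Let Ge : finite_energy g G. Proof. by case: GG => -[]. Qed.

Lemma energy2_green phi : finsupp phi -> energy2 g G phi = phi y.
Proof.
case: GG => _ _ GL phif; rewrite energy2_finsupp// GL -[RHS](rsum_ind y phi).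
by congr rsum; apply/funext => x; rewrite mulrC.
Qed.

Lemma energy_green : energy2 g G G = G y.
Proof. by case: GG => GD _ _; exact: (energy2_reproducing_D0 Ge energy2_green). Qed.

Lemma green_n_le_green n : green_n y n y <= G y.
Proof.
have ge := finite_energy_finsupp g (green_n_finsupp y n).
have := psd_ge0 (energy_psd g) (fun x => G x - green_n y n x).
rewrite (psd_sqB (energy_psd g))// energy_green energy2_green; last exact: green_n_finsupp.
by have := energy_green_n y n; lra.
Qed.

(** The value at [y] bounds the energy, and the energy bounds the difference between [x] and [y]
    through [diff_control] based at [y]. *)
Lemma green_n_bounded x : exists M, forall n, green_n y n x <= M.
Proof.
have [C C0 HC] := diff_control y conn x.
exists (G y + (1 + C * G y)) => n.
have := HC _ (finite_energy_finsupp g (green_n_finsupp y n)).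
have h1 := energy_green_n y n; have h2 := green_n_le_green n.
have := ler_wpM2l (ltW C0) (le_trans h1 h2).
have := sqr_ge0 (green_n y n x - green_n y n y - 1).
by rewrite !expr2; nra.
Qed.

Definition green_lim x := lim (green_n y ^~ x @ \oo).

Lemma green_lim_cvg x : green_n y ^~ x @ \oo --> green_lim x.
Proof.
have [M HM] := green_n_bounded x; apply: nondecreasing_is_cvgn; first exact: green_n_mono.
by exists M => _ [n _ <-].
Qed.

#[local] Arguments green_lim_cvg : clear implicits.

Lemma green_n_le_green_lim n x : green_n y n x <= green_lim x.
Proof.
apply: nondecreasing_cvgn_le; first exact: green_n_mono.
by apply/cvg_ex; exists (green_lim x); exact: green_lim_cvg.
Qed.

Lemma green_lim_energy : finite_energy g green_lim /\ energy2 g green_lim green_lim <= green_lim y.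
Proof.
apply: (@energy_lsc (green_n y)) => [n|x|n].
- exact/finite_energy_finsupp/green_n_finsupp.
- exact: green_lim_cvg.
- exact: le_trans (energy_green_n y n) (green_n_le_green_lim n y).
Qed.

Lemma green_lim_formal : formal_dom g green_lim.
Proof. exact: finite_energy_formal green_lim_energy.1. Qed.

Lemma green_lim_ge0 x : 0 <= green_lim x.
Proof. exact: le_trans (green_n_ge0 y 0 x) (green_n_le_green_lim 0 x). Qed.

Lemma green_lim_eq x : deg g x * green_lim x = ind R y x + adj g green_lim x.
Proof.
apply/eqP; rewrite eq_le; apply/andP; split.
  rewrite mulrC -ler_pdivlMr//; apply: (cvgr_to_le (green_lim_cvg x)); apply: nearW => -[|n].
    by rewrite divr_ge0 ?deg_ge0// addr_ge0 ?ler0n// adj_ge0// => z; exact: green_lim_ge0.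
  rewrite /=; case: ifP => _; last by rewrite divr_ge0 ?deg_ge0// addr_ge0 ?ler0n// adj_ge0// => z; exact: green_lim_ge0.
  rewrite ler_wpM2r ?invr_ge0 ?deg_ge0// lerD2l le_adj//; [exact/finsupp_formal/green_n_finsupp|exact: green_lim_formal|].
  by move=> z; exact: green_n_le_green_lim.
rewrite addrC -lerBrDr.
(* Shifting the sequence by [pickle x] keeps [x] inside the cutoff, so the recursion holds at [x]
   for every [n]. *)
apply: (proj2 (@rsum_le_lim _ _ (fun n z => b g x z * green_n y (n + pickle x) z) _ _ _ _ _ _)).
- by move=> n z; rewrite mulr_ge0 ?b_ge0 ?green_n_ge0.
- move=> z; apply: cvgM; first exact: cvg_cst.
  by have := green_lim_cvg z; rewrite -(cvg_shiftn (pickle x)).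
- by move=> n; have /formal_domE := finsupp_formal (green_n_finsupp y (n + pickle x)); exact.
move=> n; have := green_n_le_green_lim (n + pickle x).+1 x.
rewrite /= ltnS leq_addl ler_pdivrMr// /adj; lra.
Qed.

(** At this point the limit is not known to lie in [D0], so the uniqueness in [transient] cannot be
    invoked. Instead [energy2 green_lim G = G y] by the reproducing property, so the energy of the
    difference is at most [green_lim y - G y <= 0]; the difference is then constant, and it vanishes
    at [y]. *)
Lemma green_lim_green : green_lim = G.
Proof.
have [le lle] := green_lim_energy; have E := energy_psd g.
have lL : laplacian g green_lim = ind R y.
  by apply/funext => x; rewrite laplacianE ?green_lim_eq ?addrK//; exact: green_lim_formal.
have lphi phi : finsupp phi -> energy2 g green_lim phi = phi y.
  move=> phif; rewrite energy2_finsupp// lL -[RHS](rsum_ind y phi).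
  by congr rsum; apply/funext => x; rewrite mulrC.
have lG : energy2 g green_lim G = G y.
  by case: GG => GD _ _; exact: (energy2_reproducing_D0 le lphi).
have lyG : green_lim y <= G y.
  by apply: (cvgr_to_le (green_lim_cvg y)); apply: nearW => n; exact: green_n_le_green.
have sq := psd_sqB E le Ge; rewrite lG energy_green in sq.
have sq0 := psd_ge0 E (fun x => green_lim x - G x).
have z0 : energy2 g (fun x => green_lim x - G x) (fun x => green_lim x - G x) = 0 by lra.
have gG : green_lim y = G y by lra.
apply/funext => x; have [C C0 HC] := diff_control y conn x.
have := HC _ (psdB_closed E le Ge); rewrite z0 mulr0 gG subrr subr0.
have := sqr_ge0 (green_lim x - G x) => h1 h2.
have /eqP : (green_lim x - G x) ^+ 2 = 0 by lra.
by rewrite sqrf_eq0 subr_eq0 => /eqP.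
Qed.

End Limit.

End GreenFunction.

(** * The survival function and the identity [Gc = 1 - surv] *)

Section Transient.
Context {R : realType} {X : countType} (g : graph X R) (o : X).
Hypothesis conn : connected_graph g.
Hypothesis trans : transient g o.
Implicit Types (f h u phi : X -> R) (x y z : X).

Lemma is_green_green y : is_green g o y (fun x => green g o x y).
Proof.
have [G [GG _]] := trans y; rewrite /green.
by apply: (@xgetPex _ _ [set u | is_green g o y u]); exists G.
Qed.

(** At an isolated vertex without killing every Laplacian vanishes, which contradicts
    [laplacian G_x = 1_x] at [x]. *)
Lemma deg_gt0 x : 0 < deg g x.
Proof.
rewrite lt_neqAle deg_ge0 andbT eq_sym; apply/eqP => dx.
have [_ _ /(congr1 (@^~ x))] := is_green_green x.
have j0 : 0 <= jump_rate g x.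
  by rewrite jump_rateE; apply: rsum_ge0 => y; exact: b_ge0.
have c0 := c_ge0 g x; rewrite /deg in dx.
have b0 : forall y, b g x y = 0.
  apply: rsum_eq0; [exact: b_ge0|exact: b_summ|].
  by rewrite -jump_rateE; lra.
rewrite /laplacian (_ : (fun y => _) = fun=> 0); last first.
  by apply/funext => y; rewrite b0 mul0r.
rewrite rsum0 (_ : c g x = 0) ?mul0r ?addr0 /ind ?eqxx; last by lra.
by move/eqP; rewrite eq_sym oner_eq0.
Qed.

Lemma green_n_cvg y x : green_n g y ^~ x @ \oo --> green g o x y.
Proof.
have := green_lim_cvg conn deg_gt0 (is_green_green y) (x := x).
by rewrite (green_lim_green conn deg_gt0 (is_green_green y)).
Qed.

Lemma green_n_le y n x : green_n g y n x <= green g o x y.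
Proof.
have := green_n_le_green_lim conn deg_gt0 (is_green_green y) n x.
by rewrite (green_lim_green conn deg_gt0 (is_green_green y)).
Qed.

Lemma green_ge0 x y : 0 <= green g o x y.
Proof. exact: le_trans (green_n_ge0 g y 0 x) (green_n_le y 0 x). Qed.

Lemma green_formal y : formal_dom g (fun x => green g o x y).
Proof. by case: (is_green_green y). Qed.

Lemma green_eq x y : deg g x * green g o x y = ind R y x + adj g (fun z => green g o z y) x.
Proof.
have [_ fd /(congr1 (@^~ x))] := is_green_green y.
by rewrite laplacianE// => <-; rewrite addrNK.
Qed.

Fixpoint surv_n (n : nat) : X -> R :=
  if n is n'.+1 then fun x => adj g (surv_n n') x / deg g x else fun=> 1.

Lemma adj1 x : adj g (fun=> 1) x = jump_rate g x.
Proof. by rewrite jump_rateE /adj; congr rsum; apply/funext => y; rewrite mulr1. Qed.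

Lemma jump_le_deg x : jump_rate g x <= deg g x.
Proof. by rewrite lerDl c_ge0. Qed.

Lemma surv_n01 n x : 0 <= surv_n n x <= 1.
Proof.
elim: n x => [|n IH] x /=; first by rewrite ler01 lexx.
have v0 z : 0 <= surv_n n z by case/andP: (IH z).
have v1 z : surv_n n z <= 1 by case/andP: (IH z).
have a0 := adj_ge0 g x v0; have d0 := deg_gt0 x.
apply/andP; split; first by rewrite divr_ge0// ltW.
rewrite ler_pdivrMr// mul1r.
apply: le_trans (jump_le_deg x); rewrite -adj1 le_adj//; last exact: formal_cst.
by apply: (@formal_le _ _ _ _ (fun=> 1)); [move=> z; rewrite ger0_norm|exact: formal_cst].
Qed.

Lemma surv_n_formal n : formal_dom g (surv_n n).
Proof.
apply: (@formal_le _ _ _ _ (fun=> 1)); last exact: formal_cst.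
by move=> z; have /andP[? ?] := surv_n01 n z; rewrite ger0_norm.
Qed.

Lemma surv_nS n x : deg g x * surv_n n.+1 x = adj g (surv_n n) x.
Proof. by rewrite /= mulrC divfK ?gt_eqF ?deg_gt0. Qed.

Lemma surv_n_mono x : nonincreasing_seq (surv_n ^~ x).
Proof.
apply/nonincreasing_seqP => n; elim: n x => [|n IH] x.
  by case/andP: (surv_n01 1 x).
rewrite -(ler_pM2l (deg_gt0 x)) !surv_nS le_adj//; exact: surv_n_formal.
Qed.

Definition surv x := lim (surv_n ^~ x @ \oo).

Lemma surv_cvg x : surv_n ^~ x @ \oo --> surv x.
Proof.
apply: nonincreasing_is_cvgn; first exact: surv_n_mono.
by exists 0 => _ [n _ <-]; case/andP: (surv_n01 n x).
Qed.

#[local] Arguments surv_cvg : clear implicits.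

Lemma surv_le n x : surv x <= surv_n n x.
Proof.
apply: nonincreasing_cvgn_ge; first exact: surv_n_mono.
by apply/cvg_ex; exists (surv x); exact: surv_cvg.
Qed.

Lemma surv_ge0 x : 0 <= surv x.
Proof.
by apply: (cvgr_to_ge (surv_cvg x)); apply: nearW => n; case/andP: (surv_n01 n x).
Qed.

Lemma surv_le1 x : surv x <= 1. Proof. exact: surv_le 0%N x. Qed.

Lemma surv_formal : formal_dom g surv.
Proof.
apply: (@formal_le _ _ _ _ (fun=> 1)); last exact: formal_cst.
by move=> z; rewrite ger0_norm ?surv_ge0 ?surv_le1.
Qed.

Lemma adj_1B f x : formal_dom g f -> adj g (fun z => 1 - f z) x = jump_rate g x - adj g f x.
Proof.
move=> fd; rewrite (_ : (fun z => _) = (fun z => -1 * f z + 1)).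
  by rewrite adjZD ?adj1//; [ring|exact: formal_cst].
by apply/funext => z; ring.
Qed.

Lemma surv_harmonic x : deg g x * surv x = adj g surv x.
Proof.
apply/eqP; rewrite eq_le; apply/andP; split; last first.
  rewrite mulrC -ler_pdivrMr ?deg_gt0//; apply: (cvgr_to_ge (surv_cvg x)).
  apply: nearW => -[|n].
    by case/andP: (surv_n01 1 x) => _; apply: le_trans;
      rewrite /= ler_wpM2r ?invr_ge0 ?deg_ge0// le_adj//; [exact: surv_formal|exact: formal_cst|exact: surv_le1].
  rewrite /= ler_wpM2r ?invr_ge0 ?deg_ge0// le_adj//; [exact: surv_formal|exact: surv_n_formal|].
  by move=> z; exact: surv_le.
(* Fatou gives upper bounds on sums of nonnegative families; applied to [1 - surv_n] it bounds
   [adj surv] from below. *)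
suff : adj g (fun z => 1 - surv z) x <= jump_rate g x - deg g x * surv x.
  by rewrite adj_1B; [lra|exact: surv_formal].
apply: (proj2 (@rsum_le_lim _ _ (fun n z => b g x z * (1 - surv_n n z)) _ _ _ _ _ _)).
- by move=> n z; rewrite mulr_ge0 ?b_ge0// subr_ge0; case/andP: (surv_n01 n z).
- move=> z; apply: cvgM; first exact: cvg_cst.
  by apply: cvgB; [exact: cvg_cst|exact: surv_cvg].
- move=> n; have /formal_domE : formal_dom g (fun z => 1 - surv_n n z); last exact.
  apply: (@formal_le _ _ _ _ (fun=> 1)); last exact: formal_cst.
  by move=> z; have /andP[? ?] := surv_n01 n z; rewrite ger0_norm; lra.
move=> n; rewrite -/(adj g (fun z => 1 - surv_n n z) x) adj_1B; last exact: surv_n_formal.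
by rewrite -surv_nS lerB// ler_wpM2l ?deg_ge0// surv_le.
Qed.

(** Minimum principle: where the nonnegative harmonic function vanishes, so does its weighted sum
    over the neighbours, hence each neighbour's value. *)
Lemma surv_all x y : surv x = 0 -> surv y = 0.
Proof.
have [s] := conn x y; elim: s x => [|z s IH] x /=; first by move=> /eqP ->.
move=> /andP[/andP[bxz ps] lz] Wx; apply: (IH z); first by rewrite ps.
have := surv_harmonic x; rewrite Wx mulr0 => /esym a0.
have /formal_domE Ws := surv_formal.
have /eqP : b g x z * surv z = 0.
  by apply: (rsum_eq0 _ (Ws x) a0) => z'; rewrite mulr_ge0 ?b_ge0 ?surv_ge0.
by rewrite mulf_eq0 gt_eqF//= => /eqP.
Qed.

(** [1 - surv] is a nonnegative solution of [deg w = c + adj w], and these sums are truncated Picard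
    iterates from 0 for the same equation. *)
Lemma green_n_sum_le n (s : seq X) x : uniq s ->
  \sum_(y <- s) c g y * green_n g y n x <= 1 - surv x.
Proof.
move=> us; elim: n x => [|n IH] x.
  rewrite big1 ?subr_ge0 ?surv_le1// => y _; by rewrite /= mulr0.
have adjS : adj g (fun z => \sum_(y <- s) c g y * green_n g y n z) x =
    \sum_(y <- s) c g y * adj g (green_n g y n) x /\
    formal_dom g (fun z => \sum_(y <- s) c g y * green_n g y n z).
  elim: s {us IH} => [|y s [IH1 IH2]].
    under eq_fun do rewrite big_nil; rewrite big_nil; split; last exact: formal_cst.
    by rewrite /adj; under eq_fun do rewrite mulr0; exact: rsum0.
  under eq_fun do rewrite big_cons; rewrite big_cons.
  have fd := finsupp_formal g (green_n_finsupp g y n).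
  by rewrite adjZD// IH1; split => //; exact: formal_domZD.
have [aS fS] := adjS.
have cs : \sum_(y <- s) c g y * ind R y x <= c g x.
  elim: s us {adjS IH aS fS} => [|y s IH] /=; first by rewrite big_nil c_ge0.
  move=> /andP[ys us]; rewrite big_cons /ind; have [xy|xy] := eqVneq x y.
    rewrite mulr1 big_seq big1 ?addr0 ?xy// => z zs.
    have [yz|_] := eqVneq y z; last by rewrite mulr0.
    by move: ys; rewrite yz zs.
  by rewrite mulr0 add0r; exact: IH.
have W1 : formal_dom g (fun z => 1 - surv z).
  apply: (@formal_le _ _ _ _ (fun=> 1)); last exact: formal_cst.
  by move=> z; have := surv_ge0 z; have := surv_le1 z => ? ?; rewrite ger0_norm; lra.
have key : \sum_(y <- s) c g y * ((ind R y x + adj g (green_n g y n) x) / deg g x) <= 1 - surv x.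
  under eq_bigr do rewrite mulrA mulrDr; rewrite -mulr_suml big_split/= -aS.
  rewrite ler_pdivrMr ?deg_gt0//.
  have := le_adj x fS W1 IH; rewrite adj_1B -?surv_harmonic; last exact: surv_formal.
  by have : deg g x = jump_rate g x + c g x by []; lra.
apply: le_trans key; apply: ler_sum => y _; rewrite ler_wpM2l ?c_ge0//=.
case: ifP => // _.
by rewrite divr_ge0 ?deg_ge0// addr_ge0 ?ler0n// adj_ge0// => z; exact: green_n_ge0.
Qed.

Lemma green_c_le x : (green_c g o x <= (1 - surv x)%:E)%E.
Proof.
apply: ge_ereal_sup => _ [F [finF _] <-].
rewrite fsbig_finite//= sumEFin lee_fin.
have cv : (fun n => \sum_(y <- finmap.enum_fset (fset_set F)) c g y * green_n g y n x) @ \oo -->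
   \sum_(y <- finmap.enum_fset (fset_set F)) green g o x y * c g y.
  elim: (finmap.enum_fset _) => [|y r IH].
    by rewrite big_nil; under eq_fun do rewrite big_nil; exact: cvg_cst.
  rewrite big_cons; under eq_fun do rewrite big_cons.
  apply: cvgD => //; rewrite mulrC; apply: cvgM; first exact: cvg_cst.
  exact: green_n_cvg.
by apply: (cvgr_to_le cv); apply: nearW => n; apply: green_n_sum_le; exact: finmap.fset_uniq.
Qed.

Definition green_killing x := rsum (fun y => green g o x y * c g y).

Lemma green_c_term_ge0 x y : 0 <= green g o x y * c g y.
Proof. by rewrite mulr_ge0 ?green_ge0 ?c_ge0. Qed.

Lemma green_c_fin x : (nnsum (fun y => green g o x y * c g y)%R < +oo)%E.
Proof. exact: le_lt_trans (green_c_le x) (ltry _). Qed.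

Lemma green_killingE x : (green_killing x)%:E = green_c g o x.
Proof. by rewrite /green_killing EFin_rsum//; [exact: green_c_term_ge0|exact: green_c_fin]. Qed.

Lemma green_killing_le1 x : green_killing x <= 1 - surv x.
Proof. by rewrite -lee_fin green_killingE green_c_le. Qed.

Lemma green_killing_ge0 x : 0 <= green_killing x.
Proof. by apply: rsum_ge0; exact: green_c_term_ge0. Qed.

Lemma green_killing_formal : formal_dom g green_killing.
Proof.
apply: (@formal_le _ _ _ _ (fun=> 1)); last exact: formal_cst.
by move=> z; rewrite ger0_norm ?green_killing_ge0//; have := green_killing_le1 z; have := surv_ge0 z; lra.
Qed.

(** The equation of each Green function, weighted by [c y] and summed over [y]; nonnegativity lets
    [adj] pass through the sum. *)
Lemma green_killing_eq x : deg g x * green_killing x = c g x + adj g green_killing x.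
Proof.
have /formal_domE rs := green_killing_formal.
have gs y : summ (fun z => b g x z * green g o z y) by have /formal_domE := green_formal y.
apply/EFin_inj; rewrite EFinM EFinD green_killingE /green_c -/(nnsum (fun y => green g o x y * c g y)).
rewrite -nnsumZ ?deg_ge0//; last exact: green_c_term_ge0.
rewrite (_ : (fun y => _) = (fun y => ind R x y * c g y +
    c g y * adj g (fun z => green g o z y) x)); last first.
  by apply/funext => y; rewrite mulrA green_eq /ind eq_sym; ring.
rewrite nnsumD; first last.
- by move=> y; rewrite mulr_ge0 ?c_ge0// adj_ge0// => z; exact: green_ge0.
- by move=> y; rewrite mulr_ge0 ?c_ge0// ler0n.
rewrite [RHS]EFinD; congr (_ + _)%E.
  rewrite -EFin_rsum ?rsum_ind//; first by move=> y; rewrite mulr_ge0 ?c_ge0// ler0n.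
  by apply: summ_ge0; [move=> y; rewrite mulr_ge0 ?c_ge0// ler0n|exact/summ_finsupp/finsupp_single].
rewrite /adj EFin_rsum; last 2 first.
- by move=> y; rewrite mulr_ge0 ?b_ge0 ?green_killing_ge0.
- by apply: summ_ge0 => // y; rewrite mulr_ge0 ?b_ge0 ?green_killing_ge0.
transitivity (\esum_(y in [set: X]) \esum_(z in [set: X]) (b g x z * (green g o z y * c g y))%:E)%E.
  apply: eq_esum => y _; rewrite EFinM EFin_rsum; last 2 first.
  - by move=> z; rewrite mulr_ge0 ?b_ge0 ?green_ge0.
  - by apply: summ_ge0 => // z; rewrite mulr_ge0 ?b_ge0 ?green_ge0.
  rewrite -nnsumZ ?c_ge0//; last by move=> z; rewrite mulr_ge0 ?b_ge0 ?green_ge0.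
  by apply: eq_esum => z _; congr (_%:E); ring.
rewrite esum_swap; last by move=> y z; rewrite lee_fin mulr_ge0 ?b_ge0 ?green_c_term_ge0.
apply: eq_esum => z _; rewrite EFinM green_killingE /green_c -/(nnsum (fun y => green g o z y * c g y)).
by rewrite -nnsumZ ?b_ge0//; exact: green_c_term_ge0.
Qed.

(** The functions [1 - surv_n] are the Picard iterates from 0 of [deg w = c + adj w], so they stay
    below any nonnegative solution. With [green_killing_le1] this pins down [green_killing]. *)
Lemma surv_n_green_killing n x : 1 - surv_n n x <= green_killing x.
Proof.
elim: n x => [|n IH] x; first by rewrite subrr green_killing_ge0.
rewrite -(ler_pM2l (deg_gt0 x)) mulrBr surv_nS green_killing_eq mulr1.
have : adj g (fun z => 1 - surv_n n z) x <= adj g green_killing x.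
  apply: le_adj => //; last exact: green_killing_formal.
  apply: (@formal_le _ _ _ _ (fun=> 1)); last exact: formal_cst.
  by move=> z; have /andP[? ?] := surv_n01 n z; rewrite ger0_norm; lra.
by rewrite adj_1B; [rewrite /deg; lra|exact: surv_n_formal].
Qed.

Lemma green_killing_surv x : green_killing x = 1 - surv x.
Proof.
apply/eqP; rewrite eq_le green_killing_le1/=.
have cv : (fun n => 1 - surv_n n x) @ \oo --> 1 - surv x.
  by apply: cvgB; [exact: cvg_cst|exact: surv_cvg].
by apply: (cvgr_to_le cv); apply: nearW => n; exact: surv_n_green_killing.
Qed.

Lemma green_c_eq1 x : green_c g o x = 1%E <-> surv x = 0.
Proof.
rewrite -green_killingE green_killing_surv; split; first by move=> /eqP; rewrite eqe => /eqP; lra.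
by move=> ->; rewrite subr0.
Qed.

End Transient.

(** * Norm estimates and positive parts in [l2] *)

Section SquareSummable.
Context {R : realType} {X : countType}.
Implicit Types (f h u : X -> R).

Lemma l2_lin a f h : l2 f -> l2 h -> l2 (fun x => a * f x + h x).
Proof. exact: (psd_closed l2_psd). Qed.

Lemma l2_zero : l2 (fun _ : X => 0 : R).
Proof. by rewrite /l2 esum1// => x _; rewrite expr0n. Qed.

Lemma l2_scale a f : l2 f -> l2 (fun x => a * f x).
Proof.
move=> fl; rewrite (_ : (fun x => _) = (fun x => a * f x + 0)).
  by apply: l2_lin => //; exact: l2_zero.
by apply/funext => x; rewrite addr0.
Qed.

Lemma l2_sub f h : l2 f -> l2 h -> l2 (fun x => f x - h x).
Proof. exact: (psdB_closed l2_psd). Qed.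

Lemma l2_add f h : l2 f -> l2 h -> l2 (fun x => f x + h x).
Proof.
move=> fl hl; rewrite (_ : (fun x => _) = (fun x => 1 * f x + h x)); first exact: l2_lin.
by apply/funext => x; rewrite mul1r.
Qed.

Lemma l2norm_ge0 f : 0 <= l2norm f.
Proof. exact: sqrtr_ge0. Qed.

Lemma l2normD f h : l2 f -> l2 h -> l2norm (fun x => f x + h x) <= l2norm f + l2norm h.
Proof.
move=> fl hl; rewrite !l2normE//; last exact: l2_add.
exact: (psd_triangle l2_psd).
Qed.

Lemma l2normB f h : l2 f -> l2 h -> l2norm (fun x => f x - h x) <= l2norm f + l2norm h.
Proof.
move=> fl hl; rewrite !l2normE//; last exact: l2_sub.
exact: (psd_triangleB l2_psd).
Qed.

Lemma l2normZ a f : l2 f -> l2norm (fun x => a * f x) = `|a| * l2norm f.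
Proof.
move=> fl; have al := l2_scale a fl.
by rewrite (l2normE al) (l2normE fl) (psd_sqrtZ l2_psd).
Qed.

Lemma l2dot_le f h : l2 f -> l2 h -> `|l2dot f h| <= l2norm f * l2norm h.
Proof. by move=> fl hl; rewrite !l2normE//; exact: (psd_CS l2_psd). Qed.

Lemma l2norm_sqr f : l2 f -> l2norm f ^+ 2 = l2dot f f.
Proof. by move=> fl; rewrite l2normE// sqr_sqrtr// (psd_ge0 l2_psd). Qed.

Lemma l2dot_mono f h : l2 f -> l2 h -> (forall x, `|f x| <= `|h x|) -> l2dot f f <= l2dot h h.
Proof.
move=> fl hl fh; apply: ler_rsum; [exact: l2_summ|exact: l2_summ|].
by move=> x; rewrite -!expr2; exact: sqr_le_norm.
Qed.

Lemma l2norm_mono f h : l2 f -> l2 h -> (forall x, `|f x| <= `|h x|) -> l2norm f <= l2norm h.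
Proof. by move=> fl hl fh; rewrite !l2normE// ler_wsqrtr// l2dot_mono. Qed.

Lemma l2_approx f (e : R) : l2 f -> 0 < e -> exists F : set X, finite_set F /\
  l2norm (fun x => f x - (x \in F)%:R * f x) <= e.
Proof.
move=> fl e0; have e20 : 0 < e ^+ 2 by rewrite exprn_gt0.
have [|F [finF tF]] := nnsum_tail _ fl e20; first by move=> x; exact: sqr_ge0.
exists F; split => //.
have dl : l2 (fun x => f x - (x \in F)%:R * f x).
  apply: (l2_le _ fl) => x; case: (x \in F); rewrite ?mul1r ?subrr ?normr0//.
  by rewrite mul0r subr0.
rewrite l2normE// -(gtr0_norm e0) -sqrtr_sqr ler_wsqrtr//.
rewrite -lee_fin l2dot_nnsum//; apply: le_trans tF; apply: le_nnsum => x.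
by case: (x \in F); rewrite ?mul1r ?subrr ?mul0r ?subr0 ?expr0n ?mul1r.
Qed.

Definition pos_part f x := Num.max (f x) 0.

Lemma pos_part_ge0 f x : 0 <= pos_part f x.
Proof. by rewrite /pos_part le_max lexx orbT. Qed.

Lemma pos_part_ge f x : f x <= pos_part f x.
Proof. by rewrite /pos_part le_max lexx. Qed.

Lemma pos_part_lip f h x : `|pos_part f x - pos_part h x| <= `|f x - h x|.
Proof.
rewrite /pos_part ler_norml; have := ler_norm (f x - h x); have := ler_norm (- (f x - h x)).
rewrite normrN; have := normr_ge0 (f x - h x).
by have [?|?] := leP (f x) 0; have [?|?] := leP (h x) 0; move=> ? ? ?; apply/andP; split; lra.
Qed.

Lemma l2_pos_part f w : l2 f -> (forall x, 0 <= w x) -> l2 (pos_part (fun x => f x - w x)).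
Proof.
move=> fl w0; apply: (l2_le _ fl) => x; rewrite ger0_norm ?pos_part_ge0//.
rewrite /pos_part ge_max normr_ge0 andbT; apply: le_trans (ler_norm _).
by have := w0 x; lra.
Qed.

Lemma l2norm_pos_part f w : l2 f -> (forall x, 0 <= w x) ->
  l2norm (pos_part (fun x => f x - w x)) <= l2norm f.
Proof.
move=> fl w0; apply: l2norm_mono => //; first exact: l2_pos_part.
move=> x; rewrite ger0_norm ?pos_part_ge0//.
rewrite /pos_part ge_max normr_ge0 andbT; apply: le_trans (ler_norm _).
by have := w0 x; lra.
Qed.

End SquareSummable.

Lemma at_right0P {R : realType} (P : R -> Prop) : (\forall t \near 0^'+, P t) ->
  exists2 d : R, 0 < d & forall t, 0 < t -> t < d -> P t.
Proof.
move=> /nbhs_ballP[d /= d0 H]; exists d => // t t0 td; apply: H => //=.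
by rewrite /ball/= sub0r normrN gtr0_norm.
Qed.

(** * The domain of the generator and comparison by truncation *)

Section Semigroup.
Context {R : realType} {X : countType} (g : graph X R) (o : X).
Variable T : R -> (X -> R) -> (X -> R).
Hypothesis conn : connected_graph g.
Hypothesis sg : semigroup_of (opL g o) T.
Implicit Types (f h u phi : X -> R) (x y z : X).

Lemma D0_lin a f h : D0 g o f -> D0 g o h -> D0 g o (fun x => a * f x + h x).
Proof.
move=> /D0P[fe fD] /D0P[he hD]; apply/D0P.
have B := energy_o_psd g o; split; first exact: (psd_closed B).
move=> e e0; have K0 : 0 < 4 * (a ^+ 2 + 1) by rewrite mulr_gt0// ltr_wpDl// sqr_ge0.
have [|p [pf pe]] := fD (e / (4 * (a ^+ 2 + 1))); first by rewrite divr_gt0.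
have [|q [qf qe]] := hD (e / (4 * (a ^+ 2 + 1))); first by rewrite divr_gt0.
exists (fun x => a * p x + q x); split; first exact: finsupp_comb.
set f' := fun x => f x - p x; set h' := fun x => h x - q x.
have fe' : finite_energy g f' := psdB_closed (energy_psd g) fe (finite_energy_finsupp g pf).
have he' : finite_energy g h' := psdB_closed (energy_psd g) he (finite_energy_finsupp g qf).
rewrite (_ : (fun x => _) = (fun x => a * f' x + h' x)); last first.
  by apply/funext => x; rewrite /f' /h'; ring.
(* Positivity at [- a * f' + h'] eliminates the cross term, leaving [2 a^2] and [2] times the two
   errors. *)
rewrite (psd_sqD B)//; have := psd_ge0 B (fun x => - a * f' x + h' x).
rewrite (psd_sqD B)//.
rewrite -/f' ltr_pdivlMr// in pe; rewrite -/h' ltr_pdivlMr// in qe.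
have := psd_ge0 B f'; have := psd_ge0 B h'; have := sqr_ge0 a.
move: (energy_o _ _ f' f') (energy_o _ _ h' h') (energy_o _ _ f' h') pe qe => F H C; nra.
Qed.

Lemma opL_ind y : opL g o (ind R y) (laplacian g (ind R y)).
Proof.
split; [exact/D0_finsupp/finsupp_single|exact/l2_finsupp/finsupp_single|exact: l2_laplacian_ind|].
move=> u uD ul; rewrite (psd_sym (energy_psd g)) energy2_ind; last exact: D0_energy uD.
by rewrite l2dot_laplacian_ind.
Qed.

Lemma opL_lin a f h f' h' : opL g o f f' -> opL g o h h' ->
  opL g o (fun x => a * f x + h x) (fun x => a * f' x + h' x).
Proof.
move=> [fD fl fl' fE] [hD hl hl' hE]; split; [exact: D0_lin|exact: l2_lin|exact: l2_lin|].
move=> u uD ul; have := D0_energy fD; have := D0_energy hD; have ue := D0_energy uD.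
move=> he fe; rewrite (psd_linear (energy_psd g))// fE// hE//.
by rewrite (psd_linear l2_psd).
Qed.

Lemma opL_zero : opL g o (fun=> 0) (fun=> 0).
Proof.
have := opL_lin (-1) (opL_ind o) (opL_ind o).
have E (k : X -> R) : (fun x => -1 * k x + k x) = fun=> 0.
  by apply/funext => x; ring.
by rewrite !E.
Qed.

Lemma opL_finsupp phi : finsupp phi -> opL g o phi (laplacian g phi).
Proof.
move=> phif; suff : formal_dom g phi /\ opL g o phi (laplacian g phi) by case.
move: phi phif; apply: finsupp_ind.
  split; first exact: formal_cst.
  rewrite (_ : laplacian g _ = fun=> 0); first exact: opL_zero.
  apply/funext => x; rewrite laplacianE ?mulr0; last exact: formal_cst.
  by rewrite /adj; under eq_fun do rewrite mulr0; rewrite rsum0 subr0.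
move=> a x f [fd fL]; have xd := finsupp_formal g (finsupp_single x).
split; first exact: formal_domZD.
rewrite (_ : laplacian g _ = fun z => a * laplacian g (ind R x) z + laplacian g f z).
  by apply: opL_lin => //; exact: opL_ind.
by apply/funext => z; exact: laplacianZD.
Qed.

Lemma T_zero t : 0 <= t -> T t (fun=> 0) = fun=> 0.
Proof.
move=> t0; have := sg_linear sg 1 t0 l2_zero l2_zero.
rewrite (_ : (fun=> _) = fun=> 0); last by apply/funext => x; rewrite mulr0 addr0.
move=> /(congr1 (fun k x => k x - T t (fun=> 0) x)) E; apply/funext => x.
by have := congr1 (@^~ x) E => /=; lra.
Qed.

Lemma T_scale t a f : 0 <= t -> l2 f -> T t (fun x => a * f x) = fun x => a * T t f x.
Proof.
move=> t0 fl; have := sg_linear sg a t0 fl l2_zero; rewrite T_zero//.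
rewrite (_ : (fun x => a * f x + 0) = fun x => a * f x); last by apply/funext => x; rewrite addr0.
by move=> ->; apply/funext => x; rewrite addr0.
Qed.

Lemma T_sub t f h : 0 <= t -> l2 f -> l2 h ->
  T t (fun x => f x - h x) = fun x => T t f x - T t h x.
Proof.
move=> t0 fl hl; have := sg_linear sg (-1) t0 hl fl.
rewrite (_ : (fun x => -1 * h x + f x) = fun x => f x - h x); last by apply/funext => x; ring.
by move=> ->; apply/funext => x; ring.
Qed.

Lemma T_comm s t f : 0 <= s -> 0 <= t -> l2 f -> T s (T t f) = T t (T s f).
Proof. by move=> s0 t0 fl; rewrite -!(sg_comp sg)// addrC. Qed.

(** The error of the difference quotient when [h = L f]. It commutes with the semigroup ([T_quot]),
    so by contraction an error bound at [f] holds along the whole orbit. *)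
Definition quot f h t x := t^-1 * (f x - T t f x) - h x.

Lemma l2_quot f h t : 0 <= t -> l2 f -> l2 h -> l2 (quot f h t).
Proof.
move=> t0 fl hl; apply: l2_sub => //; apply: l2_scale; apply: l2_sub => //.
exact: (sg_l2 sg).
Qed.

Lemma T_quot s t f h : 0 <= s -> 0 <= t -> l2 f -> l2 h ->
  T s (quot f h t) = quot (T s f) (T s h) t.
Proof.
move=> s0 t0 fl hl; have Tfl := sg_l2 sg t0 fl.
rewrite [LHS]T_sub//; last by apply: l2_scale; exact: l2_sub.
by rewrite T_scale ?T_sub ?(T_comm s0 t0)//; exact: l2_sub.
Qed.

Lemma quot_le f h (e : R) : opL g o f h -> 0 < e ->
  exists2 d : R, 0 < d & forall t, 0 < t -> t < d -> l2norm (quot f h t) <= e.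
Proof.
move=> fh e0; have [_ fl hl _] := fh.
have /cvgrPdist_le /(_ e e0) H := (sg_generator sg fl hl).1 fh.
apply: at_right0P; apply: filterS H => t /=.
by rewrite sub0r normrN ger0_norm ?l2norm_ge0.
Qed.

Lemma cont_le f (e : R) : l2 f -> 0 < e ->
  exists2 d : R, 0 < d & forall t, 0 <= t -> t < d -> l2norm (fun x => T t f x - f x) <= e.
Proof.
move=> fl e0; have /cvgrPdist_le /(_ e e0) H := sg_continuous sg fl.
have [d d0 Hd] := at_right0P H; exists d => // t; rewrite le_eqVlt => /predU1P[<- _|t0 td].
  rewrite (sg_id sg)// (_ : (fun x => _) = fun x => 0 * f x).
    by rewrite l2normZ// normr0 mul0r ltW.
  by apply/funext => x; ring.
by have := Hd t t0 td; rewrite sub0r normrN ger0_norm ?l2norm_ge0.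
Qed.

Lemma opL_T s f h : 0 <= s -> opL g o f h -> opL g o (T s f) (T s h).
Proof.
move=> s0 fh; have [_ fl hl _] := fh.
apply/(sg_generator sg); [exact: (sg_l2 sg)|exact: (sg_l2 sg)|].
have H := (sg_generator sg fl hl).1 fh.
apply: (squeeze_cvgr _ (cvg_cst 0) H).
near=> t; rewrite l2norm_ge0/=.
have t0 : 0 < t by near: t; exact: nbhs_right_gt.
rewrite -/(quot f h t) -/(quot (T s f) (T s h) t) -(T_quot s0 (ltW t0) fl hl).
by apply: (sg_contraction sg s0); exact: (l2_quot (ltW t0) fl hl).
Unshelve. all: by end_near. Qed.

Lemma pos_finsupp phi w : finsupp phi -> (forall x, 0 <= w x) -> finsupp (pos_part (fun x => phi x - w x)).
Proof.
move=> phif w0; apply: finsupp_sub phif => x phix; rewrite /pos_part phix sub0r.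
by apply/max_idPr; rewrite oppr_le0.
Qed.

(** A Kato inequality: [eta] dominates [phi - w] everywhere and equals it where [eta > 0], so there
    [laplacian eta <= laplacian phi - laplacian w <= laplacian phi - kappa]. Summing against [eta]
    gives the claim. *)
Lemma energy_pos phi w kappa : finsupp phi -> (forall x, 0 <= w x) -> formal_dom g w ->
  (forall x, kappa x <= laplacian g w x) ->
  forall eta, eta = pos_part (fun x => phi x - w x) ->
  energy2 g eta eta + l2dot kappa eta <= energy2 g phi eta.
Proof.
move=> phif w0 wd wk eta etaD; have etaf : finsupp eta by rewrite etaD; exact: pos_finsupp.
rewrite !energy2_finsupp//; [|exact: finite_energy_finsupp|exact: finite_energy_finsupp].
rewrite /l2dot (_ : (fun x => kappa x * eta x) = fun x => eta x * kappa x); last first.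
  by apply/funext => x; rewrite mulrC.
rewrite -rsumD; try exact: summ_finsupp.
apply: ler_rsum; [by apply: summD; exact: summ_finsupp|exact: summ_finsupp|].
move=> x; rewrite -mulrDr; have := pos_part_ge0 (fun x => phi x - w x) x.
rewrite -etaD le_eqVlt => /predU1P[<-|eta0]; first by rewrite !mul0r.
apply: ler_wpM2l; first exact: ltW.
have etaE : eta x = phi x - w x.
  by move: eta0; rewrite etaD /pos_part; have [?|?] := leP (phi x - w x) 0; rewrite ?ltxx.
have ed := finsupp_formal g etaf; have pd := finsupp_formal g phif.
have := wk x; rewrite !laplacianE// etaE.
have : adj g (fun z => -1 * w z + phi z) x <= adj g eta x.
  apply: le_adj => //; first exact: formal_domZD.
  by move=> z; rewrite etaD; apply: le_trans (pos_part_ge (fun z => phi z - w z) z); lra.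
by rewrite adjZD//; lra.
Qed.

(** Formally this is [energy2 u eta >= energy2 eta eta + l2dot kappa eta] with the first term on the
    right dropped. As [w] may have infinite energy, [energy_pos] is applied to finitely supported
    [psi] close to [u], and a strict violation [D < 0] is refuted for [psi] close enough. *)
Lemma laplacian_comparison u h w kappa : opL g o u h -> (forall x, 0 <= w x) -> formal_dom g w ->
  l2 kappa -> (forall x, kappa x <= laplacian g w x) ->
  l2dot kappa (pos_part (fun x => u x - w x)) <= l2dot h (pos_part (fun x => u x - w x)).
Proof.
move=> [uD ul hl uE] w0 wd kl wk; set eta := pos_part _.
have P := @l2_psd R X; have E := energy_psd g.
have etal : l2 eta := l2_pos_part ul w0.
have hkl := l2_sub hl kl.
rewrite -subr_ge0 -(psdBl P)// leNgt; apply/negP.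
set hk := fun x => h x - kappa x; set D := l2dot hk eta => D0.
pose N := l2dot hk hk + 1.
have N0 : 0 < N by rewrite ltr_wpDl ?(psd_ge0 P).
(* The first bound makes the value at [eta'] exceed [D / 4]; the second makes its squared distance
   to [D] at most [D^2 / 8]. These are incompatible. *)
pose e := Num.min (- D / 4) (D ^+ 2 / (8 * N)).
have D2 : 0 < D ^+ 2 by rewrite exprn_even_gt0//= lt_eqF.
have e0 : 0 < e.
  by rewrite lt_min !divr_gt0 ?oppr_gt0// mulr_gt0.
have [psi [psif psiE psil2]] := D0_dense conn uD ul e0.
have psie := finite_energy_finsupp g psif; have psil := l2_finsupp psif.
have ue := D0_energy uD; have upe := psdB_closed E ue psie.
set eta' := pos_part (fun x => psi x - w x).
have etaf' : finsupp eta' := pos_finsupp psif w0.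
have etal' : l2 eta' := l2_finsupp etaf'.
have etae' := finite_energy_finsupp g etaf'.
have K1 : energy2 g eta' eta' + l2dot kappa eta' <= energy2 g psi eta' by exact: (energy_pos _ w0).
have K2 : l2dot h eta' = energy2 g psi eta' + energy2 g (fun x => u x - psi x) eta'.
  by rewrite -uE//; [rewrite (psdBl E)//; ring|exact: D0_finsupp].
have K3 := psd_CS2 E upe etae'.
(* The energy of [eta'] has no a priori bound, but it also occurs with a positive sign and absorbs
   the Cauchy-Schwarz term, at the cost of the energy of [u - psi], which is below [e]. *)
have K4 : - e < l2dot hk eta'.
  rewrite (psdBl P)// K2; have := psd_ge0 E eta'.
  have := psd_ge0 E (fun x => u x - psi x).
  move: K1 K3 psiE; move: (energy2 g (fun x => u x - psi x) eta') (energy2 g eta' eta').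
  move: (energy2 g (fun x => u x - psi x) (fun x => u x - psi x)) => A b' B K1 K3 psiE A0 B0.
  suff : - A <= B + b' by lra.
  rewrite leNgt; apply/negP => lt.
  by move: K3; rewrite expr2; nra.
have dl := l2_sub etal etal'.
have K5 := psd_CS2 P hkl dl.
have K6 : l2dot (fun x => eta x - eta' x) (fun x => eta x - eta' x) < e.
  apply: le_lt_trans psil2; apply: l2dot_mono => //; first exact: l2_sub.
  move=> x; apply: le_trans (pos_part_lip _ _ _) _.
  by rewrite (_ : u x - w x - (psi x - w x) = u x - psi x)//; ring.
have K7 : l2dot hk (fun x => eta x - eta' x) = D - l2dot hk eta' by rewrite (psdBr P).
have e1 : e <= - D / 4 by rewrite ge_min lexx.
have e2 : N * e <= D ^+ 2 / 8.
  rewrite -ler_pdivlMl// (_ : _ * (_ / _) = D ^+ 2 / (8 * N)).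
    by rewrite ge_min lexx orbT.
  by rewrite invfM; ring.
have K8 : (D - l2dot hk eta') ^+ 2 <= N * e.
  rewrite -K7; apply: le_trans K5 _; apply: ler_pM; rewrite ?(psd_ge0 P)// ?ltW//.
  by rewrite ltrDl.
move: K8 K4; move: (l2dot hk eta') => z K8 K4.
have : D - z < D / 2 by lra.
move=> lt; have : D ^+ 2 / 4 < (D - z) ^+ 2 by rewrite !expr2 in K8 *; nra.
by lra.
Qed.

End Semigroup.

(** * Discrete Duhamel comparison and positivity of the semigroup *)

Section Comparison.
Context {R : realType} {X : countType} (g : graph X R) (o : X).
Variable T : R -> (X -> R) -> (X -> R).
Hypothesis conn : connected_graph g.
Hypothesis sg : semigroup_of (opL g o) T.
Implicit Types (u v h phi : X -> R) (x y z : X).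

Section Sequence.
Variables (w f f' kappa kappa' : X -> R).
Hypothesis w0 : forall x, 0 <= w x.
Hypothesis wd : formal_dom g w.
Hypothesis fL : opL g o f f'.
Hypothesis kL : opL g o kappa kappa'.
Hypothesis wk : forall x, kappa x <= laplacian g w x.
Hypothesis fw : forall x, f x <= w x.

(* The Riemann sum of [e^{-nsL} f + int_0^{ns} e^{-rL} kappa dr] in recursive
   form; [duhamel_op] is its image under [L].  The squared l2 norm of
   [(duhamel - w)^+] grows by [o(s)] per step, which replaces the maximum
   principle for the heat equation. *)
Fixpoint duhamel (s : R) n : X -> R :=
  if n is n'.+1 then fun x => s * kappa x + T s (duhamel s n') x else f.

Fixpoint duhamel_op (s : R) n : X -> R :=
  if n is n'.+1 then fun x => s * kappa' x + T s (duhamel_op s n') x else f'.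

Let fl : l2 f. Proof. by case: fL. Qed.
Let fl' : l2 f'. Proof. by case: fL. Qed.
Let kl : l2 kappa. Proof. by case: kL. Qed.
Let kl' : l2 kappa'. Proof. by case: kL. Qed.

Lemma duhamel_opL s n : 0 <= s -> opL g o (duhamel s n) (duhamel_op s n).
Proof.
by move=> s0; elim: n => [//|n IH]; apply: opL_lin => //; exact: (opL_T sg).
Qed.

Lemma duhamel_l2 s n : 0 <= s -> l2 (duhamel s n).
Proof. by move=> /(@duhamel_opL s n)[]. Qed.

Lemma duhamel_op_l2 s n : 0 <= s -> l2 (duhamel_op s n).
Proof. by move=> /(@duhamel_opL s n)[]. Qed.

Lemma duhamel_norm s n : 0 <= s -> l2norm (duhamel s n) <= l2norm f + n%:R * s * l2norm kappa.
Proof.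
move=> s0; elim: n => [|n IH]; first by rewrite mul0r mul0r addr0.
have al := duhamel_l2 n s0; have Tal := sg_l2 sg s0 al.
apply: le_trans (l2normD (l2_scale s kl) Tal) _.
rewrite l2normZ// ger0_norm//; have := sg_contraction sg s0 al.
rewrite -natr1; lra.
Qed.

Lemma duhamel_op_norm s n : 0 <= s -> l2norm (duhamel_op s n) <= l2norm f' + n%:R * s * l2norm kappa'.
Proof.
move=> s0; elim: n => [|n IH]; first by rewrite mul0r mul0r addr0.
have al := duhamel_op_l2 n s0; have Tal := sg_l2 sg s0 al.
apply: le_trans (l2normD (l2_scale s kl') Tal) _.
rewrite l2normZ// ger0_norm//; have := sg_contraction sg s0 al.
rewrite -natr1; lra.
Qed.

Lemma quot_lin s a u h v k : 0 <= s -> l2 u -> l2 h -> l2 v -> l2 k ->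
  quot T (fun x => a * u x + v x) (fun x => a * h x + k x) s =
  fun x => a * quot T u h s x + quot T v k s x.
Proof.
move=> s0 ul hl vl kl2; apply/funext => x; rewrite /quot (sg_linear sg)//; ring.
Qed.

(** Each step passes the old error through the contraction [T s] and adds [s] times the error of
    [kappa]. *)
Lemma quot_duhamel s n (e : R) : 0 <= s ->
  l2norm (quot T f f' s) <= e -> l2norm (quot T kappa kappa' s) <= e ->
  l2norm (quot T (duhamel s n) (duhamel_op s n) s) <= e * (1 + n%:R * s).
Proof.
move=> s0 fe ke; elim: n => [|n IH]; first by rewrite mul0r addr0 mulr1.
have al := duhamel_l2 n s0; have ll := duhamel_op_l2 n s0.
have Tal := sg_l2 sg s0 al; have Tll := sg_l2 sg s0 ll.
have ql := l2_quot sg s0 al ll; have kql := l2_quot sg s0 kl kl'.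
rewrite /= quot_lin// -(T_quot sg)//.
apply: le_trans (l2normD (l2_scale s kql) (sg_l2 sg s0 ql)) _.
rewrite l2normZ// ger0_norm//; have := sg_contraction sg s0 ql.
have := ler_wpM2l s0 ke; rewrite -natr1; lra.
Qed.

Let N s n := l2dot (pos_part (fun x => duhamel s n x - w x)) (pos_part (fun x => duhamel s n x - w x)).

(** Second-order expansion of the squared positive part, whose derivative [2 * max a 0] is
    2-Lipschitz. *)
Lemma pos_sqr_le (a b : R) : (Num.max b 0) ^+ 2 <=
  (Num.max a 0) ^+ 2 + 2 * Num.max a 0 * (b - a) + (b - a) ^+ 2.
Proof.
have := sqr_ge0 (b - a); have := sqr_ge0 b.
by have [?|?] := leP a 0; have [?|?] := leP b 0; rewrite !expr2; nra.
Qed.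

(** The increment is [s * dd], with [dd = kappa - L duhamel] up to the quotient error. In the
    expansion of the squared positive part, [laplacian_comparison] makes the main first-order term
    nonpositive; there remain the error [A * q] and the second-order term. *)
Lemma duhamel_step s n (A L q : R) : 0 < s ->
  l2norm (duhamel s n) <= A -> l2norm kappa + l2norm (duhamel_op s n) <= L ->
  l2norm (quot T (duhamel s n) (duhamel_op s n) s) <= q ->
  N s n.+1 <= N s n + s * (2 * A * q + s * (L + q) ^+ 2).
Proof.
move=> s0 aA lL qq; have s0' := ltW s0.
have al := duhamel_l2 n s0'; have ll := duhamel_op_l2 n s0'; have al1 := duhamel_l2 n.+1 s0'.
have ql := l2_quot sg s0' al ll; have P := @l2_psd R X.
have Tal := sg_l2 sg s0' al.
set eta := pos_part (fun x => duhamel s n x - w x).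
have etal : l2 eta := l2_pos_part al w0.
have eta1l := l2_pos_part al1 w0.
pose k := fun x => kappa x - duhamel_op s n x.
have kl2 : l2 k := l2_sub kl ll.
pose dd := fun x => k x - quot T (duhamel s n) (duhamel_op s n) s x.
have ddl : l2 dd := l2_sub kl2 ql.
have step x : duhamel s n.+1 x - duhamel s n x = s * dd x.
  by rewrite /dd /k /quot /=; field; rewrite gt_eqF.
have NS : N s n.+1 <= N s n + 2 * s * l2dot eta dd + s ^+ 2 * l2dot dd dd.
  rewrite /N -/eta /l2dot.
  have s1 := l2_summ etal etal; have s2 := l2_summ etal ddl; have s3 := l2_summ ddl ddl.
  rewrite -(rsumZ _ s2) -(rsumZ _ s3) -(rsumD s1 (summZ _ s2)).
  rewrite -(rsumD (summD s1 (summZ _ s2)) (summZ _ s3)).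
  apply: ler_rsum; [exact: l2_summ|exact: (summD (summD s1 (summZ _ s2)) (summZ _ s3))|].
  move=> x; rewrite -!expr2.
  have := pos_sqr_le (duhamel s n x - w x) (duhamel s n.+1 x - w x).
  rewrite (_ : duhamel s n.+1 x - w x - (duhamel s n x - w x) = s * dd x); last by rewrite -step; ring.
  rewrite -/(pos_part (fun x => duhamel s n x - w x) x) -/eta => h; apply: le_trans h _.
  by rewrite exprMn; lra.
have D1 : l2dot eta dd <= A * q.
  rewrite (psdBr P)//.
  have : l2dot eta k <= 0.
    rewrite (psdBr P)// (psd_sym P eta) (psd_sym P eta) subr_le0.
    exact: (laplacian_comparison conn (duhamel_opL n s0')).
  have := l2dot_le etal ql; have := ler_norm (- l2dot eta (quot T (duhamel s n) (duhamel_op s n) s)).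
  rewrite normrN.
  have : l2norm eta * l2norm (quot T (duhamel s n) (duhamel_op s n) s) <= A * q.
    apply: ler_pM; rewrite ?l2norm_ge0//.
    by apply: le_trans aA; exact: l2norm_pos_part.
  lra.
have D2 : l2dot dd dd <= (L + q) ^+ 2.
  rewrite -l2norm_sqr// lerXn2r// ?nnegrE ?l2norm_ge0//.
    by rewrite addr_ge0//; [apply: le_trans lL; rewrite addr_ge0 ?l2norm_ge0|apply: le_trans qq; exact: l2norm_ge0].
  apply: le_trans (l2normB kl2 ql) _; apply: lerD => //.
  by apply: le_trans lL; exact: l2normB.
have s20 : 0 <= s ^+ 2 by exact: sqr_ge0.
have := ler_wpM2l s0' D1; have := ler_wpM2l s20 D2.
by rewrite expr2; lra.
Qed.

Lemma excess0 s : N s 0 = 0.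
Proof.
rewrite /N /=; have -> : pos_part (fun x => f x - w x) = fun=> 0.
  by apply/funext => x; rewrite /pos_part; apply/max_idPr; rewrite subr_le0.
by rewrite /l2dot; under eq_fun do rewrite mulr0; exact: rsum0.
Qed.

Lemma duhamel_bound s n (t e : R) : 0 < s -> n%:R * s <= t -> 0 <= e ->
  l2norm (quot T f f' s) <= e -> l2norm (quot T kappa kappa' s) <= e ->
  N s n <= n%:R * s * (2 * (l2norm f + t * l2norm kappa) * (e * (1 + t)) +
    s * (l2norm kappa + l2norm f' + t * l2norm kappa' + e * (1 + t)) ^+ 2).
Proof.
move=> s0 + e0 fe ke; elim: n => [|n IH] nst; first by rewrite excess0 !mul0r.
have nst' : n%:R * s <= t by apply: le_trans nst; rewrite ler_wpM2r ?ler_nat// ltW.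
have := IH nst'; set Q := (X in _ <= _ * X).
have h1 : l2norm (duhamel s n) <= l2norm f + t * l2norm kappa.
  apply: le_trans (duhamel_norm n (ltW s0)) _.
  by rewrite lerD2l ler_wpM2r// l2norm_ge0.
have h2 : l2norm kappa + l2norm (duhamel_op s n) <= l2norm kappa + l2norm f' + t * l2norm kappa'.
  rewrite -addrA lerD2l; apply: le_trans (duhamel_op_norm n (ltW s0)) _.
  by rewrite lerD2l ler_wpM2r// l2norm_ge0.
have h3 : l2norm (quot T (duhamel s n) (duhamel_op s n) s) <= e * (1 + t).
  apply: le_trans (quot_duhamel n (ltW s0) fe ke) _.
  by rewrite ler_wpM2l// lerD2l.
have := duhamel_step s0 h1 h2 h3; rewrite -/Q -natr1; lra.
Qed.

Lemma duhamel_le t (e : R) : 0 <= t -> 0 < e -> exists2 d : R, 0 < d &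
  forall s n, 0 < s -> s < d -> n%:R * s <= t -> forall x, duhamel s n x <= w x + e.
Proof.
move=> t0 e0.
pose A := l2norm f + t * l2norm kappa.
have A0 : 0 <= A by rewrite addr_ge0 ?mulr_ge0 ?l2norm_ge0.
pose L := l2norm kappa + l2norm f' + t * l2norm kappa' + (1 + t).
have L0 : 0 <= L by rewrite !addr_ge0 ?mulr_ge0 ?l2norm_ge0.
pose K1 := 2 * t * A * (1 + t) + 1.
have K10 : 0 < K1 by rewrite ltr_wpDl// !mulr_ge0// addr_ge0.
pose K2 := t * L ^+ 2 + 1.
have K20 : 0 < K2 by rewrite ltr_wpDl// !mulr_ge0// sqr_ge0.
(* In [duhamel_bound] the quotient error enters with weight at most [K1] and the step with weight at
   most [K2]; each is allotted [e^2 / 2]. The cap at 1 lets the term [1 + t] of [L] absorb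
   [e1 * (1 + t)]. *)
pose e1 := Num.min 1 (e ^+ 2 / 2 / K1).
have ee0 : 0 < e ^+ 2 by rewrite exprn_gt0.
have e10 : 0 < e1 by rewrite lt_min ltr01/= !divr_gt0.
have [d1 d10 H1] := quot_le sg fL e10.
have [d2 d20 H2] := quot_le sg kL e10.
pose d := Num.min d1 (Num.min d2 (e ^+ 2 / 2 / K2)).
exists d; first by rewrite !lt_min d10 d20 !divr_gt0.
move=> s n s0; rewrite !lt_min => /and3P[sd1 sd2 sd3] nst x.
have B := duhamel_bound s0 nst (ltW e10) (H1 s s0 sd1) (H2 s s0 sd2).
have e11 : e1 <= 1 by rewrite ge_min lexx.
have e12 : K1 * e1 <= e ^+ 2 / 2.
  by rewrite -ler_pdivlMl// mulrC ge_min lexx orbT.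
have e13 : K2 * s <= e ^+ 2 / 2.
  by rewrite -ler_pdivlMl// mulrC ltW.
have NB : N s n <= e ^+ 2.
  apply: le_trans B _; rewrite -/A.
  set Z := _ + s * _.
  have L1 : 0 <= l2norm kappa + l2norm f' + t * l2norm kappa' + e1 * (1 + t) <= L.
    rewrite !addr_ge0 ?mulr_ge0 ?l2norm_ge0 ?(ltW e10) ?addr_ge0//= /L lerD2l.
    by rewrite ler_piMl// addr_ge0.
  have Z1 : Z <= 2 * A * (1 + t) * e1 + s * L ^+ 2.
    rewrite /Z; apply: lerD; first by rewrite le_eqVlt; apply/orP; left; apply/eqP; ring.
    rewrite ler_wpM2l ?(ltW s0)//; case/andP: L1 => L1 L2.
    by rewrite lerXn2r.
  have Z0 : 0 <= Z.
    rewrite /Z; apply: addr_ge0; apply: mulr_ge0; rewrite ?sqr_ge0 ?(ltW s0)//.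
      exact: mulr_ge0.
    by apply: mulr_ge0; [exact: ltW|exact: addr_ge0].
  apply: (@le_trans _ _ (t * Z)); first by rewrite ler_wpM2r.
  have := ler_wpM2l t0 Z1; rewrite /K1 /K2 in e12 e13.
  have := ltW e10; have := ltW s0; lra.
have al := duhamel_l2 n (ltW s0); have pl := l2_pos_part al w0.
have : pos_part (fun x => duhamel s n x - w x) x <= e.
  apply: le_trans (le_trans (ler_norm _) (l2_pointwise x pl)) _.
  rewrite -(@ler_pXn2r _ 2)// ?nnegrE ?l2norm_ge0 ?(ltW e0)//.
  by rewrite l2norm_sqr.
by have := pos_part_ge (fun x => duhamel s n x - w x) x; lra.
Qed.

End Sequence.

Lemma nat_step (t d : R) : 0 <= t -> 0 < d -> exists n : nat, exists2 s : R, 0 < s < d & n%:R * s = t.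
Proof.
rewrite le_eqVlt => /predU1P[<-|t0] d0.
  by exists 0%N, (d / 2); rewrite ?mul0r//; apply/andP; split; lra.
exists (Num.truncn (t / d)).+1; have n0 : 0 < (Num.truncn (t / d)).+1%:R :> R by rewrite ltr0n.
exists (t / (Num.truncn (t / d)).+1%:R); last by rewrite mulrC divfK ?gt_eqF.
rewrite divr_gt0//= ltr_pdivrMr// mulrC -ltr_pdivrMr//.
exact: truncnS_gt.
Qed.

Lemma duhamel_heat f s n : 0 <= s -> l2 f -> duhamel f (fun=> 0) s n = T (n%:R * s) f.
Proof.
move=> s0 fl; elim: n => [|n IH] /=; first by rewrite mul0r (sg_id sg).
rewrite IH; apply/funext => x; rewrite mulr0 add0r.
rewrite -(sg_comp sg)//; last by rewrite mulr_ge0.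
by congr (T _ f x); rewrite -natr1; ring.
Qed.

Lemma heat_le t phi w x : 0 <= t -> finsupp phi -> (forall x, 0 <= w x) -> formal_dom g w ->
  (forall x, 0 <= laplacian g w x) -> (forall x, phi x <= w x) -> T t phi x <= w x.
Proof.
move=> t0 phif w0 wd wL pw; apply/ler_addgt0Pr => e e0.
have [d d0 H] := duhamel_le w0 wd (opL_finsupp g o phif) (opL_zero g o) wL pw t0 e0.
have [n [s /andP[s0 sd] nst]] := nat_step t0 d0.
have := H s n s0 sd; rewrite nst lexx => /(_ isT x).
by rewrite duhamel_heat ?nst ?(ltW s0)//; exact: l2_finsupp.
Qed.

(** The comparison of [- phi] with [w = 0]. *)
Lemma heat_ge0_finsupp t phi x : 0 <= t -> finsupp phi -> (forall x, 0 <= phi x) -> 0 <= T t phi x.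
Proof.
move=> t0 phif p0.
have : T t (fun z => -1 * phi z) x <= 0.
  have zd : formal_dom g (fun=> 0) by exact: formal_cst.
  apply: (@heat_le _ _ (fun=> 0)) => //.
  - by apply: finsupp_sub phif => z ->; rewrite mulr0.
  - by move=> z; rewrite laplacianE// mulr0 /adj; under eq_fun do rewrite mulr0; rewrite rsum0 subr0.
  - by move=> z; rewrite mulN1r oppr_le0.
by rewrite (T_scale sg)//; [rewrite mulN1r oppr_le0|exact: l2_finsupp].
Qed.

Lemma finsupp_restrict (F : set X) (f : X -> R) : finite_set F -> finsupp (fun x => (x \in F)%:R * f x).
Proof.
apply: sub_finite_set => x /=; case: (boolP (x \in F)) => [|_]; first by rewrite inE.
by rewrite mul0r eqxx.
Qed.

Lemma heat_ge0 t f x : 0 <= t -> l2 f -> (forall x, 0 <= f x) -> 0 <= T t f x.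
Proof.
move=> t0 fl f0; apply/ler_addgt0Pr => e e0.
have [F [finF ltF]] := l2_approx fl e0.
have Ff := finsupp_restrict f finF.
have h1 : 0 <= T t (fun x => (x \in F)%:R * f x) x.
  by apply: heat_ge0_finsupp => // z; rewrite mulr_ge0.
have dl := l2_sub fl (l2_finsupp Ff).
have := l2_pointwise x (sg_l2 sg t0 dl); have := sg_contraction sg t0 dl.
rewrite (T_sub sg)//; last exact: l2_finsupp.
rewrite ler_norml => h2 /andP[h3 _]; lra.
Qed.

Lemma heat_mono t f h x : 0 <= t -> l2 f -> l2 h -> (forall x, f x <= h x) ->
  T t f x <= T t h x.
Proof.
move=> t0 fl hl fh; rewrite -subr_ge0.
have : 0 <= T t (fun x => h x - f x) x.
  by apply: heat_ge0 => //; [exact: l2_sub|move=> z; rewrite subr_ge0].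
by rewrite (T_sub sg).
Qed.

(** Unrolling the recursion exhibits a left-endpoint Riemann sum, which [green_upto_riemann]
    compares with the time integral. *)
Lemma duhamel_sum f kappa s n x : 0 <= s -> l2 f -> l2 kappa ->
  duhamel f kappa s n x = T (n%:R * s) f x + \sum_(k < n) s * T (k%:R * s) kappa x.
Proof.
move=> s0 fl kl; elim: n x => [|n IH] x.
  by rewrite big_ord0 mul0r addr0 (sg_id sg).
have suml m : l2 (fun z => \sum_(k < m) s * T (k%:R * s) kappa z) /\
    T s (fun z => \sum_(k < m) s * T (k%:R * s) kappa z) =
    fun z => \sum_(k < m) s * T (k.+1%:R * s) kappa z.
  elim: m => [|m [IH1 IH2]].
    have E (F : 'I_0 -> X -> R) : (fun z => \sum_(k < 0) F k z) = fun=> 0.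
      by apply/funext => z; rewrite big_ord0.
    by rewrite !E; split; [exact: l2_zero|exact: (T_zero sg)].
  have ms0 : 0 <= m%:R * s by rewrite mulr_ge0.
  have Tl := sg_l2 sg ms0 kl.
  rewrite (_ : (fun z => \sum_(k < m.+1) s * T (k%:R * s) kappa z) =
     fun z => s * T (m%:R * s) kappa z + \sum_(k < m) s * T (k%:R * s) kappa z); last first.
    by apply/funext => z; rewrite big_ord_recr addrC.
  split; first exact: l2_lin.
  rewrite (sg_linear sg)// IH2; apply/funext => z.
  rewrite [RHS]big_ord_recr addrC; congr (_ + s * _).
  rewrite -(sg_comp sg)//; congr (T _ kappa z); rewrite -natr1; ring.
rewrite /= (_ : duhamel f kappa s n = fun z => 1 * T (n%:R * s) f z + \sum_(k < n) s * T (k%:R * s) kappa z); last first.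
  by apply/funext => z; rewrite IH mul1r.
have [s1 s2] := suml n; have ns0 : 0 <= n%:R * s by rewrite mulr_ge0.
rewrite (sg_linear sg)//; last exact: (sg_l2 sg).
rewrite s2 mul1r big_ord_recl mul0r (sg_id sg)// -(sg_comp sg)//.
rewrite (_ : s + n%:R * s = n.+1%:R * s); last by rewrite -natr1; ring.
by rewrite addrCA.
Qed.

End Comparison.

(** * Riemann sums, and integrals of sums over a countable type *)

Section Riemann.
Context {R : realType}.
Local Notation mu := lebesgue_measure.

(** Two inequalities with explicit error are stated instead of a limit, because the step [s] must at
    the same time be small enough for [duhamel_le] or [quot_le]. *)
Lemma riemann_bounds (q : R -> R) (s om : R) n :
  (forall r, 0 <= q r) -> measurable_fun [set: R] q -> 0 < s -> 0 <= om ->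
  (forall k r, k%:R * s <= r -> r <= k.+1%:R * s -> `|q r - q (k%:R * s)| <= om) ->
  (\int[mu]_(r in `[0%R, (n%:R * s)%R]) (q r)%:E <=
     (\sum_(k < n) s * q (k%:R * s) + n%:R * s * om)%:E)%E /\
  ((\sum_(k < n) s * q (k%:R * s))%:E <=
     \int[mu]_(r in `[0%R, (n%:R * s)%R]) (q r)%:E + (n%:R * s * om)%:E)%E.
Proof.
move=> q0 mq s0 om0 H; have mqE (D : set R) : measurable D -> measurable_fun D (EFin \o q).
  by move=> mD; apply/measurable_EFinP; exact: measurable_funTS.
elim: n => [|n [IH1 IH2]].
  by rewrite !mul0r set_itv1 integral_set1 big_ord0 addr0; split; rewrite ?add0e.
have nn1 : n%:R * s <= n.+1%:R * s by rewrite ler_wpM2r ?ler_nat// ltW.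
have split_int : (\int[mu]_(r in `[0%R, (n.+1%:R * s)%R]) (q r)%:E =
    \int[mu]_(r in `[0%R, (n%:R * s)%R]) (q r)%:E +
    \int[mu]_(r in `](n%:R * s)%R, (n.+1%:R * s)%R]) (q r)%:E)%E.
  rewrite -ge0_integral_setU//=.
  - by rewrite -itv_bndbnd_setU// bnd_simp ?mulr_ge0// ltW.
  - by apply: mqE; exact: measurableU.
  - by move=> x _; rewrite lee_fin.
  - apply/disj_set2P/seteqP; split => // x /=.
    by rewrite !in_itv/= => -[/andP[_ h1] /andP[h2 _]]; have := lt_le_trans h2 h1; rewrite ltxx.
have mitv : mu `](n%:R * s)%R, (n.+1%:R * s)%R] = s%:E.
  rewrite lebesgue_measure_itv/= lte_fin ltr_pM2r// ltr_nat ltnSn -EFinB.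
  by congr (_%:E); rewrite -natr1; ring.
have cst_int (a : R) : (\int[mu]_(r in `](n%:R * s)%R, (n.+1%:R * s)%R]) a%:E = (a * s)%:E)%E.
  by rewrite integral_cst//= mitv.
have J1 : (\int[mu]_(r in `](n%:R * s)%R, (n.+1%:R * s)%R]) (q r)%:E <= ((q (n%:R * s) + om) * s)%:E)%E.
  rewrite -cst_int; apply: ge0_le_integral => //=.
  - by move=> x _; rewrite lee_fin.
  - exact: mqE.
  - by move=> x; rewrite in_itv/= => /andP[h1 h2]; rewrite lee_fin;
      have := H n x (ltW h1) h2; rewrite ler_norml; lra.
have J2 : ((q (n%:R * s) * s)%:E <= \int[mu]_(r in `](n%:R * s)%R, (n.+1%:R * s)%R]) (q r)%:E + (om * s)%:E)%E.
  rewrite -!cst_int -ge0_integralD//=; last 2 first.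
  - by move=> x _; rewrite lee_fin.
  - exact: mqE.
  apply: ge0_le_integral => //=.
  - by move=> x _; rewrite lee_fin.
  - by apply: emeasurable_funD; [exact: mqE|exact: measurable_cst].
  - by move=> x; rewrite in_itv/= => /andP[h1 h2]; rewrite lee_fin;
      have := H n x (ltW h1) h2; rewrite ler_norml; lra.
rewrite split_int big_ord_recr/=; split.
  apply: le_trans (leeD IH1 J1) _; rewrite -EFinD lee_fin -natr1; lra.
rewrite EFinD; apply: le_trans (leeD IH2 _) _; first by rewrite mulrC; exact: J2.
rewrite (_ : (n.+1%:R * s * om)%:E = ((n%:R * s * om)%:E + (om * s)%:E)%E).
  by rewrite addeACA.
by rewrite -EFinD; congr (_%:E); rewrite -natr1; ring.
Qed.

(** Enumerating [X] by its codes turns the sum into a series, which can be integrated term by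
    term. *)
Lemma esum_count {X : countType} (F : X -> \bar R) : (forall x, 0 <= F x)%E ->
  (\esum_(x in [set: X]) F x = \sum_(n <oo) oapp F 0 (@pickle_inv X n))%E.
Proof.
move=> F0; rewrite nneseries_esumT; last by move=> n; case: pickle_inv => /=.
transitivity (\esum_(n in pickle @` [set: X]) oapp F 0 (@pickle_inv X n))%E.
  rewrite esum_image; first by apply: eq_esum => x _; rewrite pickleK_inv.
  by move=> x y _ _; exact: (pcan_inj pickleK).
rewrite esum_mkcond; apply: eq_esum => n _; case: ifPn => //; rewrite notin_setE => nn.
case E : (@pickle_inv X n) => [x|]//=; exfalso; apply: nn; exists x => //.
by have := @pickle_invK X n; rewrite E.
Qed.

Lemma integral_esum d (T : measurableType d) (m : {measure set T -> \bar R})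
    (D : set T) {X : countType} (F : X -> T -> \bar R) : measurable D ->
  (forall x t, D t -> 0 <= F x t)%E -> (forall x, measurable_fun D (F x)) ->
  (\int[m]_(t in D) (\esum_(x in [set: X]) F x t) =
   \esum_(x in [set: X]) (\int[m]_(t in D) F x t))%E.
Proof.
move=> mD F0 mF; rewrite esum_count; last by move=> x; apply: integral_ge0 => t; exact: F0.
transitivity (\int[m]_(t in D) (\sum_(n <oo) oapp (F^~ t) 0 (@pickle_inv X n)))%E.
  by apply: eq_integral => t; rewrite inE => Dt; rewrite esum_count// => x; exact: F0.
rewrite integral_nneseries//.
- apply: eq_eseriesr => n _; case: pickle_inv => //=.
  by rewrite integral0.
- by move=> n; case: pickle_inv => [x|]//=; exact: mF.
- by move=> n t Dt; case: pickle_inv => [x|]//=; exact: F0.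
Qed.

End Riemann.

(** * The heat kernel and its time integral *)

Section HeatKernel.
Context {R : realType} {X : countType} (g : graph X R) (o : X).
Variable T : R -> (X -> R) -> (X -> R).
Hypothesis conn : connected_graph g.
Hypothesis trans : transient g o.
Hypothesis sg : semigroup_of (opL g o) T.
Implicit Types (u v h phi : X -> R) (x y z : X).
Local Notation mu := lebesgue_measure.

(* The absolute value extends the kernel to negative times, where [T] is
   unspecified, so that it is measurable on the whole line. *)
Definition heat_kernel (s : R) x y := T `|s| (ind R y) x.

Let il y : l2 (ind R y) := l2_finsupp (finsupp_single y).

Lemma ind_ge0 y x : 0 <= ind R y x. Proof. by rewrite ler0n. Qed.

Lemma heat_kernel_ge0 s x y : 0 <= heat_kernel s x y.
Proof. by apply: (heat_ge0 conn sg) => //; exact: ind_ge0. Qed.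

Lemma l2dot_ind f x : l2dot f (ind R x) = f x.
Proof. by rewrite -[RHS](rsum_ind x f); congr rsum; apply/funext => z; rewrite mulrC. Qed.

Lemma heat_kernel_sym s x y : heat_kernel s x y = heat_kernel s y x.
Proof.
rewrite /heat_kernel -(l2dot_ind (T _ _) x) (sg_symmetric sg)// (psd_sym l2_psd).
by rewrite l2dot_ind.
Qed.

Lemma heat_kernel_l2 s x : l2 (heat_kernel s x).
Proof.
rewrite (_ : heat_kernel s x = T `|s| (ind R x)); first exact: (sg_l2 sg).
by apply/funext => z; rewrite heat_kernel_sym.
Qed.

Lemma heatE t f x : 0 <= t -> l2 f -> T t f x = rsum (fun z => heat_kernel t x z * f z).
Proof.
move=> t0 fl; rewrite -(l2dot_ind (T t f) x) (sg_symmetric sg)// (psd_sym l2_psd).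
by congr rsum; apply/funext => z; rewrite heat_kernel_sym /heat_kernel ger0_norm.
Qed.

Lemma chapman_kolmogorov s t x y : 0 <= s -> 0 <= t -> heat_kernel (s + t) x y = rsum (fun z => heat_kernel s x z * heat_kernel t z y).
Proof.
move=> s0 t0; rewrite /heat_kernel ger0_norm ?addr_ge0// (sg_comp sg)// heatE//; last exact: (sg_l2 sg).
by congr rsum; apply/funext => z; rewrite /heat_kernel (ger0_norm s0) (ger0_norm t0).
Qed.

(** For [|r| <= |s|] the difference is [T |r|] applied to [T (|s| - |r|) 1_y - 1_y], so contraction
    reduces the claim to continuity at time 0, uniformly in [x]. *)
Lemma heat_kernel_cont y (e : R) : 0 < e -> exists2 d : R, 0 < d &
  forall s r x, `|s - r| < d -> `|heat_kernel s x y - heat_kernel r x y| <= e.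
Proof.
move=> e0; have [d d0 H] := cont_le sg (il y) e0; exists d => // s r x.
wlog sr : s r / `|r| <= `|s| => [hw|].
  have [h1|/ltW h1] := leP `|s| `|r|; last exact: hw.
  by move=> h2; rewrite distrC; apply: hw => //; rewrite distrC.
move=> srd; pose h := `|s| - `|r|.
have h0 : 0 <= h by rewrite subr_ge0.
have hd : h < d.
  by apply: le_lt_trans srd; apply: le_trans (ler_norm _) (ler_dist_dist _ _).
have Hl := H h h0 hd.
have Thl := sg_l2 sg h0 (il y).
have dl := l2_sub Thl (il y).
rewrite (_ : heat_kernel s x y = T `|r| (T h (ind R y)) x); last first.
  by rewrite -(sg_comp sg)// /h addrC subrK.
have := l2_pointwise x (sg_l2 sg (normr_ge0 r) dl).
rewrite (T_sub sg)// => /le_trans; apply.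
rewrite -(T_sub sg)//; apply: le_trans Hl; exact: (sg_contraction sg).
Qed.

Lemma heat_kernel_measurable x y (D : set R) : measurable D -> measurable_fun D (fun s => heat_kernel s x y).
Proof.
move=> mD; apply: measurable_funTS; apply: continuous_measurable_fun => s.
apply/cvgrPdist_le => e e0; have [d d0 H] := heat_kernel_cont y e0.
apply: filterS (nbhsx_ballx s d d0) => r /=; exact: H.
Qed.

Definition green_upto t x y : \bar R := (\int[mu]_(s in `[0%R, t]) (heat_kernel s x y)%:E)%E.

Lemma green_upto_ge0 t x y : (0 <= green_upto t x y)%E.
Proof. by apply: integral_ge0 => s _; rewrite lee_fin heat_kernel_ge0. Qed.

Lemma green_upto_riemann t x y (e d : R) : 0 <= t -> 0 < e -> 0 < d ->
  exists n s, [/\ 0 < s, s < d, n%:R * s = t,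
    (green_upto t x y <= (\sum_(k < n) s * T (k%:R * s) (ind R y) x + t * e)%:E)%E &
    ((\sum_(k < n) s * T (k%:R * s) (ind R y) x)%:E <= green_upto t x y + (t * e)%:E)%E].
Proof.
move=> t0 e0 d0; have [d' d'0 H] := heat_kernel_cont y e0.
have [|n [s /andP[s0]]] := @nat_step _ t (Num.min d d') t0; first by rewrite lt_min d0.
rewrite lt_min => /andP[sd sd'] nst; exists n, s.
have [|||||B1 B2] := @riemann_bounds _ (fun s => heat_kernel s x y) s e n.
- by move=> r; exact: heat_kernel_ge0.
- exact: heat_kernel_measurable.
- exact: s0.
- exact: ltW.
- move=> k r h1 h2; apply: H; rewrite ger0_norm ?subr_ge0//.
  by apply: le_lt_trans sd'; move: h2; rewrite -natr1; lra.
rewrite nst in B1 B2.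
have E : \sum_(k < n) s * heat_kernel (k%:R * s) x y = \sum_(k < n) s * T (k%:R * s) (ind R y) x.
  by apply: eq_bigr => k _; rewrite /heat_kernel ger0_norm// mulr_ge0// ltW.
by rewrite E in B1 B2; split.
Qed.

Lemma laplacian_green y x : laplacian g (fun z => green g o z y) x = ind R y x.
Proof. by have [_ _ /(congr1 (@^~ x))] := is_green_green trans y. Qed.

(** [duhamel_le] with the Green function as [w] and [1_y] as [kappa]; the Riemann sums converge to
    the left side. *)
Lemma heat_green_upto_le_green t phi x y : 0 <= t -> finsupp phi ->
  (forall z, phi z <= green g o z y) ->
  ((T t phi x)%:E + green_upto t x y <= (green g o x y)%:E)%E.
Proof.
move=> t0 phif pg; apply/lee_addgt0Pr => e e0.
have e20 : 0 < e / 2 by rewrite divr_gt0.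
have t10 : 0 < t + 1 by lra.
(* Dividing by [t + 1] keeps the total error [t * (e / 2 / (t + 1))] below [e / 2], including at
   [t = 0]. *)
have ee0 : 0 < e / 2 / (t + 1) by rewrite divr_gt0.
have [d d0 H] := duhamel_le conn sg (fun z => green_ge0 conn trans z y) (green_formal trans y)
  (opL_finsupp g o phif) (opL_ind g o y) (fun x => eq_ind_r (fun a => ind R y x <= a) (lexx _) (laplacian_green y x)) pg t0 e20.
have [n [s [s0 sd nst B1 _]]] := green_upto_riemann x y t0 ee0 d0.
have := H s n s0 sd; rewrite nst lexx => /(_ isT x).
rewrite (duhamel_sum sg)//; [|exact: ltW|exact: l2_finsupp].
rewrite nst => h; apply: le_trans (leeD2l _ B1) _.
rewrite -!EFinD lee_fin; have : t * (e / 2 / (t + 1)) <= e / 2.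
  by rewrite mulrA ler_pdivrMr// mulrC ler_wpM2l ?(ltW e20)//; lra.
lra.
Qed.

Lemma green_upto_le_green t x y : 0 <= t -> (green_upto t x y <= (green g o x y)%:E)%E.
Proof.
move=> t0; apply: le_trans (@heat_green_upto_le_green t (fun=> 0) x y t0 _ _).
- by rewrite (T_zero sg)// add0e.
- by apply: finsupp_sub (finsupp_single o).
- by move=> z; exact: (green_ge0 conn trans).
Qed.

Lemma green_upto_fin t x y : 0 <= t -> green_upto t x y \is a fin_num.
Proof. by move=> t0; rewrite ge0_fin_numE ?green_upto_ge0// (le_lt_trans (green_upto_le_green _ _ t0)) ?ltry. Qed.

(** [phi - T t phi] telescopes into steps [s * T (m s) (laplacian phi)] up to quotient errors. By
    positivity each main term is at most [s * T (m s) 1_y], which gives a Riemann sum of the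
    kernel. *)
Lemma green_upto_ge t phi x y : 0 <= t -> finsupp phi -> (forall z, laplacian g phi z <= ind R y z) ->
  ((phi x)%:E <= (T t phi x)%:E + green_upto t x y)%E.
Proof.
move=> t0 phif pl; apply/lee_addgt0Pr => e e0.
have t10 : 0 < t + 1 by lra.
have ee0 : 0 < e / 2 / (t + 1) by rewrite !divr_gt0.
have pL := opL_finsupp g o phif; have pl2 := l2_finsupp phif.
have Ll2 : l2 (laplacian g phi) by case: pL.
have [d d0 H] := quot_le sg pL ee0.
have [n [s [s0 sd nst _ B2]]] := green_upto_riemann x y t0 ee0 d0.
have Hq := H s s0 sd; have s0' := ltW s0.
have ql := l2_quot sg s0' pl2 Ll2.
have key : phi x - T (n%:R * s) phi x <=
    \sum_(k < n) s * T (k%:R * s) (ind R y) x + n%:R * s * (e / 2 / (t + 1)).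
  elim: (n) => [|m IH]; first by rewrite big_ord0 !mul0r (sg_id sg)// subrr addr0.
  have ms0 : 0 <= m%:R * s by rewrite mulr_ge0.
  rewrite big_ord_recr/=.
  have E : T (m%:R * s) phi x - T (m.+1%:R * s) phi x =
      s * (T (m%:R * s) (quot T phi (laplacian g phi) s) x + T (m%:R * s) (laplacian g phi) x).
    rewrite (T_quot sg)// /quot addrNK mulVKf ?gt_eqF// -(sg_comp sg)//.
    by rewrite (_ : s + m%:R * s = m.+1%:R * s)//; rewrite -natr1; ring.
  have h1 : T (m%:R * s) (laplacian g phi) x <= T (m%:R * s) (ind R y) x.
    exact: (heat_mono conn sg).
  have h2 : T (m%:R * s) (quot T phi (laplacian g phi) s) x <= e / 2 / (t + 1).
    apply: le_trans (le_trans (ler_norm _) (l2_pointwise x (sg_l2 sg ms0 ql))) _.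
    by apply: le_trans Hq; exact: (sg_contraction sg).
  have := ler_wpM2l s0' (lerD h2 h1).
  have -> : m.+1%:R * s * (e / 2 / (t + 1)) = m%:R * s * (e / 2 / (t + 1)) + s * (e / 2 / (t + 1)).
    by rewrite -natr1 !mulrDl mul1r.
  lra.
have tt : t * (e / 2 / (t + 1)) <= e / 2.
  by rewrite mulrA ler_pdivrMr// mulrC ler_wpM2l//; [rewrite divr_ge0// ltW|lra].
move: B2; rewrite -(fineK (green_upto_fin x y t0)) -!EFinD !lee_fin => B2.
rewrite nst in key; lra.
Qed.

(* In operator form, [green = int_0^t e^{-sL} ds + e^{-tL} green]. *)
Lemma green_decomposition t x y : 0 <= t -> ((green g o x y)%:E =
  green_upto t x y + \esum_(z in [set: X]) (heat_kernel t x z * green g o z y)%:E)%E.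
Proof.
move=> t0.
have B : (green_upto t x y + \esum_(z in [set: X]) (heat_kernel t x z * green g o z y)%:E <= (green g o x y)%:E)%E.
  rewrite -leeBrDl; last exact: green_upto_fin.
  (* The Green function need not be in [l2], so [T t] acts on its restrictions to finite sets, which
     still lie below it. *)
  apply: ge_ereal_sup => _ [F [finF _] <-].
  rewrite leeBrDl ?green_upto_fin// addeC.
  pose phi z := (z \in F)%:R * green g o z y.
  have phif : finsupp phi := finsupp_restrict _ finF.
  rewrite (_ : (\sum_(_ \in _) _)%E = (T t phi x)%:E).
    apply: heat_green_upto_le_green => // z; rewrite /phi.
    by case: (z \in F); rewrite ?mul1r// mul0r (green_ge0 conn trans).
  rewrite heatE//; last exact: l2_finsupp.
  rewrite -esum_fset//; last by move=> z _; rewrite lee_fin mulr_ge0 ?heat_kernel_ge0 ?(green_ge0 conn trans).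
  rewrite EFin_rsum.
  - rewrite esum_mkcond; apply: eq_esum => z _.
    by rewrite /phi; case: (z \in F); rewrite ?mul1r// mul0r mulr0.
  - by move=> z; rewrite !mulr_ge0 ?heat_kernel_ge0 ?(green_ge0 conn trans).
  - apply: summ_ge0; first by move=> z; rewrite !mulr_ge0 ?heat_kernel_ge0 ?(green_ge0 conn trans).
    by under eq_fun do rewrite mulrC; exact: summ_finsupp.
apply/eqP; rewrite eq_le B andbT.
have Bfin : (green_upto t x y + \esum_(z in [set: X]) (heat_kernel t x z * green g o z y)%:E)%E \is a fin_num.
  rewrite ge0_fin_numE; first exact: le_lt_trans B (ltry _).
  by rewrite adde_ge0 ?green_upto_ge0//; apply: esum_ge0 => z _;
     rewrite lee_fin mulr_ge0 ?heat_kernel_ge0 ?(green_ge0 conn trans).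
(* For the reverse bound restrictions are unsuitable, as cutting off can push the Laplacian above
   [1_y]; the subsolutions [green_n] keep that bound. *)
rewrite -(fineK Bfin) lee_fin; apply: (cvgr_to_le (green_n_cvg conn trans (y := y) (x := x))).
apply: nearW => n; rewrite -lee_fin fineK//.
have gf := green_n_finsupp g y n.
apply: le_trans (green_upto_ge x t0 gf (laplacian_green_n (deg_gt0 trans) y n)) _.
rewrite addeC leeD2l// heatE//; last exact: l2_finsupp.
rewrite EFin_rsum.
- apply: le_esum => z _; rewrite lee_fin ler_wpM2l ?heat_kernel_ge0//; exact: (green_n_le conn trans).
- by move=> z; rewrite mulr_ge0 ?heat_kernel_ge0 ?green_n_ge0.
- apply: summ_ge0; first by move=> z; rewrite mulr_ge0 ?heat_kernel_ge0 ?green_n_ge0.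
  by under eq_fun do rewrite mulrC; exact: summ_finsupp.
Qed.

Lemma heat_excessive t w x : 0 <= t -> (forall z, 0 <= w z) -> formal_dom g w ->
  (forall z, 0 <= laplacian g w z) ->
  (\esum_(z in [set: X]) (heat_kernel t x z * w z)%:E <= (w x)%:E)%E.
Proof.
move=> t0 w0 wd wL; apply: ge_ereal_sup => _ [F [finF _] <-].
pose phi z := (z \in F)%:R * w z.
have phif : finsupp phi := finsupp_restrict _ finF.
rewrite (_ : (\sum_(_ \in _) _)%E = (T t phi x)%:E).
  rewrite lee_fin; apply: (heat_le conn sg) => // z; rewrite /phi.
  by case: (z \in F); rewrite ?mul1r// mul0r.
rewrite heatE//; last exact: l2_finsupp.
rewrite -esum_fset//; last by move=> z _; rewrite lee_fin mulr_ge0 ?heat_kernel_ge0.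
rewrite EFin_rsum.
- rewrite esum_mkcond; apply: eq_esum => z _.
  by rewrite /phi; case: (z \in F); rewrite ?mul1r// mul0r mulr0.
- by move=> z; rewrite !mulr_ge0 ?heat_kernel_ge0.
- apply: summ_ge0; first by move=> z; rewrite !mulr_ge0 ?heat_kernel_ge0.
  by under eq_fun do rewrite mulrC; exact: summ_finsupp.
Qed.

End HeatKernel.

(** * The formula for [M_t], large times and stochastic completeness *)

Section HeatConsequences.
Context {R : realType} {X : countType} (g : graph X R) (o : X).
Variable T : R -> (X -> R) -> (X -> R).
Hypothesis conn : connected_graph g.
Hypothesis trans : transient g o.
Hypothesis sg : semigroup_of (opL g o) T.
Implicit Types (u v w h phi : X -> R) (x y z : X).
Local Notation mu := lebesgue_measure.
Local Notation p := (heat_kernel T).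

Let p0 s x y : 0 <= p s x y := heat_kernel_ge0 conn sg s x y.

Lemma sg_extE t w x : 0 <= t ->
  sg_ext T t w x = nnsum (fun z => p t x z * w z).
Proof. by move=> t0; apply: eq_esum => z _; rewrite /heat_kernel ger0_norm. Qed.

(** [green_decomposition] weighted by [c y] and summed over [y]; Tonelli exchanges this sum with the
    time integral and with the sum over [z]. *)
Lemma heat_killing t x : 0 <= t -> (green_c g o x =
  \int[mu]_(s in `[0%R, t]) (sg_ext T s (c g) x) + nnsum (fun z => p t x z * green_killing g o z)%R)%E.
Proof.
move=> t0.
have c0 := @c_ge0 _ _ g; have G0 z y := green_ge0 conn trans z y.
have pc0 s y : 0 <= p s x y * c g y by rewrite mulr_ge0.
have -> : (\int[mu]_(s in `[0%R, t]) (sg_ext T s (c g) x) =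
    \esum_(y in [set: X]) (green_upto T t x y * (c g y)%:E))%E.
  transitivity (\int[mu]_(s in `[0%R, t]) (\esum_(y in [set: X]) (p s x y * c g y)%:E))%E.
    by apply: eq_integral => s; rewrite inE/= in_itv/= => /andP[s0 _]; rewrite sg_extE.
  rewrite integral_esum//.
  - apply: eq_esum => y _; rewrite /green_upto -ge0_integralZr//.
    + by apply/measurable_EFinP; exact: (heat_kernel_measurable sg).
    + by move=> s _; rewrite lee_fin.
    + by rewrite lee_fin.
  - by move=> y s _; rewrite lee_fin.
  - move=> y; apply/measurable_EFinP; apply: measurable_funM; last exact: measurable_cst.
    exact: (heat_kernel_measurable sg).
rewrite /green_c.
transitivity (\esum_(y in [set: X]) (green_upto T t x y * (c g y)%:E +
    nnsum (fun z => p t x z * (green g o z y * c g y))%R))%E.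
  apply: eq_esum => y _; rewrite EFinM (green_decomposition conn trans sg x y t0) ge0_muleDl; last 2 first.
  - exact: (green_upto_ge0 conn sg).
  - by apply: esum_ge0 => z _; rewrite lee_fin mulr_ge0.
  congr (_ + _)%E; rewrite muleC -nnsumZ//; last by move=> z; rewrite mulr_ge0.
  by congr nnsum; apply/funext => z; ring.
rewrite esumD.
- congr (_ + _)%E; rewrite esum_swap; last by move=> y z; rewrite lee_fin !mulr_ge0.
  apply: eq_esum => z _; rewrite EFinM (green_killingE conn trans) /green_c.
  by rewrite -/(nnsum (fun y => green g o z y * c g y)) -nnsumZ// => y; rewrite mulr_ge0.
- by move=> y _; rewrite mule_ge0 ?lee_fin//; exact: (green_upto_ge0 conn sg).
- by move=> y _; apply: nnsum_ge0 => z; rewrite !mulr_ge0.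
Qed.

(** Split the initial function as [1 = green_killing + surv]: by [heat_killing] the first part and
    the time integral add up to [green_killing x]. *)
Lemma MtE t x : 0 <= t -> (Mt g T t x =
  (1 - surv g x)%:E + nnsum (fun z => p t x z * surv g z)%R)%E.
Proof.
move=> t0; rewrite /Mt sg_extE//.
rewrite (_ : (fun z => p t x z * 1) = fun z => p t x z * green_killing g o z + p t x z * surv g z); last first.
  by apply/funext => z; rewrite (green_killing_surv conn trans); ring.
have W0 := surv_ge0 trans.
rewrite nnsumD; first last.
- by move=> z; rewrite mulr_ge0.
- by move=> z; rewrite mulr_ge0 ?(green_killing_ge0 conn trans).
rewrite -(green_killing_surv conn trans) (green_killingE conn trans) (heat_killing x t0).
rewrite addeAC; congr (_ + _)%E; exact: addeC.
Qed.

Lemma laplacian_cst (a : R) x : laplacian g (fun=> a) x = c g x * a.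
Proof.
rewrite laplacianE; last exact: formal_cst.
rewrite (_ : adj g (fun=> a) x = a * jump_rate g x) /deg; first by ring.
rewrite jump_rateE /adj -rsumZ; last exact: b_summ.
by congr rsum; apply/funext => y; rewrite mulrC.
Qed.

Lemma heat_kernel_mass t x : 0 <= t -> (nnsum (p t x) <= 1)%E.
Proof.
move=> t0; have := @heat_excessive _ _ _ _ _ conn sg t (fun=> 1) x t0.
rewrite (_ : (\esum_(z in [set: X]) _)%E = nnsum (p t x)); last first.
  by apply: eq_esum => z _; rewrite mulr1.
apply => //; first exact: formal_cst.
by move=> z; rewrite laplacian_cst mulr_ge0// c_ge0.
Qed.

Lemma heat_kernel_summ t x : 0 <= t -> summ (p t x).
Proof. by move=> t0; apply: ge0_summ => //; exact: le_lt_trans (heat_kernel_mass x t0) (ltry _). Qed.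

Lemma heat_kernel_weighted_summ t x w : 0 <= t -> (forall z, 0 <= w z <= 1) -> summ (fun z => p t x z * w z).
Proof.
move=> t0 w01; apply: summ_le (heat_kernel_summ x t0) => z; have /andP[w0 w1] := w01 z.
by rewrite ger0_norm ?mulr_ge0// ler_piMr.
Qed.

(** On the diagonal the kernel at time [t] is the squared norm of [T (t / 2) 1_z], hence
    nonincreasing in time; so [t] times its last value is at most its integral over [[0, t]]. *)
Lemma heat_kernel_diag t z : 0 <= t -> t * p t z z <= green g o z z.
Proof.
move=> t0; have il y : l2 (ind R y) := l2_finsupp (finsupp_single y).
have half r : 0 <= r -> p (r + r) z z = l2dot (T r (ind R z)) (T r (ind R z)).
  move=> r0; have rr0 : 0 <= r + r by rewrite addr_ge0.
  rewrite -(sg_symmetric sg)//; last exact: (sg_l2 sg).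
  by rewrite -(sg_comp sg)// l2dot_ind /heat_kernel ger0_norm.
have mono r : 0 <= r -> r <= t -> p t z z <= p r z z.
  move=> r0 rt; have r20 : 0 <= r / 2 by rewrite divr_ge0.
  have t20 : 0 <= t / 2 by rewrite divr_ge0.
  have d0 : 0 <= t / 2 - r / 2 by lra.
  have E (a : R) : a = a / 2 + a / 2 by lra.
  rewrite (E t) (E r) !half// -!l2norm_sqr; try exact: (sg_l2 sg).
  rewrite lerXn2r ?nnegrE ?l2norm_ge0//.
  have -> : t / 2 = t / 2 - r / 2 + r / 2 by ring.
  rewrite (sg_comp sg)//; apply: (sg_contraction sg) => //; exact: (sg_l2 sg).
apply/ler_addgt0Pr => e e0.
have t10 : 0 < t + 1 by lra.
have ee0 : 0 < e / (t + 1) by rewrite divr_gt0.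
have [n [s [s0 _ nst _ B2]]] := green_upto_riemann conn sg z z t0 ee0 ltr01.
have : t * p t z z <= \sum_(k < n) s * T (k%:R * s) (ind R z) z.
  rewrite -nst; rewrite (_ : n%:R * s * p (n%:R * s) z z = \sum_(k < n) s * p (n%:R * s) z z); last first.
    by rewrite sumr_const card_ord -mulrA mulr_natl.
  apply: ler_sum => k _; rewrite ler_wpM2l ?(ltW s0)//.
  have ks0 : 0 <= k%:R * s by rewrite mulr_ge0 ?(ltW s0).
  rewrite nst (_ : T (k%:R * s) (ind R z) z = p (k%:R * s) z z); last by rewrite /heat_kernel ger0_norm.
  apply: mono => //; rewrite -nst ler_wpM2r ?(ltW s0)// ler_nat ltnW//.
have tt : t * (e / (t + 1)) <= e.
  by rewrite mulrA ler_pdivrMr// mulrC ler_wpM2l ?(ltW e0)//; lra.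
have := green_upto_le_green conn trans sg z z t0.
move: B2; rewrite -(fineK (green_upto_fin conn trans sg z z t0)) -EFinD !lee_fin; lra.
Qed.

Lemma heat_finsupp_vanish phi (e : R) : finsupp phi -> 0 < e ->
  exists2 t0 : R, 0 <= t0 & forall t, t0 <= t -> l2norm (T t phi) <= e.
Proof.
have il y : l2 (ind R y) := l2_finsupp (finsupp_single y).
move=> phif; suff : l2 phi /\ forall e, 0 < e ->
    exists2 t0 : R, 0 <= t0 & forall t, t0 <= t -> l2norm (T t phi) <= e.
  by case=> _; exact.
move: phi phif; apply: finsupp_ind.
  split; first exact: l2_zero.
  move=> e' e0; exists 0 => // t t0; rewrite (T_zero sg)// (l2normE l2_zero).
  rewrite /l2dot (_ : (fun x => _) = fun=> 0); first by rewrite rsum0 sqrtr0 ltW.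
  by apply/funext => z; rewrite mulr0.
move=> a z f [fl IH]; split; first exact: l2_lin.
move=> {}e e0; have e20 : 0 < e / 2 by rewrite divr_gt0.
have [t1 t10 H1] := IH _ e20.
pose e1 := e / 2 / (`|a| + 1).
have a10 : 0 < `|a| + 1 by rewrite ltr_wpDl.
have e10 : 0 < e1 by rewrite !divr_gt0.
(* The squared norm of [T t 1_z] is the kernel at [(z, z)] and time [2t], at most [green / (2t)] by
   [heat_kernel_diag]; from [t2] on this is below [e1^2]. *)
pose t2 := (green g o z z + 1) / e1 ^+ 2.
have G0 := green_ge0 conn trans z z.
have e12 : 0 < e1 ^+ 2 by rewrite exprn_gt0.
have t20 : 0 < t2 by rewrite divr_gt0// ltr_wpDl.
exists (Num.max t1 t2); first by rewrite le_max t10.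
move=> t; rewrite ge_max => /andP[t1t t2t].
have t0 : 0 < t := lt_le_trans t20 t2t.
have t0' := ltW t0.
have h1 : l2norm (T t (ind R z)) <= e1.
  rewrite -(@ler_pXn2r _ 2)// ?nnegrE ?l2norm_ge0 ?(ltW e10)//.
  rewrite l2norm_sqr; last exact: (sg_l2 sg).
  rewrite -(sg_symmetric sg)//; last exact: (sg_l2 sg).
  rewrite -(sg_comp sg)// l2dot_ind.
  have tt0 : 0 <= t + t by rewrite addr_ge0.
  have := heat_kernel_diag z tt0; rewrite /heat_kernel ger0_norm//.
  have := heat_ge0 conn sg z tt0 (il z) (fun x => ind_ge0 z x).
  set P := T _ _ _ => P0 hP.
  have := t2t; rewrite /t2 ler_pdivrMr// => h3.
  rewrite -(ler_pM2l t0); nra.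
rewrite (sg_linear sg)//.
apply: le_trans (l2normD (l2_scale _ (sg_l2 sg t0' (il z))) (sg_l2 sg t0' fl)) _.
rewrite l2normZ; last exact: (sg_l2 sg).
have h2 := H1 t t1t.
have h3 : `|a| * l2norm (T t (ind R z)) <= e / 2.
  apply: le_trans (_ : `|a| * e1 <= _); first by rewrite ler_wpM2l.
  by rewrite /e1 mulrCA ler_piMr ?(ltW e20)// ler_pdivrMr// mul1r lerDl.
lra.
Qed.

Lemma sum_ind_le (s : seq X) x : uniq s -> \sum_(y <- s) c g y * ind R y x <= c g x.
Proof.
elim: s => [|y s IH] /=; first by rewrite big_nil c_ge0.
move=> /andP[ys us]; rewrite big_cons /ind; have [xy|xy] := eqVneq x y.
  rewrite mulr1 big_seq big1 ?addr0 ?xy// => z zs.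
  have [yz|_] := eqVneq y z; last by rewrite mulr0.
  by move: ys; rewrite yz zs.
by rewrite mulr0 add0r; exact: IH.
Qed.

(** Since [laplacian 1 = c], this says that [1 - phi] is superharmonic. *)
Lemma green_n_sum_super n (s : seq X) : uniq s ->
  let phi z := \sum_(y <- s) c g y * green_n g y n z in
  finsupp phi /\ forall x, laplacian g phi x <= c g x.
Proof.
move=> us phi.
have : finsupp phi /\ forall x, laplacian g phi x <= \sum_(y <- s) c g y * ind R y x.
  rewrite /phi; elim: s {us phi} => [|y s [IH1 IH2]].
    under eq_fun do rewrite big_nil; split; first by apply: finsupp_sub (finsupp_single o).
    by move=> x; rewrite big_nil laplacian_cst mulr0.
  under eq_fun do rewrite big_cons.
  have gf := green_n_finsupp g y n; split; first exact: finsupp_comb.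
  move=> x; rewrite laplacianZD; [|exact: finsupp_formal|exact: finsupp_formal].
  rewrite big_cons; apply: lerD => //; rewrite ler_wpM2l ?c_ge0//.
  exact: (laplacian_green_n (deg_gt0 trans)).
move=> [h1 h2]; split => // x; apply: le_trans (h2 x) _; exact: sum_ind_le.
Qed.

(* With [phi = sum_(y <- s) c y * green_n y n], a finitely supported function close
   to [1] at [x], the function [1 - phi] is excessive; so [e^{-tL} 1] at [x] is at
   most [1 - phi x + e^{-tL} phi x]. *)
Lemma heat1_vanish x (e : R) : (forall z, surv g z = 0) -> 0 < e ->
  exists2 t0 : R, 0 <= t0 & forall t, t0 <= t -> (nnsum (p t x) <= e%:E)%E.
Proof.
move=> Wz e0; have e20 : 0 < e / 2 by rewrite divr_gt0.
have Gc : green_c g o x = 1%E by apply/(green_c_eq1 conn trans).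
have : ((1 - e / 2)%:E < green_c g o x)%E by rewrite Gc lte_fin; lra.
move=> /ereal_sup_gt[_ [F [finF _] <-]].
rewrite fsbig_finite//= sumEFin lte_fin => ltF.
have us : uniq (finmap.enum_fset (fset_set F)) := finmap.fset_uniq _.
move: us ltF; move: (finmap.enum_fset _) => s us ltF.
have cv : (fun n => \sum_(y <- s) c g y * green_n g y n x) @ \oo -->
   \sum_(y <- s) green g o x y * c g y.
  elim: {us ltF} s => [|y r IH].
    by rewrite big_nil; under eq_fun do rewrite big_nil; exact: cvg_cst.
  rewrite big_cons; under eq_fun do rewrite big_cons.
  apply: cvgD => //; rewrite mulrC; apply: cvgM; first exact: cvg_cst.
  exact: (green_n_cvg conn trans).
have [n _ /(_ n (leqnn n)) /= ltn] := cvgr_gt _ cv _ ltF.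
have [phif phiL] := green_n_sum_super n us.
set phi := fun z => \sum_(y <- s) c g y * green_n g y n z.
have phi1 z : phi z <= 1 by have := green_n_sum_le trans n z us; rewrite Wz subr0.
have phi0 z : 0 <= phi z.
  by apply: sumr_ge0 => y _; rewrite mulr_ge0 ?c_ge0 ?green_n_ge0.
have [t0 t00 H] := heat_finsupp_vanish phif e20; exists t0 => // t t0t.
have t_0 := le_trans t00 t0t.
have pf : formal_dom g phi := finsupp_formal g phif.
have wf : formal_dom g (fun z => -1 * phi z + 1) by apply: formal_domZD => //; exact: formal_cst.
have B1 : (nnsum (fun z => p t x z * (-1 * phi z + 1))%R <= (-1 * phi x + 1)%:E)%E.
  apply: (heat_excessive conn sg) => // z; first by have := phi1 z; lra.
  rewrite laplacianZD//; last exact: formal_cst.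
  by rewrite laplacian_cst; have := phiL z; rewrite -/phi; lra.
have B2 : (nnsum (fun z => p t x z * phi z)%R <= (e / 2)%:E)%E.
  rewrite -EFin_rsum.
  - rewrite lee_fin -(heatE sg)//; last exact: l2_finsupp.
    apply: le_trans (le_trans (ler_norm _) (l2_pointwise _ (sg_l2 sg _ _))) (H _ t0t) => //.
    exact: l2_finsupp.
  - by move=> z; rewrite mulr_ge0.
  - apply: summ_ge0; first by move=> z; rewrite mulr_ge0.
    by under eq_fun do rewrite mulrC; exact: summ_finsupp.
rewrite (_ : p t x = fun z => p t x z * (-1 * phi z + 1) + p t x z * phi z); last first.
  by apply/funext => z; ring.
rewrite nnsumD.
- apply: le_trans (leeD B1 B2) _; rewrite -EFinD lee_fin.
  by rewrite /phi; lra.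
- by move=> z; rewrite mulr_ge0//; have := phi1 z; lra.
- by move=> z; rewrite mulr_ge0.
Qed.

(** By symmetry of the kernel both limits in [heat_vanishes_at] are that of the total mass of
    [p t x]. *)
Lemma heat_vanishesP x : (forall e : R, 0 < e -> exists2 t0 : R, 0 <= t0 &
    forall t, t0 <= t -> (nnsum (p t x) <= e%:E)%E) -> heat_vanishes_at T x.
Proof.
move=> H; have cv : nnsum (p t x) @[t --> +oo] --> 0%E.
  apply/fine_cvgP; split.
    near=> t; have t0 : 0 <= t by near: t; exact: nbhs_pinfty_ge.
    by rewrite ge0_fin_numE ?nnsum_ge0// (le_lt_trans (heat_kernel_mass x t0)) ?ltry.
  apply/cvgrPdist_le => e e0; have [t0 t00 Ht] := H e e0.
  near=> t; have t0t : t0 <= t by near: t; apply: nbhs_pinfty_ge; exact: num_real.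
  rewrite sub0r normrN /= ger0_norm ?fine_ge0 ?nnsum_ge0//.
  rewrite -lee_fin fineK ?Ht// ge0_fin_numE ?nnsum_ge0//.
  by apply: le_lt_trans (Ht t t0t) (ltry _).
split.
  apply: cvg_trans cv; apply: near_eq_cvg; near=> t.
  rewrite sg_extE; last by near: t; exact: nbhs_pinfty_ge.
  by congr nnsum; apply/funext => z; rewrite mulr1.
apply: cvg_trans cv; apply: near_eq_cvg; near=> t.
apply: eq_esum => z _; rewrite (heat_kernel_sym sg) /heat_kernel ger0_norm//.
Unshelve. all: by end_near. Qed.

Lemma surv0_heat : (forall z, surv g z = 0) ->
  stoch_complete_all g T /\ forall x, heat_vanishes_at T x.
Proof.
move=> Wz; split; last first.
  by move=> x; apply: heat_vanishesP => e e0; exact: heat1_vanish.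
move=> t x t0; rewrite MtE ?ltW// Wz subr0 (_ : (fun z => _) = fun=> 0).
  by rewrite /nnsum esum1// adde0.
by apply/funext => z; rewrite Wz mulr0.
Qed.

Definition heat_surv t x := rsum (fun z => p t x z * surv g z).

Let surv01 z : 0 <= surv g z <= 1. Proof. by rewrite (surv_ge0 trans) (surv_le1 trans). Qed.

Lemma EFin_heat_surv t x : 0 <= t -> (heat_surv t x)%:E = nnsum (fun z => p t x z * surv g z).
Proof.
have W0 := surv_ge0 trans.
move=> t0; rewrite EFin_rsum// => [z|]; first by rewrite mulr_ge0.
apply: summ_ge0; first by move=> z; rewrite mulr_ge0.
exact: heat_kernel_weighted_summ.
Qed.

Lemma heat_surv_le t x : 0 <= t -> heat_surv t x <= surv g x.
Proof.
move=> t0; rewrite -lee_fin EFin_heat_surv//; apply: (heat_excessive conn sg) => //.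
- exact: (surv_ge0 trans).
- exact: (surv_formal trans).
- move=> z; rewrite laplacianE; last exact: (surv_formal trans).
  by rewrite (surv_harmonic trans) subrr.
Qed.

Lemma heat_surv_ge0 t x : 0 <= heat_surv t x.
Proof. by apply: rsum_ge0 => z; rewrite mulr_ge0// (surv_ge0 trans). Qed.

Lemma heat_surv_CK s t x : 0 <= s -> 0 <= t ->
  heat_surv (s + t) x = rsum (fun z => p s x z * heat_surv t z).
Proof.
move=> s0 t0; have st0 := addr_ge0 s0 t0; have W0 := surv_ge0 trans.
have P01 z : 0 <= heat_surv t z <= 1.
  by rewrite heat_surv_ge0 (le_trans (heat_surv_le z t0))// (surv_le1 trans).
apply: EFin_inj; rewrite EFin_heat_surv// EFin_rsum; last 2 first.
- by move=> z; rewrite mulr_ge0// heat_surv_ge0.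
- by apply: summ_ge0; [move=> z; rewrite mulr_ge0// heat_surv_ge0|exact: heat_kernel_weighted_summ].
transitivity (\esum_(y in [set: X]) \esum_(z in [set: X]) (p s x z * (p t z y * surv g y))%:E)%E.
  apply: eq_esum => y _; rewrite (chapman_kolmogorov sg)// mulrC EFinM EFin_rsum; last 2 first.
  - by move=> z; rewrite mulr_ge0.
  - apply: summ_ge0; first by move=> z; rewrite mulr_ge0.
    apply: l2_summ; first exact: (heat_kernel_l2 sg).
    have -> : (fun z => p t z y) = p t y by apply/funext => z; rewrite (heat_kernel_sym sg).
    exact: (heat_kernel_l2 sg).
  rewrite -nnsumZ//; last by move=> z; rewrite mulr_ge0.
  by apply: eq_esum => z _; congr (_%:E); ring.
rewrite esum_swap; last by move=> y z; rewrite lee_fin !mulr_ge0.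
apply: eq_esum => z _; rewrite EFinM EFin_heat_surv// -nnsumZ// => y; by rewrite mulr_ge0.
Qed.

(** Across an edge the generator gives [p h x z >= h * b x z / 2] for small [h]; Chapman-Kolmogorov
    multiplies these bounds along a path of [k] edges with a common step [h]. *)
Lemma heat_kernel_small_pos x y : exists k : nat, exists2 d : R, 0 < d &
  forall h : R, 0 < h -> h < d -> 0 < p (k%:R * h) x y.
Proof.
have [s] := conn x y; elim: s x => [|z s IH] x /=.
  move=> /eqP <-; exists 0%N, 1 => // h _ _.
  by rewrite mul0r /heat_kernel normr0 (sg_id sg) ?/ind ?eqxx ?ltr01//; exact/l2_finsupp/finsupp_single.
move=> /andP[/andP[bxz ps] lz]; have [|k [d d0 H]] := IH z; first by rewrite ps.
have b2 : 0 < b g x z / 2 by rewrite divr_gt0.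
have [d' d'0 H'] := quot_le sg (opL_ind g o z) b2.
exists k.+1, (Num.min d d'); first by rewrite lt_min d0.
move=> h h0; rewrite lt_min => /andP[hd hd'].
have h0' := ltW h0; have kh0 : 0 <= k%:R * h by rewrite mulr_ge0.
rewrite -natr1 mulrDl mul1r addrC (chapman_kolmogorov sg)//.
apply: (@lt_le_trans _ _ (p h x z * p (k%:R * h) z y)); last first.
  apply: (@le_term_rsum _ _ (fun w : X => p h x w * p (k%:R * h) w y) z); first by move=> w; rewrite mulr_ge0.
  apply: l2_summ; first exact: (heat_kernel_l2 sg).
  have -> : (fun w : X => p (k%:R * h) w y) = p (k%:R * h) y by apply/funext => w; rewrite (heat_kernel_sym sg).
  exact: (heat_kernel_l2 sg).
rewrite mulr_gt0 ?H//.
have [_ il Ll _] := opL_ind g o z.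
have := le_trans (l2_pointwise x (l2_quot sg h0' il Ll)) (H' h h0 hd').
have xz : x != z by apply/eqP => xz; move: bxz; rewrite xz b_diag ltxx.
rewrite /quot laplacian_ind /ind (negPf xz) mulr0 !sub0r opprK ler_norml => /andP[_].
rewrite /heat_kernel ger0_norm//; set P := T _ _ _ => hP.
have : 0 < h^-1 * P by lra.
by rewrite pmulr_rgt0 ?invr_gt0.
Qed.

Lemma heat_surv0 : stoch_complete_some g T -> (exists x, heat_vanishes_at T x) ->
  exists x, surv g x = 0.
Proof.
move=> [t [x0 [t0 Mt1]]] [x1 [van _]]; exists x1.
have t0' := ltW t0; have W0 := surv_ge0 trans.
have Pt : heat_surv t x0 = surv g x0.
  move: Mt1; rewrite MtE// -EFin_heat_surv// -EFinD => /eqP; rewrite eqe => /eqP; lra.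
(* Half the time leaves room for a small [r <= s] at which the kernel from [x0] to [y] is positive,
   while [t - r >= s] still allows a comparison with time [s]. *)
pose s := t / 2; have s0 : 0 < s by rewrite divr_gt0.
have s0' := ltW s0.
have PWs y : heat_surv s y = surv g y.
  have [k [d d0 H]] := heat_kernel_small_pos x0 y.
  pose h := Num.min (d / 2) (s / k.+1%:R).
  have h0 : 0 < h by rewrite lt_min !divr_gt0.
  have hd : h < d by rewrite gt_min; apply/orP; left; lra.
  pose r := k%:R * h.
  have r0 : 0 <= r by rewrite mulr_ge0// ltW.
  have rs : r <= s.
    apply: (@le_trans _ _ (k.+1%:R * (s / k.+1%:R))); last by rewrite mulrC divfK.
    apply: ler_pM => //; [exact: ltW|by rewrite ler_nat|by rewrite ge_min lexx orbT].
  have pr := H h h0 hd; rewrite -/r in pr.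
  have d1 : 0 <= s - r by lra.
  have tr0 : 0 <= t - r by rewrite /s in d1; lra.
  have mono z : heat_surv (t - r) z <= heat_surv s z.
    have -> : t - r = s + (s - r) by rewrite /s; field.
    rewrite heat_surv_CK//; apply: ler_rsum.
    - by apply: heat_kernel_weighted_summ => // w; rewrite heat_surv_ge0 (le_trans (heat_surv_le w d1))// (surv_le1 trans).
    - exact: heat_kernel_weighted_summ.
    - by move=> w; rewrite ler_wpM2l// heat_surv_le.
  have s1 : summ (fun z => p r x0 z * heat_surv s z).
    by apply: heat_kernel_weighted_summ => // w; rewrite heat_surv_ge0 (le_trans (heat_surv_le w s0'))// (surv_le1 trans).
  have s2 := heat_kernel_weighted_summ x0 r0 surv01.
  (* Averages at time [r]: that of [surv] is at most [surv x0 = heat_surv t x0], which is the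
     average of [heat_surv (t - r)] and so at most that of [heat_surv s]. Thus a sum of nonnegative
     terms vanishes, and positivity of the kernel isolates the term at [y]. *)
  have E : rsum (fun z => p r x0 z * surv g z - p r x0 z * heat_surv s z) = 0.
    apply/eqP; rewrite eq_le; apply/andP; split; last first.
      by apply: rsum_ge0 => z; rewrite -mulrBr mulr_ge0// subr_ge0 heat_surv_le.
    rewrite rsumB// subr_le0 -/(heat_surv r x0).
    apply: le_trans (heat_surv_le x0 r0) _; rewrite -Pt.
    have -> : heat_surv t x0 = rsum (fun z => p r x0 z * heat_surv (t - r) z).
      by rewrite -(heat_surv_CK x0 r0 tr0) addrC subrK.
    apply: ler_rsum => //.
      apply: heat_kernel_weighted_summ => // w.
      by rewrite heat_surv_ge0 (le_trans (heat_surv_le w tr0))// (surv_le1 trans).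
    by move=> z; rewrite ler_wpM2l.
  have pos_part z : 0 <= p r x0 z * surv g z - p r x0 z * heat_surv s z.
    by rewrite -mulrBr mulr_ge0// subr_ge0 heat_surv_le.
  have := rsum_eq0 pos_part (summB s2 s1) E y.
  by rewrite -mulrBr => /eqP; rewrite mulf_eq0 gt_eqF//= subr_eq0 => /eqP.
(* Invariance at all vertices can be iterated, which reaches the large times at which the mass at
   [x1] is small. *)
have PWn n : heat_surv (n.+1%:R * s) x1 = surv g x1.
  suff H y : heat_surv (n.+1%:R * s) y = surv g y by exact: H.
  elim: n y => [|n IH] y; first by rewrite mul1r.
  have -> : n.+2%:R * s = s + n.+1%:R * s by rewrite -(natr1 n.+1); ring.
  rewrite heat_surv_CK ?mulr_ge0// -[RHS]PWs; congr rsum; apply/funext => z.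
  by rewrite IH.
apply/eqP; rewrite eq_le W0 andbT; apply/ler_addgt0Pr => e e0; rewrite add0r.
have /fine_cvgP[_ /cvgrPdist_le /(_ e e0)] := van.
move=> [M [_ HM]].
pose n := Num.truncn (Num.max 0 M / s).
have nM : M < n.+1%:R * s.
  apply: (@le_lt_trans _ _ (Num.max 0 M)); first by rewrite le_max lexx orbT.
  by rewrite -ltr_pdivrMr// truncnS_gt.
have ns0 : 0 <= n.+1%:R * s by rewrite mulr_ge0.
have := HM _ nM; rewrite /= sub0r normrN => /(le_trans (ler_norm _)); apply: le_trans.
rewrite -(PWn n) -lee_fin EFin_heat_surv// fineK.
  rewrite sg_extE//; apply: le_nnsum => z; rewrite mulr1 ler_piMr//.
  by case/andP: (surv01 z).
rewrite sg_extE// ge0_fin_numE.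
  by rewrite (_ : (fun z => _) = p (n.+1%:R * s) x1) ?(le_lt_trans (heat_kernel_mass _ _)) ?ltry//;
    apply/funext => z; rewrite mulr1.
by apply: nnsum_ge0 => z; rewrite mulr1.
Qed.

End HeatConsequences.

(** * Total killing of a trajectory as a sum over holding times *)

Section OccupationTime.
Context {R : realType} {X : countType} (g : graph X R).
Context d (Omega : measurableType d) (Y : nat -> Omega -> X) (S : nat -> Omega -> \bar R).
Hypothesis S_gt0 : forall n w, (0 < S n w)%E.
Local Notation mu := lebesgue_measure.
Local Notation J := (jump_time S).

Lemma jump_timeS n w : J n.+1 w = (J n w + S n w)%E.
Proof. by rewrite /jump_time big_ord_recr. Qed.

Lemma jump_time_ge0 n w : (0 <= J n w)%E.
Proof. by apply: sume_ge0 => k _; exact: ltW. Qed.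

Lemma jump_time_mono m n w : (m <= n)%N -> (J m w <= J n w)%E.
Proof.
move=> /subnK <-; elim: (n - m)%N => [//|k IH].
by rewrite addSn jump_timeS (le_trans IH)// leeDl// ltW.
Qed.

Definition stay k w : set R := [set t | (J k w <= t%:E < J k.+1 w)%E].

Lemma stay_trivIset w : trivIset setT (stay ^~ w).
Proof.
apply/trivIsetP => i j _ _; wlog ij : i j / (i < j)%N => [hw|_].
  rewrite neq_ltn => /orP[h|h]; first by apply: hw; rewrite // neq_ltn h.
  by rewrite setIC; apply: hw; rewrite // neq_ltn h.
apply/seteqP; split => // t /= [/andP[_ h1] /andP[h2 _]].
have := lt_le_trans h1 (le_trans (jump_time_mono w ij) h2).
by rewrite ltxx.
Qed.

Lemma state_atE k t w : stay k w t -> state_at Y S t w = Some (Y k w).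
Proof.
move=> tk; apply: xget_unique; first by exists k.
move=> _ [k' [-> tk']]; congr (Some (Y _ w)).
exact: (@stay_trivIset w k' k I I (ex_intro _ t (conj tk' tk))).
Qed.

Lemma stay_cover w :
  [set t : R | (0 <= t)%R /\ (t%:E < lifetime S w)%E] = \bigcup_k stay k w.
Proof.
apply/seteqP; split => [t [t0 tz]|t [k _ /andP[h1 h2]]].
  have [n tn] : exists n, (t%:E < J n w)%E.
    apply: contrapT => H; move: tz; rewrite ltNge => /negP; apply.
    rewrite /lifetime; apply: lime_le.
      by apply: is_cvg_nneseries => n _ _; exact: ltW.
    apply: nearW => n; rewrite big_mkord -/(J n w) leNgt; apply/negP => h.
    by apply: H; exists n.
  elim: n tn => [|n IH]; first by rewrite /jump_time big_ord0 lte_fin ltNge t0.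
  have [h1 h2|h _] := leP (J n w) t%:E; last exact: IH.
  by exists n => //=; rewrite /stay/= h1.
split; first by rewrite -lee_fin (le_trans (jump_time_ge0 k w)).
apply: lt_le_trans h2 _; rewrite /jump_time /lifetime -(big_mkord xpredT (fun i => S i w)).
apply: nneseries_lim_ge => i _ _; exact: ltW.
Qed.

Lemma stay_itv k w : measurable (stay k w) /\
  mu (stay k w) = (if J k w == +oo then 0 else S k w)%E.
Proof.
rewrite /stay jump_timeS; have := jump_time_ge0 k w; have := S_gt0 k w.
case: (J k w) => [a||]//; case: (S k w) => [b||]// b0 _.
- rewrite (_ : [set _ | _] = `[a, a + b[%classic); last first.
    by apply/seteqP; split => t /=; rewrite in_itv/= !lee_fin lte_fin.
  split; first exact: measurable_itv.
  rewrite lebesgue_measure_itv/= lte_fin ltrDl -lte_fin b0 -EFinB.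
  by congr (_%:E); ring.
- rewrite (_ : [set _ | _] = `[a, +oo[%classic); last first.
    by apply/seteqP; split => t /=; rewrite in_itv/= ?andbT ?lee_fin ?ltry ?andbT.
  split; first exact: measurable_itv.
  by rewrite lebesgue_measure_itv/= ltry.
- rewrite (_ : [set _ | _] = set0); first by rewrite measure0.
  by apply/seteqP; split => t //=.
- rewrite (_ : [set _ | _] = set0); first by rewrite measure0.
  by apply/seteqP; split => t //=.
Qed.

(** If an earlier holding time is infinite, the k-th state is never occupied and contributes 0. *)
Definition stay_killing k w : \bar R :=
  ((c g (Y k w))%:E * if J k w == +oo then 0 else S k w)%E.

Lemma stay_killing_ge0 k w : (0 <= stay_killing k w)%E.
Proof.
by rewrite /stay_killing mule_ge0 ?lee_fin ?c_ge0//; case: ifP => // _; exact: ltW.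
Qed.

Lemma total_killingE w : total_killing g Y S w = (\sum_(k <oo) stay_killing k w)%E.
Proof.
rewrite /total_killing stay_cover.
have mst k : measurable (stay k w) by case: (stay_itv k w).
have st k t : stay k w t -> oapp (c g) 0 (state_at Y S t w) = c g (Y k w).
  by move=> /state_atE ->.
rewrite ge0_integral_bigcup//.
- apply: eq_eseriesr => k _.
  transitivity (\int[mu]_(t in stay k w) (c g (Y k w))%:E)%E.
    by apply: eq_integral => t; rewrite inE => /st ->.
  by rewrite integral_cst; [congr (_ * _)%E; exact: (stay_itv k w).2|exact: mst].
- apply/measurable_fun_bigcup => // k; apply/measurable_EFinP.
  apply: (@eq_measurable_fun _ _ _ _ _ (cst (c g (Y k w)))); last exact: measurable_cst.
  by move=> t; rewrite inE => /st ->.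
- move=> t [k _ /st ->]; by rewrite lee_fin c_ge0.
- exact: stay_trivIset.
Qed.

Hypothesis mY : forall n y, measurable [set w | Y n w = y].
Hypothesis mS : forall n, measurable_fun [set: Omega] (S n).

(** As the chain is only known through its level sets, a preimage is written as a union over the
    countably many codes of states. *)
Lemma measurable_state d' (T' : measurableType d') (h : X -> T') n :
  measurable_fun [set: Omega] (fun w => h (Y n w)).
Proof.
move=> _ B mB; rewrite setTI.
rewrite (_ : _ @^-1` B = \bigcup_k [set w | exists x, @pickle_inv X k = Some x /\ (B (h x) /\ Y n w = x)]).
  apply: bigcupT_measurable => k; case E : (@pickle_inv X k) => [x|]; last first.
    by rewrite (_ : [set _ | _] = set0)//; apply/seteqP; split => // w [x []].
  have [Bx|Bx] := pselect (B (h x)).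
    rewrite (_ : [set _ | _] = [set w | Y n w = x])//.
    apply/seteqP; split => [w [x' [[<-] []]]//|w /= Ywx].
    by exists x; rewrite Ywx.
  rewrite (_ : [set _ | _] = set0)//; apply/seteqP; split => // w [x' [[<-] []]//].
apply/seteqP; split => [w Bw|w [k _ [x [_ [Bx Yx]]]]]; last by rewrite /= Yx.
by exists (pickle (Y n w)) => //; exists (Y n w); rewrite pickleK_inv.
Qed.

Lemma measurable_jump_time n : measurable_fun [set: Omega] (J n).
Proof. by apply: emeasurable_sum => k; exact: mS. Qed.

Lemma measurable_total_killing :
  measurable [set w | total_killing g Y S w = +oo%E].
Proof.
have m : measurable_fun [set: Omega] (fun w => (\sum_(k <oo) stay_killing k w)%E).
  apply: ge0_emeasurable_sum => k; first by move=> w _ _; exact: stay_killing_ge0.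
  move=> _; apply: emeasurable_funM.
    apply/measurable_EFinP; exact: (measurable_state (c g)).
  apply: measurable_fun_ifT; [|exact: measurable_cst|exact: mS].
  apply: (measurable_fun_bool true).
  rewrite (_ : _ @^-1` _ = J k @^-1` [set +oo%E]).
    by have := @measurable_jump_time k measurableT _ (emeasurable_set1 +oo%E); rewrite setTI.
  by apply/seteqP; split => w /= /eqP.
rewrite (_ : [set w | _] = (fun w => (\sum_(k <oo) stay_killing k w)%E) @^-1` [set +oo%E]).
  by rewrite -[X in measurable X]setTI; apply: m.
by apply/seteqP; split => w /=; rewrite total_killingE.
Qed.

(* An infinite holding time is harmless as long as it does not occur at a vertex
   without killing. *)
Lemma total_killing_infty w :
  (forall k, S k w = +oo%E -> c g (Y k w) != 0) ->
  (\sum_(k <oo) ((c g (Y k w))%:E * S k w) = +oo)%E -> total_killing g Y S w = +oo%E.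
Proof.
move=> H B; rewrite total_killingE.
have [[k Sk]|fin] := pselect (exists k, S k w = +oo%E); last first.
  rewrite -B; apply: eq_eseriesr => k _; rewrite /stay_killing; congr (_ * _)%E.
  have : (J k w < +oo)%E.
    rewrite /jump_time; apply: lte_sum_pinfty => i _; rewrite ltey; apply/eqP => Si.
    by apply: fin; exists i.
  by move=> /lt_eqF ->.
(* At the first infinite holding time, [J k] is still finite, so this single term of [stay_killing]
   is infinite. *)
have {k Sk}[k [Sk mk]] : exists k, S k w = +oo%E /\ forall i, (i < k)%N -> S i w != +oo%E.
  have ex : exists k, S k w == +oo%E by exists k; rewrite Sk.
  exists (ex_minn ex); case: ex_minnP => m /eqP Sm min; split => // i im.
  by apply/negP => /min; rewrite leqNgt im.
apply/eqP; rewrite -leye_eq.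
have : (\sum_(0 <= i < k.+1) stay_killing i w <= \sum_(i <oo) stay_killing i w)%E.
  by apply: nneseries_lim_ge => i _ _; exact: stay_killing_ge0.
apply: le_trans.
rewrite big_nat_recr//= /stay_killing -/(J k w).
have -> : (J k w == +oo)%E = false.
  apply/negbTE; rewrite -ltey /jump_time; apply: lte_sum_pinfty => i _.
  by rewrite ltey mk.
have c0 : 0 < c g (Y k w) by rewrite lt_neqAle eq_sym H// c_ge0.
rewrite Sk mulry gtr0_sg// mul1e.
rewrite leye_eq addey//; rewrite -ltNye.
by apply: (@lt_le_trans _ _ 0%E) => //; apply: sume_ge0 => i _; exact: stay_killing_ge0.
Qed.

Lemma total_killing_le w :
  (total_killing g Y S w <= \sum_(k <oo) ((c g (Y k w))%:E * S k w))%E.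
Proof.
rewrite total_killingE; apply: lee_nneseries => k _; first by move=> _; exact: stay_killing_ge0.
rewrite /stay_killing lee_wpmul2l ?lee_fin ?c_ge0//.
by case: ifP => // _; exact: ltW.
Qed.

End OccupationTime.

(** * Exponential weights of extended times *)

Section ExponentialLaw.
Context {R : realType}.
Local Notation mu := lebesgue_measure.

(** At [v = +oo] this is 0 for [a > 0] but 1 for [a = 0], since [0 * +oo = 0]: an infinite stay
    without killing is survived. *)
Definition decay (a : R) (v : \bar R) : R := fine (expeR (- (a%:E * v))).

Lemma decayE a v : 0 <= a -> (0 <= v)%E -> (decay a v)%:E = expeR (- (a%:E * v)).
Proof.
move=> a0 v0; rewrite /decay fineK// ge0_fin_numE ?expeR_ge0//.
have : (- (a%:E * v) <= 0)%E by rewrite oppe_le0 mule_ge0 ?lee_fin.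
by rewrite -lee_expeR expeR0 => /le_lt_trans; apply; exact: ltry.
Qed.

Lemma decay01 a v : 0 <= a -> (0 <= v)%E -> 0 <= decay a v <= 1.
Proof.
move=> a0 v0; rewrite -!lee_fin decayE// expeR_ge0 -expeR0 lee_expeR.
by rewrite oppe_le0 mule_ge0 ?lee_fin.
Qed.

Lemma decay_fin a (r : R) : decay a r%:E = expR (- (a * r)).
Proof. by rewrite /decay -EFinM -EFinN. Qed.

Lemma decay_infty a : 0 < a -> decay a +oo = 0.
Proof. by move=> a0; rewrite /decay mulry gtr0_sg// mul1e. Qed.

Lemma decay0 v : decay 0 v = 1.
Proof. by rewrite /decay mul0e oppe0 expeR0. Qed.

Lemma decayD (u v : \bar R) : (0 <= u)%E -> (0 <= v)%E ->
  decay 1 (u + v)%E = decay 1 u * decay 1 v :> R.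
Proof.
move=> u0 v0; apply: EFin_inj; rewrite EFinM !decayE ?adde_ge0// !mul1e -expeRD.
by rewrite oppeD// ge0_adde_def// inE.
Qed.

Lemma decay_sum (u : nat -> \bar R) n : (forall k, (0 <= u k)%E) ->
  decay 1 (\sum_(k < n) u k)%E = \prod_(k < n) decay 1 (u k) :> R.
Proof.
move=> u0; elim: n => [|n IH].
  by rewrite !big_ord0 /decay mule0 oppe0 expeR0.
by rewrite !big_ord_recr/= decayD ?IH//; apply: sume_ge0 => k _.
Qed.

Lemma decay_cvg (u : nat -> \bar R) (v : \bar R) : (forall k, (0 <= u k)%E) ->
  u @ \oo --> v -> (0 <= v)%E -> decay 1 (u n) @[n --> \oo] --> (decay 1 v : R).
Proof.
move=> u0; case: v => [r||]// + _; rewrite ?decay_infty//.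
- move=> /fine_cvgP[ufin uc]; rewrite decay_fin.
  have : expR (- (1 * fine (u n))) @[n --> \oo] --> expR (- (1 * r)).
    apply: continuous_cvg; first exact: continuous_expR.
    by apply: cvgN; apply: cvgM => //; exact: cvg_cst.
  apply: cvg_trans; apply: near_eq_cvg; near=> n.
  by rewrite -decay_fin fineK//; near: n.
- move=> /cvgeyPge H; apply/cvgr0Pnorm_le => e e0.
  near=> n; have un : ((- ln e)%:E <= u n)%E by near: n; exact: H.
  have /andP[d0 _] := decay01 ler01 (u0 n).
  rewrite ger0_norm// -lee_fin decayE// mul1e -[X in (_ <= X%:E)%E]lnK ?posrE//.
  by rewrite -[(expR _)%:E]/(expeR (ln e)%:E) lee_expeR leeNl -EFinN.
Unshelve. all: by end_near. Qed.

Lemma bool_measurable d (T : measurableType d) (A : T -> bool) :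
  measurable [set t | A t] -> measurable_fun [set: T] (fun t => (A t)%:R : R).
Proof.
move=> mA; rewrite (_ : (fun _ => _) = \1_[set t | A t]); first exact/measurable_indicP.
by apply/funext => t; rewrite indicE (_ : (t \in _) = A t)//; apply/idP/idP; rewrite inE.
Qed.

Lemma measurable_decay d (T : measurableType d) a (V : T -> \bar R) : 0 <= a ->
  (forall t, 0 <= V t)%E ->
  measurable_fun [set: T] V -> measurable_fun [set: T] (fun t => decay a (V t)).
Proof.
move=> a0 V0 mV; move: a0; rewrite le_eqVlt => /predU1P[<-|a0].
  by under eq_fun do rewrite decay0; exact: measurable_cst.
(* [fine] sends [+oo] to 0, where the exponential would be 1; the indicator restores the value 0. *)
rewrite (_ : (fun _ => _) = fun t => expR (- (a * fine (V t))) * (V t < +oo)%E%:R).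
  apply: measurable_funM.
    apply: measurableT_comp => //; apply: measurableT_comp => //.
    apply: measurable_funM; first exact: measurable_cst.
    exact: measurableT_comp.
  apply: bool_measurable; rewrite -[X in measurable X]setTI.
  by apply: measurable_lte => //; exact: measurable_cst.
apply/funext => t; have := V0 t; case: (V t) => [r||]//= _.
  by rewrite decay_fin ltry mulr1.
by rewrite decay_infty// mulr0.
Qed.

Lemma exponential_tail a (v : \bar R) : 0 < a -> (0 < v)%E ->
  (\int[mu]_s (exponential_pdf a s * (s%:E < v)%E%:R)%:E = (1 - decay a v)%:E)%E.
Proof.
move=> a0; case: v => [r||]//; rewrite ?lte_fin => r0.
- rewrite decay_fin -mulNr EFinB -exponential_prob_itv0c// /exponential_prob.
  have m D : measurable D -> measurable_fun D (fun x => (exponential_pdf a x)%:E).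
    by move=> mD; apply/measurable_EFinP; apply: measurable_funTS; exact: measurable_exponential_pdf.
  rewrite -integral_itv_bndo_bndc; last by apply: m; exact: measurable_itv.
  rewrite [RHS]integral_mkcond; apply: eq_integral => s _.
  rewrite patchE lte_fin; case: ifPn; rewrite ?inE ?notin_setE/= in_itv/=.
    by move=> /andP[_ ->]; rewrite mulr1.
  move=> /negP; rewrite negb_and -ltNge => /orP[s0|/negPf ->]; last by rewrite mulr0.
  by rewrite lt0_exponential_pdf// mul0r.
- rewrite decay_infty// subr0 -(integral_exponential_pdf a0).
  by apply: eq_integral => s _; rewrite ltry mulr1.
Qed.

(* Tonelli applied to [1 - e^{-aV} = \int a e^{-as} 1_{s < V} ds] turns the
   survival function of [V] into its Laplace transform. *)
Lemma laplace_exponential d (Omega : measurableType d) (Pr : probability Omega R)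
    (Z : Omega -> R) (V : Omega -> \bar R) (a lam K : R) :
  measurable_fun [set: Omega] Z -> (forall w, 0 <= Z w) ->
  measurable_fun [set: Omega] V -> (forall w, (0 < V w)%E) ->
  0 <= a -> 0 <= lam -> 0 < lam + a ->
  (forall s, 0 <= s ->
    (\int[Pr]_w (Z w * (s%:E < V w)%E%:R)%:E = (K * expR (- (lam * s)))%:E)%E) ->
  (\int[Pr]_w (Z w * decay a (V w))%:E = (K * (lam / (lam + a)))%:E)%E.
Proof.
move=> mZ Z0 mV V0 a0 lam0 la0 H.
have ZK : (\int[Pr]_w (Z w)%:E = K%:E)%E.
  have := H 0 (lexx _); rewrite mulr0 oppr0 expR0 mulr1 => <-.
  by apply: eq_integral => w _; rewrite V0 mulr1.
move: a0; rewrite le_eqVlt => /predU1P[a0|a0].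
  rewrite -a0 addr0 divff ?mulr1 -?ZK; last by rewrite -a0 addr0 in la0; rewrite gt_eqF.
  by apply: eq_integral => w _; rewrite decay0 mulr1.
have V0' w : (0 <= V w)%E := ltW (V0 w).
have d01 w := decay01 (ltW a0) (V0' w).
have la_neq : lam + a != 0 by rewrite gt_eqF.
pose F (q : Omega * R) : \bar R :=
  (Z q.1 * (exponential_pdf a q.2 * (q.2%:E < V q.1)%E%:R))%:E.
have pdf0 s : 0 <= exponential_pdf a s by apply: exponential_pdf_ge0; exact: ltW.
have F0 q : (0 <= F q)%E by rewrite lee_fin !mulr_ge0.
have mF : measurable_fun [set: Omega * R] F.
  apply/measurable_EFinP; apply: measurable_funM.
    by apply: measurableT_comp => //; exact: measurable_fst.
  apply: measurable_funM.
    by apply: measurableT_comp; [exact: measurable_exponential_pdf|exact: measurable_snd].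
  apply: bool_measurable; rewrite -[X in measurable X]setTI.
  apply: measurable_lte => //.
    by apply/measurable_EFinP; exact: measurable_snd.
  by apply: measurableT_comp => //; exact: measurable_fst.
have := fubini_tonelli (m1 := Pr) (m2 := mu) F mF F0.
have -> : (\int[Pr]_w \int[mu]_s F (w, s) = \int[Pr]_w (Z w * (1 - decay a (V w)))%:E)%E.
  apply: eq_integral => w _; rewrite EFinM -exponential_tail//.
  rewrite -ge0_integralZl_EFin//.
  - by move=> s _; rewrite lee_fin mulr_ge0.
  - apply/measurable_EFinP; apply: measurable_funM; first exact: measurable_exponential_pdf.
    apply: bool_measurable; rewrite -[X in measurable X]setTI.
    by apply: measurable_lte => //; exact: measurable_cst.
have -> : (\int[mu]_s \int[Pr]_w F (w, s) = (K * (a / (lam + a)))%:E)%E.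
  (* The density of rate [a] times the survival function of rate [lam] is [a / (lam + a)] times the
     density of rate [lam + a], which has integral 1. *)
  transitivity (\int[mu]_s ((K * (a / (lam + a)))%:E * (exponential_pdf (lam + a) s)%:E))%E.
    apply: eq_integral => s _.
    have [s0|s0] := ltP s 0.
      rewrite lt0_exponential_pdf// mule0 integral0_eq// => w _.
      by rewrite /F/= lt0_exponential_pdf// mul0r mulr0.
    transitivity (\int[Pr]_w ((exponential_pdf a s)%:E * (Z w * (s%:E < V w)%E%:R)%:E))%E.
      by apply: eq_integral => w _; rewrite /F/= -EFinM; congr (_%:E); ring.
    rewrite ge0_integralZl_EFin//.
    - rewrite H// !exponential_pdfE// -!EFinM; congr (_%:E).
      rewrite (_ : - (lam + a) * s = - (lam * s) + - a * s); last by ring.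
      by rewrite expRD; field.
    - by move=> w _; rewrite lee_fin mulr_ge0.
    - apply/measurable_EFinP; apply: measurable_funM => //.
      apply: bool_measurable; rewrite -[X in measurable X]setTI.
      by apply: measurable_lte => //; exact: measurable_cst.
  have K0 : 0 <= K.
    by rewrite -lee_fin -ZK; apply: integral_ge0 => w _; rewrite lee_fin.
  rewrite ge0_integralZl_EFin ?integral_exponential_pdf ?mule1//.
  - by move=> s _; rewrite lee_fin exponential_pdf_ge0// ltW.
  - by apply/measurable_EFinP; exact: measurable_exponential_pdf.
  - by rewrite mulr_ge0// divr_ge0 ?ltW.
move=> E; have md : measurable_fun [set: Omega] (fun w => decay a (V w)).
  by apply: measurable_decay => //; exact: ltW.
have split_int : (K%:E = \int[Pr]_w (Z w * (1 - decay a (V w)))%:E + \int[Pr]_w (Z w * decay a (V w))%:E)%E.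
  rewrite -ZK -ge0_integralD//.
  - by apply: eq_integral => w _; rewrite -EFinD; congr (_%:E); ring.
  - by move=> w _; rewrite lee_fin mulr_ge0// subr_ge0; case/andP: (d01 w).
  - apply/measurable_EFinP; apply: measurable_funM => //.
    by apply: measurable_funB => //; exact: measurable_cst.
  - by move=> w _; rewrite lee_fin mulr_ge0//; case/andP: (d01 w).
  - by apply/measurable_EFinP; exact: measurable_funM.
move: split_int; rewrite E; case: (\int[Pr]_w (Z w * decay a (V w))%:E)%E => [r||]//.
rewrite -EFinD => /eqP; rewrite eqe => /eqP h; congr (_%:E).
have : K * (lam / (lam + a)) + K * (a / (lam + a)) = K by field.
lra.
Qed.

End ExponentialLaw.

(** * Joint law of the states and exponentially weighted holding times *)

Section ChainExpectations.
Context {R : realType} {X : countType} (g : graph X R).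
Context d (Omega : measurableType d) (P : X -> probability Omega R).
Variables (Y : nat -> Omega -> X) (S : nat -> Omega -> \bar R).
Hypothesis degp : forall x, 0 < deg g x.
Hypothesis chain : minimal_chain g P Y S.
Implicit Types (x z : X) (y : nat -> X).

Let S_gt0 := holding_gt0 chain.
Let mY := chain_measurable chain.
Let mS := holding_measurable chain.

Lemma jump_rate_ge0 x : 0 <= jump_rate g x.
Proof. by rewrite jump_rateE; apply: rsum_ge0 => z; exact: b_ge0. Qed.

(** The indicator of a cylinder, as a product so that prescribing one more state adds one factor. *)
Definition on_path n y w : R := \prod_(i < n.+1) (Y i w == y i)%:R.

Lemma prod_bool n (B : nat -> bool) :
  \prod_(i < n) (B i)%:R = [forall i : 'I_n, B i]%:R :> R.
Proof.
case: forallP => [H|/existsNP[i /negP/negPf Bi]]; first by rewrite big1// => i _; rewrite H.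
by rewrite (bigD1 i)//= Bi mul0r.
Qed.

Lemma on_pathE n y w : on_path n y w = [forall i : 'I_n.+1, Y i w == y i]%:R.
Proof. exact: (prod_bool n.+1 (fun i => Y i w == y i)). Qed.

Lemma on_path_ge0 n y w : 0 <= on_path n y w.
Proof. by rewrite on_pathE ler0n. Qed.

Lemma on_path_eq n y w i : on_path n y w != 0 -> (i <= n)%N -> Y i w = y i.
Proof.
rewrite on_pathE; case: forallP => [H _ ilen|]; last by rewrite eqxx.
by have /eqP := H (Ordinal (ilen : (i < n.+1)%N)).
Qed.

Lemma measurable_at n x : measurable_fun [set: Omega] (fun w => (Y n w == x)%:R : R).
Proof.
apply: bool_measurable; rewrite (_ : [set _ | _] = [set w | Y n w = x])//.
by apply/seteqP; split => w /= /eqP.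
Qed.

Lemma measurable_on_path n y : measurable_fun [set: Omega] (on_path n y).
Proof. by apply: measurable_prod => i _; exact: measurable_at. Qed.

Lemma measurable_holding_gt n (s : R) :
  measurable_fun [set: Omega] (fun w => (s%:E < S n w)%E%:R : R).
Proof.
apply: bool_measurable; rewrite -[X in measurable X]setTI.
by apply: measurable_lte.
Qed.

Definition path_weight n x y : R :=
  (x == y 0%N)%:R * \prod_(i < n) jump_prob g (y i) (y i.+1).

(* [f i = None] selects the weight [exp (- c S)] of the i-th holding time and
   [f i = Some s] the indicator of [s < S]: the law of the chain gives the
   expectation for indicators only, and the indicators are replaced by weights
   one at a time. *)
Definition factor y (f : nat -> option R) i w : R :=
  if f i is Some s then (s%:E < S i w)%E%:R else decay (c g (y i)) (S i w).

Definition factor_mean y (f : nat -> option R) i : R :=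
  if f i is Some s then expR (- (jump_rate g (y i) * s))
  else jump_rate g (y i) / deg g (y i).

Lemma factor_ge0 y f i w : 0 <= factor y f i w.
Proof.
rewrite /factor; case: (f i) => [s|]; first by rewrite ler0n.
by case/andP: (decay01 (c_ge0 g (y i)) (ltW (S_gt0 i w))).
Qed.

Lemma measurable_factor y f i : measurable_fun [set: Omega] (factor y f i).
Proof.
rewrite /factor; case: (f i) => [s|]; first exact: measurable_holding_gt.
by apply: measurable_decay; [exact: c_ge0|move=> t; exact: ltW (S_gt0 i t)|exact: mS].
Qed.

Lemma holding_survival_law n x y (s : nat -> R) : (forall i, 0 <= s i) ->
  (\int[P x]_w (on_path n y w * \prod_(i < n.+1) ((s i)%:E < S i w)%E%:R)%:E =
   (path_weight n x y * \prod_(i < n.+1) expR (- (jump_rate g (y i) * s i)))%:E)%E.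
Proof.
move=> s0; pose A := [set w | forall i, (i <= n)%N -> Y i w = y i /\ ((s i)%:E < S i w)%E].
have E w : on_path n y w * \prod_(i < n.+1) ((s i)%:E < S i w)%E%:R = \1_A w :> R.
  rewrite -big_split/= indicE.
  under eq_bigr do rewrite -natrM mulnb.
  rewrite (prod_bool n.+1 (fun i => (Y i w == y i) && ((s i)%:E < S i w)%E)).
  rewrite (_ : (w \in A) = [forall i : 'I_n.+1, (Y i w == y i) && ((s i)%:E < S i w)%E])//.
  apply/idP/idP => [|/forallP H].
    rewrite inE => H; apply/forallP => i; have [-> ->] := H i (ltn_ord i).
    by rewrite eqxx.
  rewrite inE => i ilen; by have /andP[/eqP ? ?] := H (Ordinal (ilen : (i < n.+1)%N)).
have mA : measurable A.
  apply/(@measurable_indicP _ _ R); rewrite (_ : \1_A = (fun w => on_path n y w * \prod_(i < n.+1) ((s i)%:E < S i w)%E%:R)).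
    apply: measurable_funM; first exact: measurable_on_path.
    by apply: measurable_prod => i _; exact: measurable_holding_gt.
  by apply/funext => w; rewrite E.
under eq_integral do rewrite E.
rewrite integral_indic// setIT EFinM.
have := holding_law chain x n y s0; rewrite (chain_law chain x n y); exact.
Qed.

Lemma factor_law n x y (f : nat -> option R) :
  (forall i s, f i = Some s -> 0 <= s) ->
  (\int[P x]_w (on_path n y w * \prod_(i < n.+1) factor y f i w)%:E =
   (path_weight n x y * \prod_(i < n.+1) factor_mean y f i)%:E)%E.
Proof.
(* [k] bounds the indices that still carry a weight; at [k = 0] only indicators remain and
   [holding_survival_law] applies. *)
suff H k : forall f, (forall i s, f i = Some s -> 0 <= s) ->
    (forall i, (i <= n)%N -> f i = None -> (i < k)%N) ->
  (\int[P x]_w (on_path n y w * \prod_(i < n.+1) factor y f i w)%:E =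
   (path_weight n x y * \prod_(i < n.+1) factor_mean y f i)%:E)%E.
  by move=> f0; apply: (H n.+1).
elim: k => [|k IH] {}f f0 fk.
  have fS i : (i <= n)%N -> f i = Some (odflt 0 (f i)).
    by move=> ilen; case E : (f i) => [s|]//; have := fk i ilen E.
  have -> : \prod_(i < n.+1) factor_mean y f i =
      \prod_(i < n.+1) expR (- (jump_rate g (y i) * odflt 0 (f i))).
    by apply: eq_bigr => i _; rewrite /factor_mean (fS i (ltn_ord i)).
  rewrite -(@holding_survival_law n x y (fun i => odflt 0 (f i))); last by move=> i; case E : (f i) => [s|]//=; exact: f0 E.
  apply: eq_integral => w _; congr (_ * _)%:E; apply: eq_bigr => i _.
  by rewrite /factor (fS i (ltn_ord i)).
have [kn|nk] := leqP k n; last first.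
  by apply: IH => // i ilen _; exact: leq_ltn_trans ilen nk.
case fkE : (f k) => [s|].
  apply: IH => // i ilen fi; have := fk i ilen fi; rewrite ltnS leq_eqVlt => /predU1P[ik|//].
  by move: fi; rewrite ik fkE.
pose k' := Ordinal (kn : (k < n.+1)%N).
(* The induction hypothesis for [fr s], at all [s >= 0], is the survival function that
   [laplace_exponential] requires of [S k]; the other factors make up [Z]. *)
pose fr r i := if i == k then Some r else f i.
have frE r (i : 'I_n.+1) : i != k' -> fr r i = f i.
  by move=> ik; rewrite /fr ifF//; apply/negbTE; apply: contra ik => /eqP ik; apply/eqP/val_inj.
pose Z w := on_path n y w * \prod_(i < n.+1 | i != k') factor y f i w.
pose K := path_weight n x y * \prod_(i < n.+1 | i != k') factor_mean y f i.
transitivity (\int[P x]_w (Z w * decay (c g (y k)) (S k w))%:E)%E.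
  apply: eq_integral => w _; congr (_%:E); rewrite (bigD1 k')//= /Z {1}/factor fkE; ring.
rewrite (laplace_exponential (lam := jump_rate g (y k)) (K := K)).
- congr (_%:E); rewrite [RHS](_ : _ = path_weight n x y * (factor_mean y f k * \prod_(i < n.+1 | i != k') factor_mean y f i)); last first.
    by congr (_ * _); rewrite (bigD1 k').
  by rewrite {1}/factor_mean fkE /K /deg; ring.
- apply: measurable_funM; first exact: measurable_on_path.
  rewrite (_ : (fun w => _) = fun w => \prod_(i <- [seq i <- index_enum 'I_n.+1 | i != k']) factor y f i w).
    by apply: measurable_prod => i _; exact: measurable_factor.
  by apply/funext => w; rewrite big_filter.
- by move=> w; rewrite mulr_ge0 ?on_path_ge0// prodr_ge0// => i _; exact: factor_ge0.
- exact: mS.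
- by move=> w; exact: S_gt0.
- exact: c_ge0.
- exact: jump_rate_ge0.
- exact: degp.
move=> s s0.
transitivity (\int[P x]_w (on_path n y w * \prod_(i < n.+1) factor y (fr s) i w)%:E)%E.
  apply: eq_integral => w _; congr (_%:E); rewrite [in RHS](bigD1 k')//=.
  rewrite /factor {1}/fr eqxx -/(factor y f) /Z mulrAC mulrA; congr (_ * _).
  by apply: eq_bigr => i ik; rewrite frE.
rewrite (IH (fr s)).
- congr (_%:E); rewrite (bigD1 k')//= {1}/factor_mean {1}/fr eqxx /K mulrCA [RHS]mulrC; congr (_ * (_ * _)).
  by apply: eq_bigr => i ik; rewrite /factor_mean frE.
- by move=> i r; rewrite /fr; case: eqP => [_ [<-]//|_]; exact: f0.
- move=> i ilen; rewrite /fr; case: eqP => // ik fi.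
  have := fk i ilen fi; rewrite ltnS leq_eqVlt => /predU1P[//|//].
Qed.

End ChainExpectations.

(** * Survival expectations and almost sure infinite killing *)

Section KillingAlongPaths.
Context {R : realType} {X : countType} (g : graph X R) (o : X).
Context d (Omega : measurableType d) (P : X -> probability Omega R).
Variables (Y : nat -> Omega -> X) (S : nat -> Omega -> \bar R).
Hypothesis trans : transient g o.
Hypothesis chain : minimal_chain g P Y S.
Implicit Types (x z : X) (y : nat -> X).

Let S_gt0 := holding_gt0 chain.
Let mY := chain_measurable chain.
Let mS := holding_measurable chain.
Let degp := deg_gt0 trans.

(** Unlike [stay_killing], this also counts indices after an infinite holding time. Each term then
    involves only the k-th state and holding time, so expectations factor along a path. *)
Definition killed k w : \bar R := ((c g (Y k w))%:E * S k w)%E.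

Lemma killed_ge0 k w : (0 <= killed k w)%E.
Proof. by rewrite mule_ge0 ?lee_fin ?c_ge0// ltW. Qed.

Lemma measurable_killed k : measurable_fun [set: Omega] (killed k).
Proof.
apply: emeasurable_funM; last exact: mS.
by apply/measurable_EFinP; exact: (measurable_state mY (c g)).
Qed.

Definition survive n w : R := decay 1 (\sum_(k < n) killed k w)%E.

Lemma surviveE n w : survive n w = \prod_(k < n) decay (c g (Y k w)) (S k w).
Proof.
rewrite /survive (@decay_sum _ (killed ^~ w)); last by move=> k; exact: killed_ge0.
by apply: eq_bigr => k _; rewrite /decay mul1e.
Qed.

Lemma killed_sum_ge0 n w : (0 <= \sum_(k < n) killed k w)%E.
Proof. by apply: sume_ge0 => k _; exact: killed_ge0. Qed.

Lemma survive01 n w : 0 <= survive n w <= 1.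
Proof. exact: decay01 (killed_sum_ge0 n w). Qed.

Lemma survive_ge0 n w : 0 <= survive n w.
Proof. by case/andP: (survive01 n w). Qed.

Lemma measurable_survive n : measurable_fun [set: Omega] (survive n).
Proof.
apply: measurable_decay => //; first exact: killed_sum_ge0.
by apply: emeasurable_sum => k; exact: measurable_killed.
Qed.

Lemma integral_state k x (F : Omega -> R) : measurable_fun [set: Omega] F ->
  (forall w, 0 <= F w) ->
  (\int[P x]_w (F w)%:E = \esum_(z in [set: X]) \int[P x]_w ((Y k w == z)%:R * F w)%:E)%E.
Proof.
move=> mF F0; rewrite -integral_esum//; last 2 first.
- by move=> z w _; rewrite lee_fin mulr_ge0.
- move=> z; apply/measurable_EFinP; apply: measurable_funM => //.
  exact: (measurable_at chain).
apply: eq_integral => w _; rewrite -(nnsum_single (Y k w) (F0 w)).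
by apply: eq_esum => z _; rewrite eq_sym.
Qed.

Definition update y k z : nat -> X := fun i => if i == k then z else y i.

Lemma update_lt y k z i : (i < k)%N -> update y k z i = y i.
Proof. by move=> ik; rewrite /update ltn_eqF. Qed.

Lemma update_at y k z : update y k z k = z.
Proof. by rewrite /update eqxx. Qed.

Lemma on_path_update k y z w :
  on_path Y k.+1 (update y k.+1 z) w = on_path Y k y w * (Y k.+1 w == z)%:R :> R.
Proof.
rewrite /on_path big_ord_recr/= update_at; congr (_ * _).
by apply: eq_bigr => i _; rewrite update_lt.
Qed.

Lemma path_weight_update k x y z :
  path_weight g k.+1 x (update y k.+1 z) = path_weight g k x y * jump_prob g (y k) z.
Proof.
rewrite /path_weight big_ord_recr/= update_at !update_lt// mulrA; congr (_ * _ * _).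
by apply: eq_bigr => i _; rewrite !update_lt ?ltnS// ltnW.
Qed.

Lemma integral_extend_path k x y (F : Omega -> R) : measurable_fun [set: Omega] F ->
  (forall w, 0 <= F w) ->
  (\int[P x]_w (on_path Y k y w * F w)%:E =
   \esum_(z in [set: X]) \int[P x]_w (on_path Y k.+1 (update y k.+1 z) w * F w)%:E)%E.
Proof.
move=> mF F0; rewrite (integral_state k.+1).
- apply: eq_esum => z _; apply: eq_integral => w _; congr (_%:E).
  by rewrite on_path_update; ring.
- by apply: measurable_funM => //; exact: measurable_on_path chain _ _.
- by move=> w; rewrite mulr_ge0// on_path_ge0.
Qed.

Lemma integral_start x (F : Omega -> R) : measurable_fun [set: Omega] F ->
  (forall w, 0 <= F w) ->
  (\int[P x]_w (F w)%:E =
   \esum_(z in [set: X]) \int[P x]_w (on_path Y 0 (fun=> z) w * F w)%:E)%E.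
Proof.
move=> mF F0; rewrite (integral_state 0)//; apply: eq_esum => z _.
by apply: eq_integral => w _; rewrite /on_path big_ord_recr big_ord0/= mul1r.
Qed.

Definition no_kill x : R := jump_rate g x / deg g x.

(** At jump rate 0 the jump chain stays put, but then [no_kill] and all weights [b x z] vanish. *)
Lemma no_kill_jump_prob x z : no_kill x * jump_prob g x z = b g x z / deg g x.
Proof.
rewrite /no_kill /jump_prob; case: eqP => [j0|/eqP j0]; last by field; rewrite j0 gt_eqF.
rewrite j0 !mul0r; have : rsum (b g x) = 0 by rewrite -jump_rateE.
by move=> /(rsum_eq0 (b_ge0 g x) (b_summ g x)) ->; rewrite mul0r.
Qed.

Lemma nnsum_surv_n n x : nnsum (fun z => b g x z / deg g x * surv_n g n z) = (surv_n g n.+1 x)%:E.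
Proof.
have v0 z : 0 <= surv_n g n z by case/andP: (surv_n01 trans n z).
have bv0 z : 0 <= b g x z * surv_n g n z by rewrite mulr_ge0 ?b_ge0.
rewrite /= mulrC EFinM /adj EFin_rsum//; last first.
  apply: summ_ge0 => //; have /formal_domE := surv_n_formal trans n; exact.
rewrite -nnsumZ ?invr_ge0 ?deg_ge0//; congr nnsum; apply/funext => z; ring.
Qed.

Lemma survive_on_path n x y :
  (\int[P x]_w (on_path Y n y w * survive n w)%:E =
   (path_weight g n x y * \prod_(i < n) no_kill (y i))%:E)%E.
Proof.
(* The path has [n + 1] states but only [n] weights; the last factor is the indicator of [0 < S n],
   which is 1. *)
pose f i := if (i < n)%N then None else Some (0 : R).
have f0 i r : f i = Some r -> 0 <= r by rewrite /f; case: ifP => // _ [<-].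
have fn : f n = Some 0 by rewrite /f ltnn.
have := factor_law degp chain n x y f0.
rewrite [\prod_(i < n.+1) factor_mean g y f i]big_ord_recr/= {2}/factor_mean fn.
rewrite mulr0 oppr0 expR0 mulr1.
have -> : \prod_(i < n) factor_mean g y f i = \prod_(i < n) no_kill (y i).
  by apply: eq_bigr => i _; rewrite /factor_mean /f ltn_ord.
move=> <-.
apply: eq_integral => w _; congr (_%:E).
have [->|on] := eqVneq (on_path Y n y w) (0 : R); first by rewrite !mul0r.
congr (_ * _); rewrite big_ord_recr/= {2}/factor fn S_gt0 mulr1 surviveE.
by apply: eq_bigr => i _; rewrite /factor /f ltn_ord (on_path_eq on)// ltnW.
Qed.

(** The Markov property for survival. In the induction on [m] the next state is summed over, which
    reproduces the recursion of [surv_n]. *)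
Lemma survive_from_path m n x y :
  (\int[P x]_w (on_path Y n y w * survive (n + m) w)%:E =
   (path_weight g n x y * \prod_(i < n) no_kill (y i) * surv_n g m (y n))%:E)%E.
Proof.
elim: m n y => [|m IH] n y; first by rewrite addn0 survive_on_path/= mulr1.
rewrite integral_extend_path; [|exact: measurable_survive|exact: survive_ge0].
pose K := path_weight g n x y * \prod_(i < n) no_kill (y i).
have K0 : 0 <= K.
  rewrite -lee_fin -survive_on_path; apply: integral_ge0 => w _.
  by rewrite lee_fin mulr_ge0 ?on_path_ge0 ?survive_ge0.
rewrite -[_ * surv_n g _ _]/(K * surv_n g m.+1 (y n)) EFinM -nnsum_surv_n -nnsumZ//; last first.
  by move=> z; rewrite mulr_ge0 ?divr_ge0 ?b_ge0 ?deg_ge0//; case/andP: (surv_n01 trans m z).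
apply: eq_esum => z _; rewrite -addSnnS IH update_at path_weight_update; congr (_%:E).
rewrite big_ord_recr/= update_lt// -no_kill_jump_prob.
rewrite (eq_bigr (fun i : 'I_n => no_kill (y i))); first by rewrite /K; ring.
by move=> i _; rewrite update_lt// ltnS ltnW.
Qed.

Lemma integral_survive n x : (\int[P x]_w (survive n w)%:E = (surv_n g n x)%:E)%E.
Proof.
rewrite integral_start; [|exact: measurable_survive|exact: survive_ge0].
have v0 : 0 <= surv_n g n x by case/andP: (surv_n01 trans n x).
rewrite -(nnsum_single x v0); apply: eq_esum => z _.
rewrite -[n in survive n]add0n survive_from_path /path_weight !big_ord0 !mulr1 eq_sym.
by congr (_%:E); case: eqP => [->|]; rewrite ?mul0r.
Qed.

Definition total_killed w : \bar R := (\sum_(k <oo) killed k w)%E.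

Lemma total_killed_ge0 w : (0 <= total_killed w)%E.
Proof. by apply: nneseries_ge0 => k _ _; exact: killed_ge0. Qed.

Lemma measurable_total_killed : measurable_fun [set: Omega] total_killed.
Proof.
apply: ge0_emeasurable_sum => k; first by move=> w _ _; exact: killed_ge0.
by move=> _; exact: measurable_killed.
Qed.

Lemma survive_cvg w : survive n w @[n --> \oo] --> decay 1 (total_killed w).
Proof.
apply: decay_cvg; [by move=> n; exact: killed_sum_ge0| |exact: total_killed_ge0].
under eq_fun do rewrite -(big_mkord xpredT (fun k => killed k w)).
by apply: is_cvg_nneseries => k _ _; exact: killed_ge0.
Qed.

Lemma measurable_decay_total : measurable_fun [set: Omega] (fun w => decay 1 (total_killed w)).
Proof.
by apply: measurable_decay => //; [exact: total_killed_ge0|exact: measurable_total_killed].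
Qed.

Lemma integral_decay_total x :
  (\int[P x]_w (decay 1 (total_killed w))%:E = (surv g x)%:E)%E.
Proof.
have [_ _ H] := @dominated_convergence _ _ _ (P x) setT measurableT
  (fun n w => (survive n w)%:E) (fun w => (decay 1 (total_killed w))%:E) (cst 1%E)
  (fun n => (proj2 (measurable_EFinP _ _) (measurable_survive n)))
  (proj2 (measurable_EFinP _ _) measurable_decay_total)
  ltac:(by apply: nearW => w _; apply: cvg_EFin; [exact: nearW|exact: survive_cvg])
  ltac:(exact: finite_measure_integrable_cst)
  ltac:(by apply: nearW => w n _; rewrite /= lee_fin ger0_norm ?survive_ge0//; case/andP: (survive01 n w)).
have E : (fun n => \int[P x]_(w in setT) (survive n w)%:E)%E = (fun n => (surv_n g n x)%:E).
  by apply/funext => n; rewrite integral_survive.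
move: H; rewrite [X in X @ _]E => H; apply: (cvg_unique _ H) => //.
apply: cvg_EFin; first exact: nearW.
exact: (surv_cvg trans).
Qed.

(** The paths of a given length are countably many and cover [Omega]; they are shortened one state
    at a time. *)
Lemma null_of_null_on_paths k x (F : Omega -> R) : measurable_fun [set: Omega] F ->
  (forall w, 0 <= F w) ->
  (forall y, \int[P x]_w (on_path Y k y w * F w)%:E = 0)%E ->
  (\int[P x]_w (F w)%:E = 0)%E.
Proof.
move=> mF F0; elim: k => [|k IH] H.
  by rewrite integral_start//; apply: esum1 => z _.
by apply: IH => y; rewrite integral_extend_path//; apply: esum1 => z _.
Qed.

Lemma path_no_infinite_holding k x y : 0 < jump_rate g (y k) ->
  (\int[P x]_w (on_path Y k y w * (S k w == +oo)%E%:R)%:E = 0)%E.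
Proof.
move=> j0; set I := (\int[P x]_w _)%E.
have I0 : (0 <= I)%E by apply: integral_ge0 => w _; rewrite lee_fin mulr_ge0 ?on_path_ge0.
pose K := path_weight g k x y.
have H s : 0 <= s -> (I <= (K * expR (- (jump_rate g (y k) * s)))%:E)%E.
  move=> s0; pose f i := if i == k then s else 0.
  have f0 i : 0 <= f i by rewrite /f; case: ifP.
  have fk : f k = s by rewrite /f eqxx.
  have := holding_survival_law chain k x y f0.
  rewrite big_ord_recr/= fk big1 ?mul1r => [|i _]; last first.
    by rewrite /f ltn_eqF// mulr0 oppr0 expR0.
  move=> <-; apply: ge0_le_integral => //.
  - by move=> w _; rewrite lee_fin mulr_ge0 ?on_path_ge0.
  - apply/measurable_EFinP; apply: measurable_funM; first exact: measurable_on_path chain _ _.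
    apply: bool_measurable; rewrite (_ : [set _ | _] = S k @^-1` [set +oo%E]).
      by rewrite -[X in measurable X]setTI; exact: mS.
    by apply/seteqP; split => w /= /eqP.
  - apply/measurable_EFinP; apply: measurable_funM; first exact: measurable_on_path chain _ _.
    by apply: measurable_prod => i _; exact: measurable_holding_gt chain _ _.
  - move=> w _; rewrite lee_fin ler_wpM2l ?on_path_ge0//.
    rewrite (prod_bool _ (fun i => (f i)%:E < S i w)%E); case: eqP => [Sk|]; last by rewrite ler0n.
    rewrite ler_nat lt0b; apply/forallP => i; rewrite /f; case: eqP => [->|_]; last exact: S_gt0.
    by rewrite Sk ltry.
have Ifin : I \is a fin_num by rewrite ge0_fin_numE// (le_lt_trans (H 0 (lexx _)))// ltry.
move: I0 H; rewrite -(fineK Ifin); set r := fine I => r0 H.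
apply/eqP; rewrite eq_le r0 andbT leNgt lte_fin; apply/negP => rp.
(* If [r > 0], then at this time [e^u >= 1 + u] turns [r <= K e^{-u}], with [u = K / r], into
   [K + r <= K]. *)
have s0 : 0 <= K / (r * jump_rate g (y k)).
  have := le_trans r0 (H 0 (lexx _)); rewrite mulr0 oppr0 expR0 mulr1 lee_fin => K0.
  by rewrite divr_ge0// mulr_ge0 ?ltW.
have := H _ s0; rewrite lee_fin expRN ler_pdivlMr ?expR_gt0// leNgt => /negP; apply.
apply: (@lt_le_trans _ _ (r * (1 + jump_rate g (y k) * (K / (r * jump_rate g (y k)))))).
  rewrite (_ : r * _ = K + r); first by rewrite ltrDl.
  by field; rewrite !gt_eqF.
by rewrite ler_wpM2l ?expR_ge1Dx// ltW.
Qed.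

(** A vertex without killing has positive jump rate because [deg > 0], so its holding times are
    almost surely finite. *)
Lemma ae_infinite_holding x :
  {ae P x, forall w, forall k, S k w = +oo%E -> c g (Y k w) != 0}.
Proof.
apply: ae_foralln => k; pose F w : R := ((c g (Y k w) == 0) && (S k w == +oo%E))%:R.
have mF : measurable_fun [set: Omega] F.
  apply: bool_measurable.
  rewrite (_ : [set _ | _] = ((fun w => c g (Y k w)) @^-1` [set 0]) `&` (S k @^-1` [set +oo%E])).
    apply: measurableI; rewrite -[X in measurable X]setTI; last exact: mS.
    exact: (measurable_state mY (c g)).
  by apply/seteqP; split => w /=; [move=> /andP[/eqP ? /eqP ?]|move=> [-> ->]; rewrite !eqxx].
have F0 w : 0 <= F w by rewrite ler0n.
have : (\int[P x]_w (F w)%:E = 0)%E.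
  apply: (@null_of_null_on_paths k) => // y.
  have [cy|cy] := eqVneq (c g (y k)) 0.
    rewrite -[RHS](@path_no_infinite_holding k x y); last first.
      by have := degp (y k); rewrite /deg cy addr0.
    apply: eq_integral => w _; congr (_%:E).
    have [->|on] := eqVneq (on_path Y k y w) (0 : R); first by rewrite !mul0r.
    by rewrite /F (on_path_eq on)// cy eqxx.
  apply: integral0_eq => w _.
  have [->|on] := eqVneq (on_path Y k y w) (0 : R); first by rewrite !mul0r.
  by rewrite /F (on_path_eq on)// (negPf cy) mulr0.
have -> : (\int[P x]_w (F w)%:E = \int[P x]_(w in setT) `|(F w)%:E|)%E.
  by apply: eq_integral => w _; rewrite gee0_abs ?lee_fin.
move=> /(ae_eq_integral_abs _ measurableT (proj2 (measurable_EFinP _ _) mF)).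
apply: filterS => w /(_ I) [Fw] Sw; apply/negP => cw.
by move: Fw; rewrite /F cw Sw eqxx => /eqP; rewrite oner_eq0.
Qed.

Lemma prob1_ae x (A : set Omega) : measurable A -> P x A = 1%E <-> {ae P x, forall w, A w}.
Proof.
move=> mA; have mAC : measurable (~` A) by exact: measurableC.
have -> : {ae P x, forall w, A w} <-> P x (~` A) = 0%E := negligibleP (P x) mAC.
split=> PA; first by rewrite probability_setC// PA subee.
by rewrite -[A]setCK probability_setC// PA sube0.
Qed.

(** Since [surv x] is the mean of a nonnegative variable, it vanishes iff [total_killed] is almost
    surely infinite. One direction then uses [total_killing <= total_killed]; the converse needs
    [ae_infinite_holding], as the two differ after an infinite holding time. *)
Lemma killing_infinite_iff x :
  P x [set w | total_killing g Y S w = +oo%E] = 1%E <-> surv g x = 0.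
Proof.
rewrite prob1_ae; last exact: measurable_total_killing S_gt0 mY mS.
have mD := proj2 (measurable_EFinP _ _) measurable_decay_total.
have D0 w : 0 <= decay 1 (total_killed w).
  by case/andP: (decay01 ler01 (total_killed_ge0 w)).
have WE : (surv g x)%:E = (\int[P x]_(w in setT) `|(decay 1 (total_killed w))%:E|)%E.
  rewrite -integral_decay_total; apply: eq_integral => w _.
  by rewrite gee0_abs ?lee_fin.
transitivity ({ae P x, forall w, decay 1 (total_killed w) = 0}); last first.
  split => [H|W0].
    apply: EFin_inj; rewrite WE; apply/(ae_eq_integral_abs _ measurableT mD).
    by apply: filterS H => w /= -> _.
  move: WE; rewrite W0 => /esym /(ae_eq_integral_abs _ measurableT mD).
  by apply: filterS => w /(_ I) [].
split => [|H].
  apply: filterS => w A; have := total_killing_le g Y S_gt0 w.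
  rewrite A leye_eq => /eqP B; rewrite /total_killed /killed B.
  exact: decay_infty.
apply: filterS (filterI H (ae_infinite_holding x)) => w [D Hw].
apply: total_killing_infty => //; apply/eqP; rewrite -leye_eq leNgt; apply/negP => B.
have Bfin : total_killed w \is a fin_num by rewrite ge0_fin_numE// total_killed_ge0.
move: D; rewrite -(fineK Bfin) decay_fin => /eqP.
by rewrite gt_eqF// expR_gt0.
Qed.

End KillingAlongPaths.

Theorem theorem8 (R : realType) (X : countType) (o : X) (g : graph X R)
    (T : R -> (X -> R) -> (X -> R))
    (d : measure_display) (Omega : measurableType d)
    (P : X -> probability Omega R)
    (Y : nat -> Omega -> X) (S : nat -> Omega -> \bar R) :
  connected_graph g ->
  transient g o ->
  semigroup_of (opL g o) T ->
  minimal_chain g P Y S ->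
  [<-> exists x, green_c g o x = 1%E;
       forall x, green_c g o x = 1%E;
       stoch_complete_some g T /\ exists x, heat_vanishes_at T x;
       stoch_complete_all g T /\ forall x, heat_vanishes_at T x;
       exists x, P x [set w | total_killing g Y S w = +oo%E] = 1%E;
       forall x, P x [set w | total_killing g Y S w = +oo%E] = 1%E].
Proof.
move=> conn trans sg chain.
have green x := green_c_eq1 conn trans x.
have killing x := killing_infinite_iff trans chain x.
have W_const x z : surv g x = 0 -> surv g z = 0 := surv_all conn trans z.
tfae.
- by move=> [x /green Wx] z; apply/green/(W_const x).
- move=> G; have [|stoch heat] := surv0_heat conn trans sg; first by move=> z; apply/green.
  by split; [exists 1, o; split => //; exact: stoch|exists o].
- move=> [stoch heat]; have [x Wx] := heat_surv0 conn trans sg stoch heat.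
  by apply: (surv0_heat conn trans sg) => z; exact: W_const Wx.
- move=> [stoch heat]; have [||x Wx] := heat_surv0 conn trans sg.
  + by exists 1, o; split => //; exact: stoch.
  + by exists o.
  by exists x; apply/killing.
- by move=> [x /killing Wx] z; apply/killing/(W_const x).
- by move=> H; exists o; apply/green/killing.
Qed.
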